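(* Let $\Psi$ be a split affine flow on $B_1\times B_2\times H$ with lift $\Psi^1$ to $B_1\times B_2\times H^1$, let $\Phi$ be the associated linear flow on $B_2\times H$ with Selgrade bundles $\mathcal{V}_1,\dots,\mathcal{V}_\ell\subset B_2\times H$, let $\mathcal{V}_i^\infty=\mathcal{V}_i\times\{0\}\subset B_2\times H^1$, and let $e^1\in B_1$ be the given equilibrium. Then the central Selgrade bundle $\mathcal{V}_c^1\subset B_1\times B_2\times H^1$ of $\Psi^1$ satisfies $$\mathcal{V}_c^1\cap\big(\{e^1\}\times B_2\times H^1\big)=\{e^1\}\times\Big(\mathcal{P}\oplus\bigoplus\nolimits_i\mathcal{V}_i^\infty\Big),$$ where $\mathcal{P}=B_2\times\{0_H\}\times\mathbb{R}$ is the polar bundle and the sum is taken over all indices $i\in\{1,\dots,\ell\}$ such that $h^1(\mathcal{V}_i)=\{(b^2,\mathbb{P}(x,1))\mid(b^2,x)\in\mathcal{V}_i\}\subset B_2\times\mathbb{P}H^1$ is chain transitive (for the flow $\mathbb{P}\Phi^1$ on $B_2\times\mathbb{P}H^1$ induced by $\Phi^1_t(b^2,x,r)=(\Phi_t(b^2,x),r)$).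
   Context: Flows and chains: A flow on a metric space $X$ is a continuous map $\Phi:\mathbb{R}\times X\to X$ with $\Phi_0=\mathrm{id}$, $\Phi_{t+s}=\Phi_t\circ\Phi_s$. For $\varepsilon,T>0$ an $(\varepsilon,T)$-chain from $x$ to $y$ consists of $n\ge1$, $T_0,\dots,T_{n-1}\ge T$ and $x_0=x,x_1,\dots,x_n=y\in X$ with $d(\Phi_{T_i}(x_i),x_{i+1})<\varepsilon$ for $i=0,\dots,n-1$. A set $Y\subset X$ is chain transitive if for all $x,y\in Y$ and all $\varepsilon,T>0$ there is an $(\varepsilon,T)$-chain from $x$ to $y$. A chain recurrent component is a maximal chain transitive set. Linear flows and Selgrade's theorem: Let $B$ be a compact metric space with a chain transitive flow $\theta$ and $H$ a finite dimensional real Hilbert space. A linear flow on $B\times H$ is a flow $\Phi_t(b,x)=(\theta_tb,\varphi(t,b,x))$ with $\varphi(t,b,\cdot)$ linear. A subbundle is a closed subset of $B\times H$ intersecting each fiber in a linear subspace of constant dimension. $\mathbb{P}$ denotes the projections $H\setminus\{0\}\to\mathbb{P}H$ and $B\times(H\setminus\{0\})\to B\times\mathbb{P}H$. $\mathbb{P}H$ has the metric $d(\mathbb{P}x,\mathbb{P}y)=\min\{\|\frac{x}{\|x\|}-\frac{y}{\|y\|}\|,\|\frac{x}{\|x\|}+\frac{y}{\|y\|}\|\}$, and $B\times\mathbb{P}H$ the maximum metric. $\Phi$ induces a flow $\mathbb{P}\Phi$ on $B\times\mathbb{P}H$. Selgrade's theorem: $\mathbb{P}\Phi$ has finitely many chain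 recurrent components $\mathcal{M}_1,\dots,\mathcal{M}_\ell$; the sets $\mathcal{V}_i=\{(b,x)\mid x\ne0\Rightarrow(b,\mathbb{P}x)\in\mathcal{M}_i\}$ are subbundles, called the Selgrade bundles, and $B\times H=\mathcal{V}_1\oplus\dots\oplus\mathcal{V}_\ell$. Split affine flows: $B_1,B_2$ are compact metric spaces with chain transitive flows $\theta^1$ on $B_1$ and $\theta^2$ on $B_2$ (then the product flow on $B_1\times B_2$ is chain transitive), and $e^1\in B_1$ is an equilibrium, i.e. $\theta^1_te^1=e^1$ for all $t$. A split affine flow on $(B_1\times B_2)\times H$ is a continuous flow of the form $$\Psi_t(b^1,b^2,x)=\Big(\theta^1_tb^1,\ \theta^2_tb^2,\ \varphi(t,b^2,x)+\int_0^t\varphi(t-s,\theta^2_sb^2,f(b^1)(s))\,ds\Big),$$ where $\Phi=(\theta^2,\varphi)$ is a linear flow on $B_2\times H$ and $f:B_1\to L^\infty(\mathbb{R},H)$ satisfies $f(e^1)=0$ and $f(b^1)(t+s)=f(\theta^1_sb^1)(t)$ for all $b^1\in B_1$ and almost all $t,s\in\mathbb{R}$. Its lift is the linear flow on $(B_1\times B_2)\times H^1$, $H^1=H\times\mathbb{R}$ (product Hilbert norm), $\Psi^1_t(b^1,b^2,x,r)=(\theta^1_tb^1,\theta^2_tb^2,\varphi(t,b^2,x)+r\int_0^t\varphi(t-s,\theta^2_sb^2,f(b^1)(s))\,ds,r)$. There is a unique Selgrade bundle of $\Psi^1$ that intersects $B_1\times B_2\times H\times(\mathbb{R}\setminus\{0\})$;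 it is called the central Selgrade bundle $\mathcal{V}_c^1$. *)

(* Defs.v *)
From HB Require Import structures.
From mathcomp Require Import all_boot all_order all_algebra.
From mathcomp Require Import all_classical all_reals all_analysis.

Set Implicit Arguments.
Unset Strict Implicit.
Unset Printing Implicit Defensive.

Import Order.TTheory GRing.Theory Num.Theory.

Local Open Scope classical_set_scope.
Local Open Scope ring_scope.

(* Phase spaces are pairs (X, d) with an explicit distance d, since they combine
   the metric of B with the Euclidean distance on H or the metric on PH, which
   depend on the inner product. *)

Section Flows.
Context {R : realType} {X : Type}.
Implicit Types (d : X -> X -> R) (Phi : R -> X -> X) (Y : set X).

Definition jointly_continuous d Phi : Prop :=
  forall t x e, 0 < e -> exists2 delta, 0 < delta &
    forall s y, `|t - s| < delta -> d x y < delta -> d (Phi t x) (Phi s y) < e.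

Definition is_flow d Phi : Prop :=
  [/\ jointly_continuous d Phi, (forall x, Phi 0 x = x) &
      forall t s x, Phi (t + s) x = Phi t (Phi s x)].

Definition chain d Phi (e T : R) (x y : X) : Prop :=
  exists n (c : nat -> X) (tau : nat -> R),
    [/\ (0 < n)%N, c 0%N = x, c n = y &
        forall i, (i < n)%N ->
          T <= tau i /\ d (Phi (tau i) (c i)) (c i.+1) < e].

Definition chain_transitive d Phi Y : Prop :=
  forall x y, Y x -> Y y -> forall e T, 0 < e -> 0 < T -> chain d Phi e T x y.

Definition chain_recurrent_component d Phi Y : Prop :=
  chain_transitive d Phi Y /\
  forall Z, chain_transitive d Phi Z -> Y `<=` Z -> Z = Y.

End Flows.

Definition max_dist {R : realType} {X Y : Type}
    (dX : X -> X -> R) (dY : Y -> Y -> R) (p q : X * Y) : R :=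
  Num.max (dX p.1 q.1) (dY p.2 q.2).

Section Projective.
Context {R : realType} {V : vectType R}.
Variable dot : V -> V -> R.

Definition dot_norm (x : V) : R := Num.sqrt (dot x x).
Definition dot_dist (x y : V) : R := dot_norm (x - y).

Definition proj_space : Type := {L : {vspace V} | \dim L == 1%N}.

Lemma dim_vline_eq1 (x : V) : x != 0 -> \dim <[x]>%VS == 1%N.
Proof. by rewrite dim_vline => ->. Qed.

Definition proj (x : V) (x0 : x != 0) : proj_space :=
  exist _ <[x]>%VS (dim_vline_eq1 x0).

(* vpick L is a nonzero vector of the line L; the choice is irrelevant, see
   proj_distE. *)
Definition unit_pick (p : proj_space) : V :=
  (dot_norm (vpick (val p)))^-1 *: vpick (val p).

Definition proj_dist (p q : proj_space) : R :=
  Num.min (dot_norm (unit_pick p - unit_pick q))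
          (dot_norm (unit_pick p + unit_pick q)).

End Projective.

Arguments proj_space {R} V.

Section ProjDist.
Context {R : realType} {V : vectType R} (dot : {dot V for idfun}).
Local Notation norm := (dot_norm dot).
Local Notation unit x := ((norm x)^-1 *: x).

Lemma dot_normZ a x : norm (a *: x) = `|a| * norm x.
Proof.
rewrite /dot_norm.
have -> : dot (a *: x) (a *: x) = a ^+ 2 * dot x x.
  by rewrite linearZl_LR linearZr_LR /= mulrA expr2.
by rewrite sqrtrM ?sqr_ge0 // sqrtr_sqr.
Qed.

Lemma unit_pickE (x : V) (x0 : x != 0) :
  exists b : bool, unit_pick dot (proj x0) = (-1) ^+ b *: unit x.
Proof.
rewrite /unit_pick /=; set y := vpick _.
have y0 : y != 0 by rewrite vpick0 -dimv_eq0 dim_vline x0.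
have /vlineP[a ya] : y \in <[x]>%VS by exact: memv_pick.
have a0 : a != 0 by apply: contraNneq y0 => a0; rewrite ya a0 scale0r.
exists (a < 0); rewrite ya dot_normZ !scalerA; congr (_ *: _).
rewrite invfM mulrAC [LHS](_ : _ = (`|a|^-1 * a) * (norm x)^-1) //.
by congr (_ * _); rewrite [X in _ * X]realEsign ?num_real // mulrCA mulVf ?normr_eq0 // mulr1.
Qed.

Lemma proj_distE (x y : V) (x0 : x != 0) (y0 : y != 0) :
  proj_dist dot (proj x0) (proj y0) =
  Num.min (norm (unit x - unit y)) (norm (unit x + unit y)).
Proof.
have normN z : norm (- z) = norm z by rewrite -scaleN1r dot_normZ normrN1 mul1r.
rewrite /proj_dist.
have [[] ->] := unit_pickE x0; have [[] ->] := unit_pickE y0;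
  rewrite /= ?expr1 ?expr0 ?scaleN1r ?scale1r ?opprK.
- by rewrite -(normN (unit x - unit y)) -(normN (unit x + unit y)) !opprD opprK.
- by rewrite -(normN (unit x - unit y)) -(normN (unit x + unit y)) !opprD opprK minC.
- by rewrite minC.
- by [].
Qed.

End ProjDist.

Section Selgrade.
Context {R : realType} {B : Type} {V : vectType R}.
Variables (dB : B -> B -> R) (dot : V -> V -> R).
Variables (theta : R -> B -> B) (phi : R -> B -> V -> V).

Definition skew_product (t : R) (p : B * V) : B * V :=
  (theta t p.1, phi t p.1 p.2).

Definition is_linear_flow : Prop :=
  (forall t b, linear (phi t b)) /\
  is_flow (max_dist dB (dot_dist dot)) skew_product.

(* The default value of insubd is never used for a linear flow, and the induced
   map is (b, Px) |-> (theta_t b, P(phi(t,b,x))), see proj_flowE. *)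
Definition proj_flow (t : R) (q : B * proj_space V) : B * proj_space V :=
  (theta t q.1, insubd q.2 <[phi t q.1 (vpick (val q.2))]>%VS).

Lemma linear_flow_neq0 t b x :
  is_linear_flow -> x != 0 -> phi t b x != 0.
Proof.
move=> [lin [_ id0 add]]; apply: contraNneq => ptx.
have := add (- t) t (b, x); rewrite addNr id0 /skew_product /= ptx => -[_ ->].
have := lin (- t) (theta t b) (-1) 0 0.
by rewrite scaler0 addr0 scaleN1r addNr => ->.
Qed.

Lemma proj_flowE t b x (x0 : x != 0) (y0 : phi t b x != 0) :
  is_linear_flow -> proj_flow t (b, proj x0) = (theta t b, proj y0).
Proof.
move=> linf; congr pair; apply: val_inj; rewrite /=.
set y := vpick _.
have ny0 : y != 0 by rewrite vpick0 -dimv_eq0 dim_vline x0.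
have /vlineP[a ya] : y \in <[x]>%VS by exact: memv_pick.
have a0 : a != 0 by apply: contraNneq ny0 => a0; rewrite ya a0 scale0r.
have pya : phi t b y = a *: phi t b x.
  have [lin _] := linf; have p0 : phi t b 0 = 0.
    by have := lin t b (-1) 0 0; rewrite scaler0 addr0 scaleN1r addNr.
  by have := lin t b a x 0; rewrite !addr0 ya p0 addr0.
rewrite val_insubd dim_vline linear_flow_neq0 //= pya.
apply/eqP; rewrite eqEsubv -!memvE memvZ ?memv_line //=.
by apply/vlineP; exists a^-1; rewrite scalerA mulVf // scale1r.
Qed.

Definition bundle_of (M : set (B * proj_space V)) : set (B * V) :=
  [set p | forall x0 : p.2 != 0, M (p.1, proj x0)].

Definition selgrade_bundle (W : set (B * V)) : Prop :=
  exists2 M : set (B * proj_space V),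
    chain_recurrent_component (max_dist dB (proj_dist dot)) proj_flow M &
    W = bundle_of M.

End Selgrade.

Section BundleSums.
Context {R : realType} {B : Type} {V : vectType R}.
Implicit Types U W : set (B * V).

Definition bundle_sum U W : set (B * V) :=
  [set p | exists u w, [/\ U (p.1, u), W (p.1, w) & p.2 = u + w]].

Definition bundle_sum_direct U W : Prop :=
  forall b x, U (b, x) -> W (b, x) -> x = 0.

Definition bundle_bigsum (I : finType) (A : set I) (W : I -> set (B * V)) :
    set (B * V) :=
  [set p | exists x : I -> V, (forall i, A i -> W i (p.1, x i)) /\
                              p.2 = \sum_(i | i \in A) x i].

Definition bundle_bigsum_direct (I : finType) (A : set I)
    (W : I -> set (B * V)) : Prop :=
  forall b (x : I -> V), (forall i, A i -> W i (b, x i)) ->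
    \sum_(i | i \in A) x i = 0 -> forall i, A i -> x i = 0.

End BundleSums.

Section HIntegral.
Context {R : realType} {H : vectType R}.

Definition hcoord (i : 'I_(\dim {:H})) (x : H) : R := coord (vbasis {:H}) i x.

(* g is a representative of its class in L^infty(R, H). *)
Definition in_Linfty (g : R -> H) : Prop :=
  forall i, (fun t => hcoord i (g t)) \in Lfun (@lebesgue_measure R) +oo%E.

Definition oriented_integral (h : R -> R) (t : R) : R :=
  if 0 <= t then \int[@lebesgue_measure R]_(s in `[0, t]) h s
  else - \int[@lebesgue_measure R]_(s in `[t, 0]) h s.

Definition hintegral (g : R -> H) (t : R) : H :=
  \sum_(i < \dim {:H})
    oriented_integral (fun s => hcoord i (g s)) t *: (vbasis {:H})`_i.

End HIntegral.

Section SplitAffine.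
Context {R : realType} {B1 B2 : Type} {H : vectType R}.
Variables (theta1 : R -> B1 -> B1) (theta2 : R -> B2 -> B2).
Variables (phi : R -> B2 -> H -> H) (f : B1 -> R -> H).

Definition prod_flow (t : R) (b : B1 * B2) : B1 * B2 :=
  (theta1 t b.1, theta2 t b.2).

Definition forcing (t : R) (b : B1 * B2) : H :=
  hintegral (fun s => phi (t - s) (theta2 s b.2) (f b.1 s)) t.

Definition split_affine_flow (t : R) (p : B1 * B2 * H) : B1 * B2 * H :=
  (prod_flow t p.1, phi t p.1.2 p.2 + forcing t p.1).

(* On representatives in L^infty, "for almost all t, s" is read as "for almost
   all s, for almost all t": this does not depend on the representatives. *)
Definition is_forcing_family (e1 : B1) : Prop :=
  [/\ forall b1, in_Linfty (f b1),
      {ae @lebesgue_measure R, forall t, f e1 t = 0} &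
      forall b1, {ae @lebesgue_measure R, forall s,
        {ae @lebesgue_measure R, forall t, f b1 (t + s) = f (theta1 s b1) t}}].

Local Notation H1 := (H * R^o)%type.

Definition dot1 (dot : H -> H -> R) (u v : H1) : R :=
  dot u.1 v.1 + u.2 * v.2.

Definition lift_cocycle (t : R) (b : B1 * B2) (u : H1) : H1 :=
  (phi t b.2 u.1 + (u.2 : R) *: forcing t b, u.2).

Definition cocycle1 (t : R) (b : B2) (u : H1) : H1 := (phi t b u.1, u.2).

Definition polar_bundle : set (B2 * H1) := [set p | p.2.1 = 0].

Definition bundle_at_infty (W : set (B2 * H)) : set (B2 * H1) :=
  [set p | W (p.1, p.2.1) /\ p.2.2 = 0].

Lemma pair1_neq0 (x : H) : (x, 1) != 0 :> H1.
Proof. by rewrite -pair_eqE /= /pair_eq /= oner_eq0 andbF. Qed.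

Definition h1 (W : set (B2 * H)) : set (B2 * proj_space H1) :=
  [set (p.1, proj (pair1_neq0 p.2)) | p in W].

Definition over_point (e1 : B1) (S : set (B2 * H1)) : set (B1 * B2 * H1) :=
  [set p | p.1.1 = e1 /\ S (p.1.2, p.2)].

Definition central_selgrade_bundle (dB : B1 * B2 -> B1 * B2 -> R)
    (dot : H -> H -> R) (W : set (B1 * B2 * H1)) : Prop :=
  selgrade_bundle dB (dot1 dot) prod_flow lift_cocycle W /\
  exists2 p, W p & p.2.2 != 0.

End SplitAffine.

Arguments polar_bundle {R} B2 H.

(* Main.v *)
(* Replacing the flows by their time-one maps, chains become finite pseudo-orbits, and a
   chain transitive set has chains of every large length between any two of its points;
   hence products of chain transitive sets are chain transitive. For a linear cocycle over
   a chain transitive base, the points reachable by e-chains from a given point form a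
   trapping region of the projective flow. Its maximal invariant set P and the dual repeller
   Q are fiberwise linear and, since linear maps transport fibers of P along chains of the
   base, complementary of constant dimension. Attractors are totally ordered by inclusion,
   so the recurrent vectors span each fiber; this gives Selgrade's decomposition.

   For the lift of the split affine flow, an attractor-repeller pair separating the pole
   over e1 from a point of Vc off infinity would have a repeller fiber over e1 contained in
   H x 0; the part at infinity does not depend on b1, so by dimension the repeller would be
   contained in H x 0 everywhere. Hence Vc contains the polar bundle over e1. Finally, the
   conjugation (x, r) |-> (delta x, r) multiplies the forcing by delta, so for delta -> 0
   chains of the lift between the pole and infinity become chains of Phi^1: V_i^oo lies in
   Vc over e1 iff it is chain equivalent to the pole under Phi^1, i.e. iff h^1(V_i) is
   chain transitive. *)

Require Import Defs.
From HB Require Import structures.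
From mathcomp Require Import all_boot all_order all_algebra.
From mathcomp Require Import all_classical all_reals all_analysis.
From mathcomp Require Import ring lra zify.

Set Implicit Arguments.
Unset Strict Implicit.
Unset Printing Implicit Defensive.

Import Order.TTheory GRing.Theory Num.Theory.
Import numFieldNormedType.Exports.

Local Open Scope classical_set_scope.
Local Open Scope ring_scope.

(** * Chains of flows and of time-one maps *)

(** Legs of an (e,T)-chain have arbitrary durations, so chains in two factors do not run in
    parallel. Cutting a leg of duration t into floor(t) or floor(t)+1 nearly unit steps yields loops
    of two consecutive lengths, hence of all large lengths. Projective closeness is handled on
    vectors, as a relative error up to a scalar ([pnear]), which keeps the linear structure
    available; the projective space only occurs at the interface with the definitions. The crux of
    the linear theory is that attractor fibers are closed under sums: where a segment leaves such a
    fiber, two backward growth rates would have to dominate each other. In the rescaling, delta has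
    to be fixed before any chain is known. It depends only on the tolerance and on a bound for the
    time-one forcing, and the pole and the lines at infinity are fixed by the rescaling, so the
    endpoints of the chain do not move. *)

Section Distances.
Context {R : realType}.

Definition is_dist (X : Type) (d : X -> X -> R) : Prop :=
  [/\ forall x, d x x = 0, forall x y, d x y = d y x &
      forall x y z, d x z <= d x y + d y z].

Definition seq_compact (X : Type) (d : X -> X -> R) : Prop :=
  forall u : nat -> X, exists (k : nat -> nat) (x : X),
    (forall n, (n <= k n)%N) /\
    forall e : R, 0 < e -> exists N, forall n, (N <= n)%N -> d (u (k n)) x < e.

Lemma is_dist_ge0 (X : Type) (d : X -> X -> R) x y : is_dist d -> 0 <= d x y.
Proof. by move=> [d0 ds dt]; have := dt x y x; rewrite d0 (ds y x); lra. Qed.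

Lemma is_dist_max (X Y : Type) (dX : X -> X -> R) (dY : Y -> Y -> R) :
  is_dist dX -> is_dist dY -> is_dist (max_dist dX dY).
Proof.
move=> [X0 Xs Xt] [Y0 Ys Yt]; split.
- by move=> x; rewrite /max_dist X0 Y0 maxxx.
- by move=> x y; rewrite /max_dist Xs Ys.
- move=> x y z; rewrite /max_dist ge_max; apply/andP; split.
  + by apply: (le_trans (Xt _ y.1 _)); rewrite lerD // le_max lexx.
  + by apply: (le_trans (Yt _ y.2 _)); rewrite lerD // le_max lexx orbT.
Qed.

Lemma seq_compact_max (X Y : Type) (dX : X -> X -> R) (dY : Y -> Y -> R) :
  seq_compact dX -> seq_compact dY -> seq_compact (max_dist dX dY).
Proof.
move=> cX cY u.
have [k [x [kn kx]]] := cX (fun n => (u n).1).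
have [l [y [ln ly]]] := cY (fun n => (u (k n)).2).
exists (k \o l), (x, y); split=> [n|e e0]; first exact: leq_trans (ln n) (kn _).
have [N1 h1] := kx _ e0; have [N2 h2] := ly _ e0.
exists (maxn N1 N2) => n; rewrite geq_max => /andP[n1 n2].
rewrite /max_dist gt_max /= h2 // h1 //.
by rewrite (leq_trans n1) // ln.
Qed.

Lemma is_dist_mdist (X : metricType R) : is_dist (@mdist R X).
Proof.
split; [exact: mdistxx|exact: metric_sym|].
by move=> x y z; exact: metric_triangle.
Qed.

Lemma cluster_subseq (X : Type) (d : X -> X -> R) (u : nat -> X) x :
  (forall (e : R) N, 0 < e -> exists2 n, (N <= n)%N & d (u n) x < e) ->
  exists k : nat -> nat, (forall n, (n <= k n)%N) /\
    forall e : R, 0 < e -> exists N, forall n, (N <= n)%N -> d (u (k n)) x < e.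
Proof.
move=> h.
have /choice[k kP] : forall n : nat, exists m, (n <= m)%N /\ d (u m) x < n.+1%:R^-1.
  by move=> n; have [|m] := h n.+1%:R^-1 n; [by rewrite invr_gt0 ltr0n|exists m].
exists k; split=> [n|e e0]; first by have [] := kP n.
have [N _ hN] := near_infty_natSinv_lt (PosNum e0).
by exists N => n Nn; have [_ /lt_trans->//] := kP n; exact: hN.
Qed.

Lemma seq_compact_mdist (X : metricType R) :
  compact [set: X] -> seq_compact (@mdist R X).
Proof.
move=> cX u.
have [x [_ xc]] : exists x, setT x /\ cluster (u @ \oo) x by exact: cX filterT.
suff /(cluster_subseq (d := @mdist R X))[k kP] : forall (e : R) N, 0 < e ->
    exists2 n, (N <= n)%N & mdist (u n) x < e by exists k, x.
move=> e N e0.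
have h1 : (u @ \oo) [set y | exists2 n, (N <= n)%N & y = u n].
  by exists N => // n /= Nn; exists n.
have h2 : nbhs x (ball x e) by exact: nbhsx_ballx.
have [y [[n Nn ->]]] := xc _ _ h1 h2.
by rewrite ballEmdist /= metric_sym; exists n.
Qed.

End Distances.

(** The length is an index because chains in different factors are combined step by step, which
    requires equal lengths. *)
Inductive dchain (X : Type) (S : X -> X -> Prop) : nat -> X -> X -> Prop :=
| dchain0 x : dchain S 0 x x
| dchainS n x y z : dchain S n x y -> S y z -> dchain S n.+1 x z.

Section DiscreteChains.
Context {X : Type}.
Implicit Types (S : X -> X -> Prop).

Lemma dchain1 S x y : S x y -> dchain S 1 x y.
Proof. by apply: dchainS; exact: dchain0. Qed.

Lemma dchain0E S x y : dchain S 0 x y -> x = y.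
Proof. by move=> h; inversion h. Qed.

Lemma dchainSE S n x z : dchain S n.+1 x z -> exists2 y, dchain S n x y & S y z.
Proof. by move=> h; inversion h; subst; exists y. Qed.

Lemma dchain_cat S m n x y z :
  dchain S m x y -> dchain S n y z -> dchain S (m + n) x z.
Proof.
move=> xy yz; elim: yz xy => [y'|k y1 y2 y3 _ IH s] xy; first by rewrite addn0.
by rewrite addnS; apply: (dchainS (IH xy) s).
Qed.

Lemma dchain_split S m n x z :
  dchain S (m + n) x z -> exists2 y, dchain S m x y & dchain S n y z.
Proof.
elim: n z => [|n IH] z; first by rewrite addn0 => h; exists z => //; exact: dchain0.
by rewrite addnS => /dchainSE[y /IH[w h1 h2] s]; exists w => //; exact: dchainS s.
Qed.

Lemma dchain_sub S S' n x y : (forall u v, S u v -> S' u v) ->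
  dchain S n x y -> dchain S' n x y.
Proof.
move=> h; elim=> [z|m a b c _ IH s]; first exact: dchain0.
by apply: dchainS IH _; exact: h.
Qed.

Lemma dchain_map (Y : Type) (S : X -> X -> Prop) (S' : Y -> Y -> Prop) (f : X -> Y)
    n x y : (forall u v, S u v -> S' (f u) (f v)) ->
  dchain S n x y -> dchain S' n (f x) (f y).
Proof.
move=> h; elim=> [z|m a b c _ IH s]; first exact: dchain0.
by apply: dchainS IH _; exact: h.
Qed.

Lemma dchain_iter S n x m : dchain S n x x -> dchain S (m * n) x x.
Proof.
move=> h; elim: m => [|m IH]; first exact: dchain0.
by rewrite mulSn; exact: dchain_cat h IH.
Qed.

(** Writing n = q m + r with r < m, the bound on n gives q >= m > r, so n = (q - r) m + r (m + 1) is
    a combination of the two loop lengths. *)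
Lemma dchain_loops S m x : dchain S m x x -> dchain S m.+1 x x ->
  forall n, (m * m <= n)%N -> dchain S n x x.
Proof.
case: m => [|m] h h' n.
  by rewrite -[n]muln1 => _; exact: dchain_iter h'.
move=> mn; have nE := divn_eq n m.+1; have rm := ltn_pmod n (ltn0Sn m).
have qm : (m.+1 <= n %/ m.+1)%N by rewrite leq_divRL.
have -> : n = ((n %/ m.+1 - n %% m.+1) * m.+1 + (n %% m.+1) * m.+2)%N by nia.
by apply: dchain_cat; exact: dchain_iter.
Qed.

End DiscreteChains.

Lemma dchain_prod (X Y : Type) (S : X -> X -> Prop) (S' : Y -> Y -> Prop) n x x' y y' :
  dchain S n x x' -> dchain S' n y y' ->
  dchain (fun p q => S p.1 q.1 /\ S' p.2 q.2) n (x, y) (x', y').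
Proof.
elim: n x' y' => [|n IH] x' y'.
  by move=> h1 h2; rewrite (dchain0E h1) (dchain0E h2); exact: dchain0.
move=> h h'; have [x1 h1 s1] := dchainSE h; have [y1 h2 s2] := dchainSE h'.
by apply: dchainS (IH _ _ h1 h2) _.
Qed.

Section FlowChains.
Context {R : realType} {X : Type} (d : X -> X -> R) (Phi : R -> X -> X).
Hypotheses (dd : is_dist d) (dc : seq_compact d) (fl : is_flow d Phi).

Let d0 x : d x x = 0. Proof. by case: dd. Qed.
Let ds x y : d x y = d y x. Proof. by case: dd. Qed.
Let dt x y z : d x z <= d x y + d y z. Proof. by case: dd. Qed.
Let PhiD t s x : Phi (t + s) x = Phi t (Phi s x). Proof. by case: fl. Qed.
Let Phi0 x : Phi 0 x = x. Proof. by case: fl. Qed.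

(** By compactness: counterexamples for smaller and smaller eta would accumulate at some x and
    contradict joint continuity at (t, x). *)
Lemma flow_unif t (e : R) : 0 < e -> exists2 eta : R, 0 < eta &
  forall s x y, `|t - s| < eta -> d x y < eta -> d (Phi t x) (Phi s y) < e.
Proof.
move=> e0; apply: contrapT => no.
have /choice[w wP] : forall n : nat, exists w : R * X * X,
    [/\ `|t - w.1.1| < n.+1%:R^-1, d w.1.2 w.2 < n.+1%:R^-1 &
        e <= d (Phi t w.1.2) (Phi w.1.1 w.2)].
  move=> n; apply: contrapT => noW; apply: no; exists n.+1%:R^-1.
    by rewrite invr_gt0 ltr0n.
  move=> s x y ts xy; rewrite ltNge; apply/negP => le.
  by apply: noW; exists (s, x, y).
have [k [x [kn kx]]] := dc (fun n => (w n).1.2).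
have [del del0 jc] : exists2 delta : R, 0 < delta & forall s y, `|t - s| < delta ->
    d x y < delta -> d (Phi t x) (Phi s y) < e / 2.
  by have [+ _ _] := fl; apply; rewrite divr_gt0.
have del20 : 0 < del / 2 by rewrite divr_gt0.
have [N1 _ hN1] := near_infty_natSinv_lt (PosNum del20).
have [N2 hN2] := kx _ del20.
pose n := maxn N1 N2.
have [] := wP (k n); set s := (w _).1.1; set a := (w _).1.2; set b := (w _).2.
have kN1 : (k n).+1%:R^-1 < del / 2.
  by apply: hN1; rewrite /= (leq_trans (leq_maxl N1 N2)) // kn.
have ax : d a x < del / 2 by apply: hN2; exact: leq_maxr.
move=> /lt_trans/(_ kN1) ts /lt_trans/(_ kN1) ab; apply/negP; rewrite -ltNge.
clearbody a b s.
have xb : d x b < del by have := dt x a b; rewrite (ds x a); lra.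
have xa : d x a < del by rewrite ds; lra.
have h1 : d (Phi t x) (Phi t a) < e / 2.
  by apply: jc => //; rewrite subrr normr0.
have h2 : d (Phi t x) (Phi s b) < e / 2.
  by apply: jc => //; lra.
by have := dt (Phi t a) (Phi t x) (Phi s b); rewrite (ds (Phi t a) (Phi t x)); lra.
Qed.

Definition step (e : R) (x y : X) : Prop := d (Phi 1 x) y < e.

(** With k the integer part of t, both t/k and t/(k+1) differ from 1 by at most 1/k. Equal pieces of
    either duration follow the time-one map up to e, and the final jump costs another e. *)
Lemma leg_dchain (e : R) : 0 < e -> exists2 T : R, 0 < T & forall t, T <= t ->
  exists2 k, (0 < k)%N & forall x y, d (Phi t x) y < e ->
    dchain (step (e + e)) k x y /\ dchain (step (e + e)) k.+1 x y.
Proof.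
move=> e0; have [eta eta0 hU] := flow_unif 1 e0.
have [N _ hN] := near_infty_natSinv_lt (PosNum eta0).
have orbit tau : `|1 - tau| < eta -> forall j x,
    dchain (step (e + e)) j x (Phi (tau *+ j) x).
  move=> ht; elim=> [|j IH] x; first by rewrite mulr0n Phi0; exact: dchain0.
  apply: dchainS (IH x) _; rewrite mulrS PhiD /step.
  by have := hU _ (Phi (tau *+ j) x) (Phi (tau *+ j) x) ht; rewrite d0 => /(_ eta0); lra.
have leg tau j x y : `|1 - tau| < eta -> d (Phi (tau *+ j.+1) x) y < e ->
    dchain (step (e + e)) j.+1 x y.
  move=> ht xy; apply: dchainS (orbit _ ht j x) _; rewrite /step.
  move: xy; rewrite mulrS PhiD; set z := Phi _ x => xy.
  have := hU _ z z ht; rewrite d0 => /(_ eta0).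
  by have := dt (Phi 1 z) (Phi tau z) y; lra.
exists (N.+1%:R); first by rewrite ltr0n.
move=> t Nt; have t0 : 0 <= t by apply: le_trans Nt; rewrite ler0n.
have /andP[kt tk] := truncn_itv t0; set k := Num.truncn t in kt tk.
have Nk : (N < k)%N.
  by rewrite -ltnS -(ltr_nat R) (le_lt_trans Nt).
exists k; first by apply: leq_trans Nk.
move=> x y xy.
have sm m : (N < m)%N -> m%:R^-1 < eta.
  by case: m => // m Nm; exact: hN.
have dv j : t / j.+1%:R *+ j.+1 = t by rewrite -[LHS]mulr_natr divfK // pnatr_eq0.
have kk : 0 < k%:R :> R by rewrite ltr0n; apply: leq_trans Nk.
have kk1 : 0 < k.+1%:R :> R by rewrite ltr0n.
split.
- case: k Nk kt tk kk {kk1} => [//|k] Nk kt tk kk.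
  apply: (@leg (t / k.+1%:R)); last by rewrite dv.
  rewrite -[X in `|X - _|](@divff _ k.+1%:R) ?gt_eqF // -mulrBl normrM.
  rewrite (gtr0_norm (_ : 0 < k.+1%:R^-1)) ?invr_gt0 //.
  apply: le_lt_trans (sm _ Nk); rewrite ler_piMl // ?invr_ge0 ?ler0n //.
  by rewrite ler_norml; move: tk; rewrite -natr1; lra.
- apply: (@leg (t / k.+1%:R)); last by rewrite dv.
  rewrite -[X in `|X - _|](@divff _ k.+1%:R) ?gt_eqF // -mulrBl normrM.
  rewrite (gtr0_norm (_ : 0 < k.+1%:R^-1)) ?invr_gt0 //.
  apply: le_lt_trans (sm _ (ltnW Nk : (N < k.+1)%N)); rewrite ler_piMl // ?invr_ge0 ?ler0n //.
  by rewrite ler_norml; move: kt tk; rewrite -natr1; lra.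
Qed.

(** The choice between two lengths is exercised on the first leg only; all later legs contribute a
    common length. *)
Lemma chain_dchain2 (e : R) : 0 < e -> exists2 T : R, 0 < T & forall x y,
  chain d Phi e T x y ->
  exists2 m, (0 < m)%N &
    dchain (step (e + e)) m x y /\ dchain (step (e + e)) m.+1 x y.
Proof.
move=> e0; have [T T0 leg] := leg_dchain e0; exists T => // x y.
move=> [n [c [tau [n0 <- <- h]]]].
have : forall i, (i < n)%N -> exists2 m, (0 < m)%N &
    dchain (step (e + e)) m (c 0%N) (c i.+1) /\
    dchain (step (e + e)) m.+1 (c 0%N) (c i.+1).
  elim=> [|i IH] hi.
    by have [Tt ht] := h _ hi; have [k k0 /(_ _ _ ht) hk] := leg _ Tt; exists k.
  have [m m0 [h1 h2]] := IH (ltnW hi).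
  have [Tt ht] := h _ hi; have [k k0 /(_ _ _ ht)[hk _]] := leg _ Tt.
  exists (m + k)%N; first by rewrite addn_gt0 m0.
  by split; [exact: dchain_cat h1 hk|rewrite -addSn; exact: dchain_cat h2 hk].
by case: n n0 {h} => // n _; apply.
Qed.

(** Loops at [x] of two consecutive lengths give loops of every large length, to which one chain
    from [x] to [y] is appended. *)
Lemma flow_mixing (Y : set X) x y (e : R) : chain_transitive d Phi Y -> Y x -> Y y ->
  0 < e -> exists N, forall n, (N <= n)%N -> dchain (step e) n x y.
Proof.
move=> tr Yx Yy e0; have e20 : 0 < e / 2 by rewrite divr_gt0.
have [T T0 h] := chain_dchain2 e20; rewrite -splitr in h.
have [m m0 [h1 h2]] := h _ _ (tr x x Yx Yx _ _ e20 T0).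
have [k _ [h3 _]] := h _ _ (tr x y Yx Yy _ _ e20 T0).
exists (m * m + k)%N => n mn.
have -> : n = (n - k + k)%N by rewrite subnK // (leq_trans _ mn) // leq_addl.
apply: dchain_cat h3; apply: dchain_loops h1 h2 _ _.
by rewrite -(leq_add2r k) subnK // (leq_trans _ mn) // leq_addl.
Qed.

Lemma chain_cat e T x y z :
  chain d Phi e T x y -> chain d Phi e T y z -> chain d Phi e T x z.
Proof.
move=> [n [c [tau [n0 c0 cn h]]]] [m [c' [tau' [m0 c0' cm h']]]].
exists (n + m)%N, (fun i => if (i < n)%N then c i else c' (i - n)%N),
  (fun i => if (i < n)%N then tau i else tau' (i - n)%N); split.
- by rewrite addn_gt0 n0.
- by rewrite n0.
- by rewrite ltnNge leq_addr /= addKn.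
- move=> i im; have [lt|ge] := ltnP i n.
    have [h1 h2] := h _ lt; split => //; have [//|ge] := ltnP i.+1 n.
    have /eqP iE : i.+1 == n by rewrite eqn_leq lt ge.
    by rewrite iE subnn c0' -cn -iE.
  rewrite ltnNge (leq_trans ge) //= subSn //; apply: h'.
  by rewrite ltn_subLR.
Qed.

(** The converse of cutting: boundedly many time-one steps with tiny errors merge into one leg of
    integer duration. *)
Lemma dchain_shadow J (e : R) : 0 < e -> exists2 eta : R, 0 < eta & forall j x y,
  (j <= J)%N -> dchain (step eta) j x y -> d (Phi j%:R x) y < e.
Proof.
elim: J e => [|J IH] e e0.
  exists 1 => // -[|//] x y _ h; rewrite -(dchain0E h).
  by rewrite Phi0 d0.
have e20 : 0 < e / 2 by rewrite divr_gt0.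
have [eta1 eta10 hU] := flow_unif 1 e20.
have [eta2 eta20 h2] := IH _ eta10.
exists (Num.min (e / 2) eta2); first by rewrite lt_min e20.
move=> [|j] x y jJ.
  by move=> h; rewrite -(dchain0E h) Phi0 d0.
move=> h; have [z xz] := dchainSE h; rewrite /step lt_min => /andP[zy _].
have xz' : d (Phi j%:R x) z < eta1.
  by apply: h2 => //; apply: dchain_sub xz => u v; rewrite /step lt_min => /andP[].
rewrite -natr1 addrC PhiD.
have := hU 1 _ _ _ xz'; rewrite subrr normr0 => /(_ eta10).
by have := dt (Phi 1 (Phi j%:R x)) (Phi 1 z) y; lra.
Qed.

Lemma dchain_chain x y :
  (forall (e : R) K, 0 < e -> exists2 n, (K <= n)%N & dchain (step e) n x y) ->
  forall e T : R, 0 < e -> 0 < T -> chain d Phi e T x y.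
Proof.
move=> h e T e0 T0.
pose K := (Num.truncn T).+1.
have TK : T <= K%:R by have /andP[_ /ltW] := truncn_itv (ltW T0).
have [eta eta0 sh] := dchain_shadow (2 * K) e0.
have [n Kn xy] := h _ K eta0.
elim/ltn_ind: n x Kn xy {h} => n IH x Kn xy.
(* Blocks of length [K] are split off while more than [2 * K] steps remain, so every block has
   between [K] and [2 * K] steps: long enough for [T], short enough for shadowing. *)
have one j u v : (K <= j <= 2 * K)%N -> dchain (step eta) j u v -> chain d Phi e T u v.
  move=> /andP[Kj jK] uv; exists 1%N, (fun i => if i == 0%N then u else v), (fun=> j%:R).
  split=> // [[|//]] _ /=; split; last exact: sh uv.
  by rewrite (le_trans TK) // ler_nat.
have [nK|Kn2] := leqP n (2 * K); first by apply: one xy; rewrite Kn.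
move: xy; rewrite -(@subnKC K n) // => h; have [z xz zy] := dchain_split h.
apply: chain_cat (one K _ _ _ xz) _; first by rewrite leqnn leq_pmull.
by apply: IH zy; [rewrite ltn_subrL; lia|lia].
Qed.

Lemma chain_transitiveP (Y : set X) : chain_transitive d Phi Y <->
  forall x y, Y x -> Y y -> forall e : R, 0 < e ->
    exists2 n, (0 < n)%N & dchain (step e) n x y.
Proof.
split=> [tr x y Yx Yy e e0|h x y Yx Yy].
  have [N hN] := flow_mixing tr Yx Yy e0.
  by exists N.+1 => //; apply: hN.
apply: dchain_chain => e K e0.
have [n n0 xx] := h x x Yx Yx e e0; have [m m0 xy] := h x y Yx Yy e e0.
exists (K * n + m)%N; first by rewrite (leq_trans (leq_pmulr K n0)) // leq_addr.
exact: dchain_cat (dchain_iter K xx) xy.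
Qed.

End FlowChains.

(** * Finite-dimensional norms *)

Section Norms.
Context {R : realType} {V : vectType R}.

Definition is_norm (N : V -> R) : Prop :=
  [/\ forall a x, N (a *: x) = `|a| * N x, forall x y, N (x + y) <= N x + N y &
      forall x, N x = 0 -> x = 0].

(** A predicate on bare functions, because the form [dot1] on the lifted space carries no [{dot _}]
    structure. *)
Definition is_inner (dot : V -> V -> R) : Prop :=
  [/\ forall a x y z, dot (a *: x + y) z = a * dot x z + dot y z,
      forall x y, dot x y = dot y x & forall x, x != 0 -> 0 < dot x x].

Lemma dot_inner (dot : {dot V for idfun}) : is_inner dot.
Proof.
split.
- by move=> a x y z; rewrite linearPl.
- by move=> x y; have := @hermC R false idfun V dot x y; rewrite expr0 mul1r.
- by move=> x; exact: neq0_dnorm_gt0.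
Qed.

Lemma inner_norm (dot : V -> V -> R) : is_inner dot -> is_norm (dot_norm dot).
Proof.
move=> [lin sym pos].
have lin0 z : dot 0 z = 0.
  by have := lin (-1) 0 0 z; rewrite scaler0 addr0 mulN1r addNr.
have dge0 x : 0 <= dot x x.
  by have [->|/pos/ltW//] := eqVneq x 0; rewrite lin0.
have linD x y z : dot (x + y) z = dot x z + dot y z.
  by rewrite -[x]scale1r lin scale1r mul1r.
have linZ a x z : dot (a *: x) z = a * dot x z.
  by rewrite -[a *: x]addr0 lin lin0 addr0.
have rD x y z : dot z (x + y) = dot z x + dot z y by rewrite !(sym z) linD.
have rZ a x z : dot z (a *: x) = a * dot z x by rewrite !(sym z) linZ.
have N2 x : dot_norm dot x * dot_norm dot x = dot x x.
  by rewrite -expr2 sqr_sqrtr.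
have CS x y : dot x y <= dot_norm dot x * dot_norm dot y.
  have [->|y0] := eqVneq y 0.
    by rewrite sym lin0 mulr_ge0 ?sqrtr_ge0.
  have yy := pos _ y0.
  pose t := dot x y / dot y y.
  have tE : t * dot y y = dot x y by rewrite /t divfK // gt_eqF.
  have := dge0 (x + (- t) *: y).
  rewrite linD !rD !linZ !rZ (sym y x) => h.
  have h2 : dot x y ^+ 2 <= dot x x * dot y y.
    have tt : - t * (- t * dot y y) = t * dot x y by rewrite -tE; ring.
    have h3 : 0 <= dot x x - t * dot x y by move: h; rewrite tt; lra.
    have := mulr_ge0 h3 (ltW yy); rewrite mulrBl mulrAC tE expr2; lra.
  apply: le_trans (ler_norm _) _; rewrite -sqrtr_sqr.
  by rewrite /dot_norm -sqrtrM // ler_wsqrtr.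
split.
- move=> a x; rewrite /dot_norm linZ rZ mulrA -expr2 sqrtrM ?sqr_ge0 //.
  by rewrite sqrtr_sqr.
- move=> x y; rewrite -[leRHS]ger0_norm ?addr_ge0 ?sqrtr_ge0 // -sqrtr_sqr.
  rewrite ler_wsqrtr // linD !rD (sym y x).
  by have := CS x y; have := N2 x; have := N2 y; nra.
- move=> x /eqP; rewrite /dot_norm sqrtr_eq0 => h.
  by apply/eqP/negPn/negP => /pos; rewrite ltNge h.
Qed.

Section NormTheory.
Variable N : V -> R.
Hypothesis normN : is_norm N.

Lemma nrmZ a x : N (a *: x) = `|a| * N x. Proof. by case: normN. Qed.
Lemma nrmD x y : N (x + y) <= N x + N y. Proof. by case: normN. Qed.
Lemma nrm0 : N 0 = 0.
Proof. by rewrite -(scale0r (0 : V)) nrmZ normr0 mul0r. Qed.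
Lemma nrmN x : N (- x) = N x.
Proof. by rewrite -scaleN1r nrmZ normrN1 mul1r. Qed.
Lemma nrmB x y : N (x - y) <= N x + N y.
Proof. by rewrite -(nrmN y) nrmD. Qed.
Lemma nrmC x y : N (x - y) = N (y - x).
Proof. by rewrite -nrmN opprB. Qed.
Lemma nrm_ge0 x : 0 <= N x.
Proof. by have := nrmB x x; rewrite subrr nrm0; lra. Qed.
Lemma nrm_eq0 x : (N x == 0) = (x == 0).
Proof.
by apply/eqP/eqP => [|->]; [have [_ _] := normN; apply|exact: nrm0].
Qed.
Lemma nrm_gt0 x : (0 < N x) = (x != 0).
Proof. by rewrite lt_neqAle nrm_ge0 andbT eq_sym nrm_eq0. Qed.
Lemma nrm_dist x y : N x <= N y + N (x - y).
Proof. by rewrite -{1}(subrK y x) addrC nrmD. Qed.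
Lemma nrm_sum (I : finType) (F : I -> V) : N (\sum_i F i) <= \sum_i N (F i).
Proof.
elim/big_ind2: _ => [||//]; first by rewrite nrm0.
by move=> x1 x2 y1 y2 h1 h2; apply: le_trans (nrmD _ _) _; exact: lerD.
Qed.
Lemma nrm_unit x : x != 0 -> N ((N x)^-1 *: x) = 1.
Proof.
move=> x0; rewrite nrmZ ger0_norm ?invr_ge0 ?nrm_ge0 // mulVf //.
by rewrite nrm_eq0.
Qed.

Let n := \dim {:V}.
Let r2v : 'rV[R]_n -> V := passmx.vecof (vbasis {:V}).
Let v2r : V -> 'rV[R]_n := passmx.rVof (vbasis {:V}).
Let v2rK : cancel v2r r2v. Proof. exact: passmx.rVofK (vbasisP _). Qed.
Let r2vK : cancel r2v v2r. Proof. exact: passmx.vecofK (vbasisP _). Qed.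

Let r2vB x y : r2v (x - y) = r2v x - r2v y.
Proof.
by have := passmx.vecof_linear (vbasis {:V}) (-1) y x; rewrite -/r2v !scaleN1r ![- _ + _]addrC.
Qed.
Let r2vE v : r2v v = \sum_(i < n) v 0 i *: (vbasis {:V})`_i.
Proof. by []. Qed.
Let v2rZ a x : v2r (a *: x) = a *: v2r x.
Proof.
apply: (can_inj r2vK); rewrite v2rK.
have := passmx.vecof_linear (vbasis {:V}) a (v2r x) 0; rewrite -/r2v addr0 => ->.
by have := r2vB 0 0; rewrite !subrr => ->; rewrite addr0 v2rK.
Qed.

Let row_norm (v : 'rV[R]_n) (i : 'I_n) : `|v 0 i| <= `|v|.
Proof.
rewrite [leRHS]/Num.Def.normr /= mx_normrE.
exact: (le_bigmax _ (fun ij : ordinal 1 * ordinal n => `|v ij.1 ij.2|) (0, i)).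
Qed.

Let norm_le_row : exists2 C : R, 0 < C & forall v : 'rV[R]_n, N (r2v v) <= C * `|v|.
Proof.
exists (1 + \sum_(i < n) N (vbasis {:V})`_i).
  by rewrite ltr_wpDr ?sumr_ge0 // => i _; exact: nrm_ge0.
move=> v; apply: le_trans (nrm_sum _) _.
rewrite mulrDl mul1r ler_wpDl // mulr_suml; apply: ler_sum => i _.
by rewrite nrmZ mulrC ler_wpM2l ?nrm_ge0 // row_norm.
Qed.

Let row_seq_compact (u : nat -> 'rV[R]_n) (M : R) : (forall m, `|u m| <= M) ->
  exists (k : nat -> nat) (v : 'rV[R]_n), (forall m, (m <= k m)%N) /\
    forall e : R, 0 < e -> exists K, forall m, (K <= m)%N -> `|u (k m) - v| < e.
Proof.
move=> uM.
have cA : compact [set v : 'rV[R]_n | `|v| <= M].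
  apply: bounded_closed_compact.
    by exists M; split; [exact: num_real|move=> M' MM' v /= /le_trans-> //; exact: ltW].
  have -> : [set v : 'rV[R]_n | `|v| <= M] = (fun v : 'rV[R]_n => `|v|) @^-1` [set x | x <= M].
    by [].
  by apply: preimage_closed; [move=> v _; exact: norm_continuous|exact: closed_le].
have [v [_ vc]] : exists v, [set v : 'rV[R]_n | `|v| <= M] v /\ cluster (u @ \oo) v.
  by apply: cA; exists 0%N => // m _; exact: uM.
suff /(cluster_subseq (d := fun x y : 'rV[R]_n => `|x - y|))[k kP] :
    forall (e : R) K, 0 < e -> exists2 m, (K <= m)%N & `|u m - v| < e by exists k, v.
move=> e K e0.
have h1 : (u @ \oo) [set y | exists2 m, (K <= m)%N & y = u m].
  by exists K => // m /= Km; exists m.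
have [y [[m Km ->]]] := vc _ _ h1 (nbhsx_ballx v e e0).
by rewrite -ball_normE /= distrC; exists m.
Qed.

(** The nontrivial half of norm equivalence: otherwise vectors of coordinate norm 1 with [N] tending
    to 0 would converge to a nonzero vector of norm 0. *)
Let row_le_norm : exists2 C : R, 0 < C & forall x, `|v2r x| <= C * N x.
Proof.
apply: contrapT => no.
have /choice[x xP] : forall m : nat, exists x, `|v2r x| = 1 /\ N x < m.+1%:R^-1.
  move=> m; apply: contrapT => no'; apply: no; exists m.+1%:R; first by rewrite ltr0n.
  move=> x; rewrite leNgt; apply/negP => xx; apply: no'.
  have x0 : 0 < `|v2r x|.
    by apply: le_lt_trans xx; rewrite mulr_ge0 ?ler0n ?nrm_ge0.
  exists (`|v2r x|^-1 *: x); split.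
    by rewrite v2rZ normrZ normrV ?unitfE ?gt_eqF // normr_id mulVf // gt_eqF.
  rewrite nrmZ normrV ?unitfE ?gt_eqF // normr_id mulrC ltr_pdivrMr //.
  by rewrite mulrC ltr_pdivlMr ?ltr0n // mulrC.
have [m|k [v [km kv]]] := @row_seq_compact (v2r \o x) 1.
  by rewrite /= (xP m).1.
have [C C0 hC] := norm_le_row.
have v1 : 1 <= `|v|.
  apply/ler_addgt0Pr => e e0; have [K hK] := kv _ e0.
  have := hK _ (leqnn K); rewrite /= => h.
  rewrite -(xP (k K)).1 -{1}(subrK v (v2r _)) (le_trans (ler_normD _ _)) //.
  by rewrite addrC lerD2l ltW.
have : N (r2v v) = 0.
  apply/eqP; rewrite eq_le nrm_ge0 andbT; apply/ler_addgt0Pr => e e0; rewrite add0r.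
  have e20 : 0 < e / 2 by rewrite divr_gt0.
  have eC0 : 0 < e / 2 / C by rewrite divr_gt0.
  have [K1 hK1] := kv _ eC0.
  have [K2 _ hK2] := near_infty_natSinv_lt (PosNum e20).
  pose m := maxn K1 K2.
  have h1 := hK1 m (leq_maxl _ _).
  have h2 : N (x (k m)) < e / 2.
    apply: lt_trans (xP _).2 _; apply: hK2; exact: leq_trans (leq_maxr K1 K2) (km m).
  have h3 : N (r2v v - x (k m)) <= e / 2.
    have := hC (v - v2r (x (k m))); rewrite r2vB v2rK => /le_trans; apply.
    by rewrite mulrC -ler_pdivlMr // distrC ltW.
  by apply: le_trans (nrm_dist _ (x (k m))) _; lra.
case: normN => _ _ /[apply] /(congr1 v2r); rewrite r2vK -(scale0r (0 : V)) v2rZ scale0r => v0.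
by move: v1; rewrite v0 normr0; lra.
Qed.

Lemma unit_sphere_compact (u : nat -> V) : (forall m, N (u m) = 1) ->
  exists (k : nat -> nat) (x : V), [/\ (forall m, (m <= k m)%N), N x = 1 &
    forall e : R, 0 < e -> exists K, forall m, (K <= m)%N -> N (u (k m) - x) < e].
Proof.
move=> u1; have [C C0 hC] := row_le_norm; have [C' C'0 hC'] := norm_le_row.
have [m|k [v [km kv]]] := @row_seq_compact (v2r \o u) C.
  by have := hC (u m); rewrite u1 mulr1.
have cv (e : R) : 0 < e -> exists K, forall m, (K <= m)%N -> N (u (k m) - r2v v) < e.
  move=> e0; have [|K hK] := kv (e / C'); first by rewrite divr_gt0.
  exists K => m /hK /= h; have := hC' (v2r (u (k m)) - v).
  by rewrite r2vB v2rK => /le_lt_trans; apply; rewrite mulrC -ltr_pdivlMr.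
exists k, (r2v v); split=> //.
apply/eqP; rewrite eq_le; apply/andP; split; apply/ler_addgt0Pr => e /cv[K hK].
- have := hK _ (leqnn K); rewrite nrmC.
  by have := nrm_dist (r2v v) (u (k K)); rewrite u1; lra.
- have := hK _ (leqnn K).
  by have := nrm_dist (u (k K)) (r2v v); rewrite u1; lra.
Qed.

Lemma linear_bounded (f : 'End(V)) : exists2 C : R, 0 < C & forall x, N (f x) <= C * N x.
Proof.
have [C C0 hC] := row_le_norm.
pose D := 1 + \sum_(i < n) N (f (vbasis {:V})`_i).
have D0 : 0 < D by rewrite /D ltr_wpDr ?sumr_ge0 // => i _; exact: nrm_ge0.
exists (D * C); first exact: mulr_gt0.
move=> x; rewrite -{1}(v2rK x) r2vE linear_sum.
apply: le_trans (nrm_sum _) _; rewrite -mulrA.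
apply: (@le_trans _ _ (D * `|v2r x|)); last by rewrite ler_wpM2l // ltW.
rewrite mulrDl mul1r ler_wpDl // mulr_suml; apply: ler_sum => i _.
by rewrite linearZ nrmZ mulrC ler_wpM2l ?nrm_ge0 // row_norm.
Qed.

(** [W] is the kernel of the bounded map identity minus projection onto [W]. *)
Lemma vspace_closed (W : {vspace V}) x :
  (forall e : R, 0 < e -> exists2 y, y \in W & N (y - x) < e) -> x \in W.
Proof.
move=> h; pose f : 'End(V) := (\1 - projv W)%VF.
have fE y : f y = y - projv W y by rewrite /f !lfunE /= lfunE /= !lfunE.
have [C C0 hC] := linear_bounded f.
suff /eqP : N (f x) == 0.
  move=> /eqP; rewrite nrm_eq0 fE subr_eq0 => /eqP->; exact: memv_proj.
rewrite eq_le nrm_ge0 andbT; apply/ler_addgt0Pr => e e0; rewrite add0r.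
have [|y yW yx] := h (e / C); first exact: divr_gt0.
have -> : f x = f (x - y) by rewrite linearB /= [f y]fE projv_id // subrr subr0.
by rewrite (le_trans (hC _)) // mulrC -ler_pdivlMr // nrmC ltW.
Qed.

End NormTheory.

(** [W] is a subspace of maximal dimension inside [S]: adjoining the line of any point of [S] stays
    in [S], so it cannot enlarge [W]. *)
Lemma linear_vspace (S : set V) : S 0 ->
  (forall a x y, S x -> S y -> S (a *: x + y)) ->
  exists W : {vspace V}, forall x, S x <-> x \in W.
Proof.
move=> S0 lin.
pose P k := `[< exists W : {vspace V}, \dim W = k /\ forall x, x \in W -> S x >].
have exP : exists k, P k.
  by exists 0%N; apply/asboolP; exists 0%VS; split=> [|x]; rewrite ?dimv0 // memv0 => /eqP->.
have bP k : P k -> (k <= \dim {:V})%N.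
  by move=> /asboolP[W [<- _]]; exact: dimvS (subvf W).
case: (ex_maxnP exP bP) => k /asboolP[W [dW WS]] max; exists W => x; split=> [Sx|]; last exact: WS.
have /max : P (\dim (W + <[x]>)%VS).
  apply/asboolP; exists (W + <[x]>)%VS; split=> // y /memv_addP[w wW [_ /vlineP[a ->] ->]].
  by rewrite addrC; apply: lin => //; exact: WS.
rewrite -dW => le; have /eqP -> : W == (W + <[x]>)%VS by rewrite eqEdim addvSl.
by apply: (subvP (addvSr W <[x]>)); exact: memv_line.
Qed.

End Norms.

(** * Linear cocycles, traps and attractors *)

Section Cocycles.
Context {R : realType} {B : Type} {V : vectType R}.
Variables (dB : B -> B -> R) (N : V -> R).
Implicit Types (e a c eta delta : R) (U : set (B * V)).

Definition skew_map (g : B -> B) (G : B -> V -> V) (p : B * V) : B * V :=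
  (g p.1, G p.1 p.2).

(* Closeness in B x PV expressed on vectors: q is only relevant up to scaling,
   and only the relative error matters. *)
Definition pnear (e : R) (p q : B * V) : Prop :=
  [/\ dB p.1 q.1 < e, q.2 != 0 &
      exists2 a, a != 0 & N (a *: q.2 - p.2) < e * N p.2].

Definition near_unif (F : B * V -> B * V) : Prop :=
  forall e : R, 0 < e -> exists2 eta : R, 0 < eta &
    forall p q, pnear eta p q -> pnear e (F p) (F q).

(** Keeping the inverse in the data makes the notion symmetric: through [cocycle_inv], results on
    attractors apply to repellers. *)
Record cocycle g G gi Gi : Prop := Cocycle {
  coc_dist : is_dist dB;
  coc_norm : is_norm N;
  coc_lin : forall b, linear (G b);
  coc_lini : forall b, linear (Gi b);
  cocK : cancel (skew_map g G) (skew_map gi Gi);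
  cocKi : cancel (skew_map gi Gi) (skew_map g G);
  coc_unif : near_unif (skew_map g G);
  coc_unifi : near_unif (skew_map gi Gi) }.

Lemma cocycle_inv g G gi Gi : cocycle g G gi Gi -> cocycle gi Gi g G.
Proof. by case=> *; split. Qed.

(** The set [U] itself may fail to be scale invariant, but [pnear] ignores scalars in its second
    point, so every nonzero multiple of a point of [F U] lies in [U]. Arguments that rescale a
    vector therefore spend one application of [F]. *)
Definition trap (F : B * V -> B * V) (U : set (B * V)) (delta : R) : Prop :=
  [/\ 0 < delta, forall p, U p -> p.2 != 0 &
      forall p q, U p -> pnear delta (F p) q -> U q].

(* The maximal F-invariant part of a trap U is core (F^-1) U; the dual repeller
   is core F (~` U). *)
Definition core (F : B * V -> B * V) (U : set (B * V)) : set (B * V) :=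
  [set p | p.2 != 0 -> forall n, U (iter n F p)].

Definition cstep (F : B * V -> B * V) (e : R) (p q : B * V) : Prop :=
  pnear e (F p) q.

Definition conn (F : B * V -> B * V) (p q : B * V) : Prop :=
  forall e : R, 0 < e -> exists2 n, (0 < n)%N & dchain (cstep F e) n p q.

Section Near.
Hypotheses (dd : is_dist dB) (nN : is_norm N).

Lemma near_neq0l e p q : pnear e p q -> p.2 != 0.
Proof.
move=> [_ _ [a _]]; apply: contraTneq => ->.
by rewrite (nrm0 nN) mulr0 -leNgt nrm_ge0.
Qed.

Lemma near_refl e p : 0 < e -> p.2 != 0 -> pnear e p p.
Proof.
move=> e0 p0; split=> //; first by case: dd => ->.
by exists 1; rewrite ?oner_eq0 // scale1r subrr (nrm0 nN) mulr_gt0 // nrm_gt0.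
Qed.

Lemma near_le e e' p q : e <= e' -> pnear e p q -> pnear e' p q.
Proof.
move=> ee [h1 h2 [a a0 h3]]; split=> //; first exact: lt_le_trans h1 ee.
by exists a => //; apply: (lt_le_trans h3); rewrite ler_wpM2r // nrm_ge0.
Qed.

Lemma near_fiber e b x y : 0 < e -> N (y - x) < e * N x -> y != 0 -> pnear e (b, x) (b, y).
Proof.
move=> e0 h y0; split=> //=; first by case: dd => ->.
by exists 1; rewrite ?oner_eq0 // scale1r.
Qed.

Lemma near_scale e p b x a : a != 0 -> pnear e p (b, x) -> pnear e p (b, a *: x).
Proof.
move=> a0 [h1 h2 [c c0 h3]]; split=> //=; first by rewrite scaler_eq0 negb_or a0.
exists (c / a); first by rewrite mulf_neq0 // invr_neq0.
by rewrite scalerA divfK.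
Qed.

(** The second error is relative to the rescaled middle vector, whose norm is at most (1 + e) <= 2
    times that of [p]; hence e + 2e. *)
Lemma near_trans e p q r : e <= 1 -> pnear e p q -> pnear e q r -> pnear (3 * e) p r.
Proof.
move=> e1 [h1 q0 [a a0 h2]] [h3 r0 [c c0 h4]].
have e0 : 0 < e by apply: le_lt_trans h1; exact: is_dist_ge0.
split=> //; first by case: dd => _ _ /(_ p.1 q.1 r.1); lra.
exists (a * c); first by rewrite mulf_neq0.
have -> : (a * c) *: r.2 - p.2 = a *: (c *: r.2 - q.2) + (a *: q.2 - p.2).
  by rewrite scalerBr scalerA addrA subrK.
apply: le_lt_trans (nrmD nN _ _) _; rewrite (nrmZ nN).
have aa : 0 < `|a| by rewrite normr_gt0.
have h5 : `|a| * N (c *: r.2 - q.2) < e * (`|a| * N q.2).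
  by rewrite mulrCA ltr_pM2l.
rewrite -[`|a| * N q.2](nrmZ nN) in h5.
have h6 := nrm_dist nN (a *: q.2) p.2.
have h7 := nrm_ge0 nN p.2.
have h8 : e * N (a *: q.2) <= e * (2 * N p.2) by rewrite ler_pM2l //; nra.
nra.
Qed.

(** For e <= 1/2 the rescaled [q] has at least half the norm of [p], which doubles the relative
    error. *)
Lemma near_sym e p q : e <= 1 / 2 -> pnear e p q -> pnear (2 * e) q p.
Proof.
move=> e1 npq; have p0 := near_neq0l npq; case: npq => [h1 q0 [a a0 h2]].
have e0 : 0 < e by apply: le_lt_trans h1; exact: is_dist_ge0.
split=> //; first by have [_ -> _] := dd; lra.
have aa : 0 < `|a| by rewrite normr_gt0.
exists a^-1; first by rewrite invr_neq0.
have -> : a^-1 *: p.2 - q.2 = - a^-1 *: (a *: q.2 - p.2).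
  by rewrite scaleNr scalerBr scalerA mulVf // scale1r opprB.
rewrite (nrmZ nN) normrN normrV ?unitfE // mulrC ltr_pdivrMr //.
have h3 := nrm_dist nN p.2 (a *: q.2); rewrite (nrmC nN) (nrmZ nN) in h3.
have h4 := nrm_ge0 nN p.2.
have h5 : e * N p.2 <= 1 / 2 * N p.2 by rewrite ler_wpM2r.
have h6 : e * N p.2 <= e * (2 * (`|a| * N q.2)) by rewrite ler_pM2l //; lra.
lra.
Qed.

End Near.

Section OneCocycle.
Variables (g : B -> B) (G : B -> V -> V) (gi : B -> B) (Gi : B -> V -> V).
Hypothesis coc : cocycle g G gi Gi.
Local Notation F := (skew_map g G).
Local Notation Fi := (skew_map gi Gi).

Let dd := coc_dist coc.
Let nN := coc_norm coc.

Lemma skew0 b : G b 0 = 0.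
Proof.
by have := coc_lin coc b (-1) 0 0; rewrite scaler0 addr0 scaleN1r addNr.
Qed.

Lemma skew_eq0 p : ((F p).2 == 0) = (p.2 == 0).
Proof.
apply/eqP/eqP => [h|]; last by rewrite /skew_map /= => ->; rewrite skew0.
have : (Fi (F p)).2 = (Fi (F (p.1, 0))).2.
  by congr (snd _); rewrite /skew_map /= skew0 -[G _ _]/((F p).2) h.
by rewrite !(cocK coc).
Qed.

Lemma iter_skew1 n p q : p.1 = q.1 -> (iter n F p).1 = (iter n F q).1.
Proof. by elim: n => //= n IH /IH ->. Qed.

Lemma iter_skew_lin n b a x y :
  (iter n F (b, a *: x + y)).2 =
    a *: (iter n F (b, x)).2 + (iter n F (b, y)).2.
Proof.
elim: n => [//|n IH]; rewrite !iterS /= IH (coc_lin coc).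
by rewrite !(@iter_skew1 n (b, _) (b, 0)).
Qed.

Lemma iter_skewD n b x y :
  (iter n F (b, x + y)).2 = (iter n F (b, x)).2 + (iter n F (b, y)).2.
Proof. by rewrite -[x]scale1r iter_skew_lin !scale1r. Qed.

Lemma iter_skewZ n b a x : (iter n F (b, a *: x)).2 = a *: (iter n F (b, x)).2.
Proof.
rewrite -[a *: x]addr0 iter_skew_lin.
suff -> : (iter n F (b, 0)).2 = 0 by rewrite addr0.
by have := iter_skew_lin n b (-1) 0 0; rewrite scaler0 addr0 scaleN1r addNr.
Qed.

Lemma iter_skewB n b x y :
  (iter n F (b, x - y)).2 = (iter n F (b, x)).2 - (iter n F (b, y)).2.
Proof. by rewrite iter_skewD -scaleN1r iter_skewZ scaleN1r. Qed.

Lemma iter_skew_eq0 n p : ((iter n F p).2 == 0) = (p.2 == 0).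
Proof. by elim: n => //= n <-; rewrite skew_eq0. Qed.

Lemma iter_skewE n b x : iter n F (b, x) = ((iter n F (b, 0)).1, (iter n F (b, x)).2).
Proof. by rewrite (@iter_skew1 n (b, 0) (b, x)) // -surjective_pairing. Qed.

Lemma near_iter n e : 0 < e -> exists2 eta : R, 0 < eta &
  forall p q, pnear eta p q -> pnear e (iter n F p) (iter n F q).
Proof.
elim: n e => [|n IH] e e0; first by exists e.
have [eta1 h1 H1] := coc_unif coc e0; have [eta h H] := IH _ h1.
by exists eta => // p q /H /H1.
Qed.

Lemma near_iter_fiber n e b x y : e > 0 -> y != 0 ->
  N ((iter n F (b, y)).2 - (iter n F (b, x)).2) < e * N (iter n F (b, x)).2 ->
  pnear e (iter n F (b, x)) (iter n F (b, y)).
Proof.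
move=> e0 y0 h; rewrite (iter_skewE n b x) (iter_skewE n b y).
by apply: near_fiber => //; rewrite iter_skew_eq0.
Qed.

Lemma near_iterZ n e b a x : 0 < e -> a != 0 -> x != 0 ->
  pnear e (iter n F (b, x)) (iter n F (b, a *: x)).
Proof.
move=> e0 a0 x0; rewrite (iter_skewE n b (a *: x)) iter_skewZ.
apply: near_scale => //; rewrite -iter_skewE; apply: near_refl => //.
by rewrite iter_skew_eq0.
Qed.

Lemma iter_skew_inv n p : iter n F (iter n Fi p) = p.
Proof. by elim: n p => // n IH p; rewrite iterSr [iter _ Fi _]iterS (cocKi coc) IH. Qed.

End OneCocycle.

Section Trap.
Variables (g : B -> B) (G : B -> V -> V) (gi : B -> B) (Gi : B -> V -> V).
Hypothesis coc : cocycle g G gi Gi.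
Local Notation F := (skew_map g G).
Local Notation Fi := (skew_map gi Gi).

Let dd := coc_dist coc.
Let nN := coc_norm coc.
Let coci := cocycle_inv coc.

Variables (U : set (B * V)) (delta : R).
Hypothesis tU : trap F U delta.

Let U0 p : U p -> p.2 != 0. Proof. by case: tU => _ + _; apply. Qed.
Let delta0 : 0 < delta. Proof. by case: tU. Qed.

Lemma trap_step p : U p -> U (F p).
Proof.
move=> Up; have [_ _ h] := tU; apply: h (Up) _; apply: near_refl => //.
by rewrite (skew_eq0 coc); exact: U0.
Qed.

Lemma trap_iter n p : U p -> U (iter n F p).
Proof. by elim: n => //= n IH /IH /trap_step. Qed.

Lemma trap_iterW m n p : (m <= n)%N -> U (iter m F p) -> U (iter n F p).
Proof. by move=> /subnK <-; rewrite iterD; exact: trap_iter. Qed.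

Lemma trap_inv_iterW m n p : (m <= n)%N -> U (iter n Fi p) -> U (iter m Fi p).
Proof.
move=> mn; rewrite -{1}(subnK mn) iterD => h.
by rewrite -(iter_skew_inv coc (n - m) (iter m Fi p)); exact: trap_iter.
Qed.

Lemma trap_near p q : U (Fi p) -> pnear delta p q -> U q.
Proof. by move=> h1 h2; have [_ _ h] := tU; apply: h h1 _; rewrite (cocKi coc). Qed.

(** Each backward iterate of a core point is the image of the next one, which is again in [U]; so
    the margin of the trap is available along the whole backward orbit. *)
Lemma core_near n p q : core Fi U p -> pnear delta (iter n Fi p) q -> U q.
Proof.
move=> cp npq; apply: (trap_near _ npq); rewrite -iterS; apply: cp.
by rewrite -(iter_skew_eq0 coci n); exact: near_neq0l npq.
Qed.

End Trap.

End Cocycles.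

Section CoreLinear.
Context {R : realType} {B : Type} {V : vectType R}.
Context (dB : B -> B -> R) (N : V -> R).
Variables (g : B -> B) (G : B -> V -> V) (gi : B -> B) (Gi : B -> V -> V).
Hypothesis coc : cocycle dB N g G gi Gi.
Local Notation F := (skew_map g G).
Local Notation Fi := (skew_map gi Gi).

Let dd := coc_dist coc.
Let nN := coc_norm coc.
Let coci := cocycle_inv coc.

Variables (U : set (B * V)) (delta : R).
Hypothesis tU : trap dB N F U delta.

Let delta0 : 0 < delta. Proof. by case: tU. Qed.

Lemma core0 b : core Fi U (b, 0).
Proof. by rewrite /core /= eqxx. Qed.

Lemma coreZ b a x : core Fi U (b, x) -> core Fi U (b, a *: x).
Proof.
move=> cx; rewrite /core /= => ax0 n; move: (ax0).
rewrite scaler_eq0 negb_or => /andP[a0 x0].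
by apply: (core_near coc tU (n := n) cx); exact: (near_iterZ coci).
Qed.

Let not_core b x : ~ core Fi U (b, x) ->
  x != 0 /\ exists m, forall n, (m <= n)%N -> ~ U (iter n Fi (b, x)).
Proof.
move=> nc; split.
  by apply/negP => /eqP x0; apply: nc; rewrite x0; exact: core0.
apply: contrapT => no; apply: nc => _ m; apply: contrapT => nU.
by apply: no; exists m => n mn /(trap_inv_iterW coc tU mn).
Qed.

(* On a segment leaving the fiber of the core at z, the direction y grows
   faster than z along backward orbits, which prevents y from lying in the core. *)
Let core_boundary b z y (t : R) : 0 < t -> z != 0 -> y != 0 ->
  core Fi U (b, z) -> core Fi U (b, y) ->
  (forall s, 0 < s <= t -> ~ core Fi U (b, z + s *: y)) -> False.
Proof.
move=> t0 z0 y0 cz cy out.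
have far b1 x1 w n : core Fi U (b1, x1) -> w != 0 -> ~ U (iter n Fi (b1, w)) ->
    delta * N (iter n Fi (b1, x1)).2 <=
      N ((iter n Fi (b1, w)).2 - (iter n Fi (b1, x1)).2).
  move=> cx w0 nU; rewrite leNgt; apply/negP => lt; apply: nU.
  by apply: (core_near coc tU (n := n) cx); exact: (near_iter_fiber coci).
(* Let a and c be the norms of the n-th backward iterates of [y] and [z]. The points outside the
   core at parameters t and t2 give delta t a <= c and delta c <= t2 a, which t2 < delta^2 t makes
   incompatible. The minimum with 1 keeps t2 <= t. *)
pose t2 := Num.min (delta ^+ 2 / 2) 1 * t.
have d2 : 0 < delta ^+ 2 by rewrite exprn_gt0.
have t20 : 0 < t2 by rewrite mulr_gt0 // lt_min ltr01 divr_gt0.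
have t2t : t2 <= t by apply: ler_piMl; [exact: ltW|rewrite ge_min lexx orbT].
have t2d : t2 < delta ^+ 2 * t.
  rewrite ltr_pM2r //; apply: le_lt_trans (_ : delta ^+ 2 / 2 < _).
    by rewrite ge_min lexx.
  by lra.
have [w1 [m1 h1]] := not_core (out t (introT andP (conj t0 (lexx t)))).
have [w2 [m2 h2]] := not_core (out t2 (introT andP (conj t20 t2t))).
(* The successor leaves one application of [F] for rescaling [z + t *: y] by [t^-1]. *)
pose n := (maxn m1 m2).+1.
have tw0 : t^-1 *: (z + t *: y) != 0 by rewrite scaler_eq0 negb_or invr_neq0 ?gt_eqF.
have nU : ~ U (iter n Fi (b, t^-1 *: (z + t *: y))).
  have [_ _ hU] := tU => Un; apply: (h1 n.-1 (leq_maxl _ _)); apply: hU Un _.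
  have tn0 : t != 0 by rewrite gt_eqF.
  rewrite iterS (cocKi coc).
  by have := near_iterZ coci n.-1 b delta0 tn0 tw0; rewrite scalerA mulfV // scale1r.
have := far _ _ _ n cz w2 (h2 _ (leqW (leq_maxr _ _))).
have := far _ _ _ n cy tw0 nU.
rewrite -!(iter_skewB coci) scalerDr scalerA mulVf ?gt_eqF // scale1r addrK addrC addKr.
rewrite !(iter_skewZ coci) !(nrmZ nN) !gtr0_norm ?invr_gt0 //.
set a := N _; set c := N _ => h3 h4.
have a0 : 0 < a by rewrite nrm_gt0 // (iter_skew_eq0 coci).
have h5 : delta * t * a <= c by move: h3; rewrite [_^-1 * _]mulrC ler_pdivlMr // mulrAC.
have h6 : delta * (delta * t * a) <= delta * c by rewrite ler_pM2l.
have h7 : t2 * a < delta ^+ 2 * t * a by rewrite ltr_pM2r.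
by move: h4 h6 h7; rewrite expr2; lra.
Qed.

(** Follow the segment from x to x + y up to the supremum s of the parameters in the core. The core
    contains the point at s, by a closedness argument, and [core_boundary] forbids leaving it
    there. *)
Lemma coreD b x y : core Fi U (b, x) -> core Fi U (b, y) -> core Fi U (b, x + y).
Proof.
move=> cx cy; apply: contrapT => nxy.
have y0 : y != 0 by apply/eqP => y0; apply: nxy; rewrite y0 addr0.
pose S := [set s : R | 0 <= s <= 1 /\ core Fi U (b, x + s *: y)].
have S0 : S 0 by split; rewrite ?lexx ?ler01 // scale0r addr0.
have uS : ubound S 1 by move=> s [/andP[]].
have supS : has_sup S by split; [exists 0|exists 1].
pose s := sup S.
have s0 : 0 <= s by apply: (sup_upper_bound supS).
have s1 : s <= 1 by apply: sup_le_ub => //; exists 0.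
have z0 : x + s *: y != 0.
  apply/eqP => z0; apply: nxy.
  have -> : x + y = (1 - s) *: y.
    by rewrite scalerBl scale1r -[x](addrK (s *: y)) z0 sub0r addrC.
  exact: coreZ.
have cz : core Fi U (b, x + s *: y).
  move=> _ n; set z := x + s *: y.
  pose c := N (iter n Fi (b, y)).2; pose a := N (iter n Fi (b, z)).2.
  have a0 : 0 < a by rewrite nrm_gt0 // (iter_skew_eq0 coci).
  have c0 : 0 <= c by exact: nrm_ge0.
  (* A parameter r with s - r < t satisfies (s - r) c < delta (a - (s - r) c), so the n-th backward
     iterates are within the margin. The [+ 1] keeps the denominator positive when c is 0. *)
  pose t := delta * a / ((1 + delta) * (c + 1)).
  have m0 : 0 < (1 + delta) * (c + 1) by apply: mulr_gt0; [have := delta0; lra|lra].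
  have t0 : 0 < t by rewrite divr_gt0 // mulr_gt0.
  have tE : t * ((1 + delta) * (c + 1)) = delta * a by rewrite /t divfK // gt_eqF.
  have [r [r01 cr] sr] := sup_adherent t0 supS; rewrite -/s in sr.
  have rs : r <= s by apply: (sup_upper_bound supS).
  apply: (core_near coc tU (n := n) cr); apply: (near_iter_fiber coci) => //.
  rewrite -(iter_skewB coci).
  have zE : z - (x + r *: y) = (s - r) *: y.
    by rewrite /z opprD addrACA subrr add0r scalerBl.
  rewrite zE (iter_skewZ coci) (nrmZ nN) ger0_norm ?subr_ge0 // -/c.
  have : a - (s - r) * c <= N (iter n Fi (b, x + r *: y)).2.
    have := nrm_dist nN (iter n Fi (b, z)).2 (iter n Fi (b, x + r *: y)).2.
    rewrite -(iter_skewB coci) zE (iter_skewZ coci) (nrmZ nN).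
    by rewrite ger0_norm ?subr_ge0 // -/c -/a; lra.
  set w := N _ => h.
  have h1 : delta * (a - (s - r) * c) <= delta * w by rewrite ler_pM2l.
  have h2 : (s - r) * ((1 + delta) * (c + 1)) < t * ((1 + delta) * (c + 1)).
    by rewrite ltr_pM2r //; lra.
  have h3 : 0 <= (s - r) * (1 + delta) by apply: mulr_ge0; [lra|have := delta0; lra].
  nra.
have s1' : 0 < 1 - s.
  rewrite subr_gt0 lt_neqAle s1 andbT; apply/eqP => sE; apply: nxy.
  by rewrite sE scale1r in cz.
apply: (core_boundary s1' z0 y0 cz cy) => r /andP[r0 rs] cr.
have : S (s + r).
  split; first by apply/andP; split; lra.
  by rewrite scalerDl addrA.
by move=> /(sup_upper_bound supS); rewrite -/s; lra.
Qed.

Lemma core_lin b a x y :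
  core Fi U (b, x) -> core Fi U (b, y) -> core Fi U (b, a *: x + y).
Proof. by move=> cx cy; apply: coreD => //; exact: coreZ. Qed.

(** If a point q close to the preimage of p were in [U], then p, being close to the image of q,
    would be in [U]. The minimum of 1/2 and delta/2 absorbs the loss of [near_sym]. *)
Lemma trap_dual : exists delta', trap dB N Fi [set p | p.2 != 0 /\ ~ U p] delta'.
Proof.
have [_ U0 hU] := tU.
have e0 : 0 < Num.min (1 / 2) (delta / 2) by rewrite lt_min !divr_gt0.
have [eta eta0 h] := coc_unif coc e0.
exists eta; split=> // [p []//|p q [p0 nU] npq]; have [_ q0 _] := npq.
split=> // Uq; apply: nU; apply: hU Uq _.
have := h _ _ npq; rewrite (cocKi coc) => /(near_sym dd nN) npq'.
apply: near_le (npq' _); rewrite ?ge_min ?lexx //.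
rewrite -ler_pdivlMl // mulrC [_^-1 * _]mulrC.
by rewrite ge_min lexx orbT.
Qed.

End CoreLinear.

Lemma core_dual {R : realType} {B : Type} {V : vectType R} (dB : B -> B -> R)
    (N : V -> R) g G gi Gi U p : cocycle dB N g G gi Gi ->
  core (skew_map g G) [set p | p.2 != 0 /\ ~ U p] p <-> core (skew_map g G) (~` U) p.
Proof.
move=> coc; split=> cp p0 n; first by have [] := cp p0 n.
by split; [rewrite (iter_skew_eq0 coc)|exact: cp].
Qed.

(** * Dimensions of attractors and repellers *)

Lemma linear_lfun (R : fieldType) (V : vectType R) (f : V -> V) :
  linear f -> exists T : 'End(V), forall x, T x = f x.
Proof.
move=> lf.
pose L := GRing.isLinear.Build R V V *:%R f lf.
pose fL : {linear V -> V} := HB.pack f L.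
by exists (linfun fL) => x; rewrite lfunE.
Qed.

Lemma limg_dim_inj (R : fieldType) (V : vectType R) (T : 'End(V)) (W : {vspace V}) :
  (forall x, T x = 0 -> x = 0) -> \dim (T @: W)%VS = \dim W.
Proof.
move=> inj; apply: limg_dim_eq; apply/eqP; rewrite -subv0; apply/subvP => x.
by rewrite memv_cap memv_ker memv0 => /andP[_ /eqP /inj ->].
Qed.

Lemma dimv_gt_capv (R : fieldType) (V : vectType R) (W1 W2 : {vspace V}) :
  (\dim {:V} < \dim W1 + \dim W2)%N -> exists x, [/\ x \in W1, x \in W2 & x != 0].
Proof.
move=> h; exists (vpick (W1 :&: W2)).
have : vpick (W1 :&: W2)%VS \in (W1 :&: W2)%VS by exact: memv_pick.
rewrite memv_cap => /andP[-> ->]; split=> //.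
rewrite vpick0 -dimv_eq0 -lt0n -(ltn_add2l (\dim (W1 + W2))) addn0 dimv_sum_cap.
by apply: leq_ltn_trans h; exact: dimvS (subvf _).
Qed.

Section Dimensions.
Context {R : realType} {B : Type} {V : vectType R}.
Context (dB : B -> B -> R) (N : V -> R).
Variables (g : B -> B) (G : B -> V -> V) (gi : B -> B) (Gi : B -> V -> V).
Hypothesis coc : cocycle dB N g G gi Gi.
Hypothesis base_trans : forall b b' (e : R), 0 < e ->
  exists n, dchain (fun b c => dB (g b) c < e) n b b'.
Local Notation F := (skew_map g G).
Local Notation Fi := (skew_map gi Gi).

Let dd := coc_dist coc.
Let nN := coc_norm coc.
Let coci := cocycle_inv coc.

Variables (U : set (B * V)) (delta : R).
Hypothesis tU : trap dB N F U delta.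

Let delta0 : 0 < delta. Proof. by case: tU. Qed.

Lemma attractor_vspace : exists P : B -> {vspace V},
  forall b x, x \in P b <-> core Fi U (b, x).
Proof.
have /choice[P hP] : forall b, exists W : {vspace V},
    forall x, core Fi U (b, x) <-> x \in W.
  move=> b; apply: linear_vspace; first exact: core0.
  by move=> a x y; exact: (core_lin coc tU).
by exists P => b x; split=> /hP.
Qed.

Lemma repeller_vspace : exists Q : B -> {vspace V},
  forall b x, x \in Q b <-> core F (~` U) (b, x).
Proof.
have [delta' tU'] := trap_dual coc tU.
have /choice[Q hQ] : forall b, exists W : {vspace V}, forall x,
    core F [set p | p.2 != 0 /\ ~ U p] (b, x) <-> x \in W.
  move=> b; apply: linear_vspace; first by rewrite /core /= eqxx.
  by move=> a x y; exact: (core_lin coci tU').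
exists Q => b x; split; first by move=> /hQ /(core_dual _ _ coc).
by move=> /(core_dual _ _ coc) /hQ.
Qed.

(** The bundle is trivial, so at each jump of the base chain the vector can be kept unchanged: the
    only error is in the base, hence within the margin of the trap. *)
Lemma transport n b b' : dchain (fun b c => dB (g b) c < delta) n b b' ->
  exists2 T : 'End(V), (forall x, T x = 0 -> x = 0) &
    forall x, U (b, x) -> U (b', T x).
Proof.
elim: n b' => [|n IH] b'.
  by move=> h; rewrite -(dchain0E h); exists \1%VF => x; rewrite lfunE.
move=> h; have [c bc cb'] := dchainSE h; have [T Tinj hT] := IH _ bc.
have [S hS] := linear_lfun (coc_lin coc c).
have Sinj x : S x = 0 -> x = 0.
  by rewrite hS => /eqP; rewrite -[G c x]/((F (c, x)).2) (skew_eq0 coc) => /eqP.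
exists (S \o T)%VF => x; first by rewrite comp_lfunE => /Sinj /Tinj.
move=> /hT Ux; have [_ U0 hU] := tU; apply: (hU _ _ Ux); split=> //=.
  by rewrite comp_lfunE; apply/eqP => /Sinj; apply/eqP; exact: U0 Ux.
exists 1; first exact: oner_neq0.
rewrite comp_lfunE hS scale1r subrr (nrm0 nN) mulr_gt0 // nrm_gt0 // -hS.
by apply/eqP => /Sinj; apply/eqP; exact: U0 Ux.
Qed.

Lemma iter_lfun n b : exists2 T : 'End(V), (forall x, T x = 0 -> x = 0) &
  forall x, T x = (iter n F (b, x)).2.
Proof.
have [a x y|T hT] := @linear_lfun _ _ (fun x => (iter n F (b, x)).2).
  exact: (iter_skew_lin coc).
by exists T => // x /eqP; rewrite hT (iter_skew_eq0 coc) => /eqP.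
Qed.

Variables (P Q : B -> {vspace V}).
Hypothesis PE : forall b x, x \in P b <-> core Fi U (b, x).
Hypothesis QE : forall b x, x \in Q b <-> core F (~` U) (b, x).

Lemma capPQ b x : x \in P b -> x \in Q b -> x = 0.
Proof.
move=> /PE xP /QE xQ; apply/eqP/negPn/negP => x0.
exact: xQ x0 0%N (xP x0 0%N).
Qed.

(** Otherwise the transported fiber of [P] would meet that of [Q] in a nonzero vector, which would
    be both in [U] and outside it. *)
Lemma dim_attractor_le b b' : (\dim (P b) + \dim (Q b') <= \dim {:V})%N.
Proof.
have [n bb'] := base_trans b b' delta0.
have [T Tinj hT] := transport bb'.
rewrite -(limg_dim_inj (P b) Tinj) leqNgt; apply/negP => /dimv_gt_capv[y [yT yQ y0]].
have [x xP yE] := memv_imgP yT; rewrite {}yE in yT yQ y0.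
have x0 : x != 0 by apply: contraNneq y0 => ->; rewrite linear0.
by move/QE: yQ => /(_ y0 0%N); apply; apply: hT; move/PE: xP => /(_ x0 0%N).
Qed.

(** Unit vectors of [C] staying outside [U] for longer and longer times would accumulate at a unit
    vector of [C] that never enters [U], that is, one in [Q b]. *)
Let enter_uniform b (C : {vspace V}) : (forall x, x \in C -> x \in Q b -> x = 0) ->
  exists n, forall x, x \in C -> x != 0 -> U (iter n F (b, x)).
Proof.
move=> CQ; apply: contrapT => no.
have /choice[u hu] : forall n : nat, exists x, [/\ x \in C, N x = 1 &
    forall m, (m < n)%N -> ~ U (iter m F (b, x))].
  move=> n; apply: contrapT => no'; apply: no; exists n => x xC x0.
  apply: contrapT => nU; apply: no'; exists ((N x)^-1 *: x); split.
  - by rewrite memvZ.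
  - exact: nrm_unit.
  - move=> m mn Um; apply: nU; apply: (trap_iterW coc tU mn).
    have [_ _ hU] := tU; apply: hU Um _.
    have ux0 : (N x)^-1 *: x != 0.
      by rewrite scaler_eq0 negb_or x0 andbT invr_neq0 // nrm_eq0.
    have Nx0 : N x != 0 by rewrite nrm_eq0.
    have := near_iterZ coc m.+1 b delta0 Nx0 ux0.
    by rewrite scalerA mulfV // scale1r.
have [n|k [x [kn x1 kx]]] := @unit_sphere_compact _ _ _ nN u; first by have [] := hu n.
have x0 : x != 0 by rewrite -(nrm_eq0 nN) x1 oner_eq0.
have xC : x \in C.
  apply: (vspace_closed nN) => e /kx[K hK]; exists (u (k K)); last exact: hK.
  by have [] := hu (k K).
suff xQ : x \in Q b by move: x0; rewrite (CQ x xC xQ) eqxx.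
apply/QE => _ m Um.
have [eta eta0 hn] := near_iter coc m.+1 delta0.
have [K hK] := kx _ eta0; pose n := maxn K m.+2.
have [_ un /(_ m.+1)] := hu (k n); apply.
  by rewrite (leq_trans _ (kn n)) // leq_maxr.
have [_ _ hU] := tU; apply: hU Um _; apply: hn; apply: near_fiber => //.
  by rewrite x1 mulr1 hK // leq_maxl.
by rewrite -(nrm_eq0 nN) un oner_eq0.
Qed.

(** Push [C] forward until it lies in [U], transport it along the base to the n-th preimage of [b],
    and push it forward n steps: the result has the dimension of [C], and its n-th preimages are in
    [U]. *)
Let big_core_approx b (C : {vspace V}) : (forall x, x \in C -> x \in Q b -> x = 0) ->
  forall n, exists2 W : {vspace V}, \dim W = \dim C &
    forall x, x \in W -> x != 0 -> U (iter n Fi (b, x)).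
Proof.
move=> CQ n; have [n0 hn0] := enter_uniform CQ.
have [T1 T1inj hT1] := iter_lfun n0 b.
have [m bm] := base_trans (iter n0 F (b, 0)).1 (iter n Fi (b, 0)).1 delta0.
have [T2 T2inj hT2] := transport bm.
have [T3 T3inj hT3] := iter_lfun n (iter n Fi (b, 0)).1.
exists (T3 @: (T2 @: (T1 @: C)))%VS; first by rewrite !limg_dim_inj.
move=> _ /memv_imgP[_ /memv_imgP[_ /memv_imgP[x xC ->] ->] ->] y0.
have x0 : x != 0 by apply: contraNneq y0 => ->; rewrite !linear0.
have -> : iter n Fi (b, T3 (T2 (T1 x))) = ((iter n Fi (b, 0)).1, T2 (T1 x)).
  rewrite hT3; set z := T2 _.
  have -> : (b, (iter n F ((iter n Fi (b, 0)).1, z)).2) =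
            iter n F ((iter n Fi (b, 0)).1, z).
    rewrite [RHS]surjective_pairing; congr pair.
    by rewrite (@iter_skew1 _ _ _ g G n _ (iter n Fi (b, 0))) // (iter_skew_inv coc).
  by rewrite (iter_skew_inv coci).
by apply: hT2; rewrite hT1 -iter_skewE; exact: hn0.
Qed.

(** If the dimensions were too small, a complement of [P b] would meet each approximation of the
    core in a unit vector whose n-th preimage is in [U]. A limit of these vectors is in [P b] and in
    its complement. *)
Lemma dim_attractor_ge b : (\dim {:V} <= \dim (P b) + \dim (Q b))%N.
Proof.
rewrite leqNgt; apply/negP => lt.
pose C := ((Q b)^C)%VS; pose D := ((P b)^C)%VS.
have CQ x : x \in C -> x \in Q b -> x = 0.
  move=> xC xQ; apply/eqP; rewrite -memv0 -(capv_compl (Q b)) memv_cap xQ //.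
have DP x : x \in D -> x \in P b -> x = 0.
  move=> xD xP; apply/eqP; rewrite -memv0 -(capv_compl (P b)) memv_cap xP //.
have dC : \dim C = (\dim {:V} - \dim (Q b))%N by exact: dimv_compl.
have dD : \dim D = (\dim {:V} - \dim (P b))%N by exact: dimv_compl.
have lP : (\dim (P b) <= \dim {:V})%N by exact: dimvS (subvf _).
have /choice[u hu] : forall n : nat, exists x, [/\ x \in D, N x = 1 &
    U (iter n Fi (b, x))].
  move=> n; have [W dW hW] := big_core_approx CQ n.
  have [|x [xW xD x0]] := @dimv_gt_capv _ _ W D; first by rewrite dW dC dD; lia.
  exists ((N x)^-1 *: x); split; [by rewrite memvZ|exact: nrm_unit|].
  apply: hW; first by rewrite memvZ.
  by rewrite scaler_eq0 negb_or x0 andbT invr_neq0 // nrm_eq0.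
have [n|k [x [kn x1 kx]]] := @unit_sphere_compact _ _ _ nN u; first by have [] := hu n.
have x0 : x != 0 by rewrite -(nrm_eq0 nN) x1 oner_eq0.
have xD : x \in D.
  apply: (vspace_closed nN) => e /kx[K hK]; exists (u (k K)); last exact: hK.
  by have [] := hu (k K).
suff xP : x \in P b by move: x0; rewrite (DP x xD xP) eqxx.
apply/PE => _ m.
have [eta eta0 hn] := near_iter coci m delta0.
have [K hK] := kx _ eta0; pose n := maxn K m.+1.
have [_ un Un] := hu (k n).
have /(trap_near coc tU) : U (Fi (iter m Fi (b, u (k n)))).
  rewrite -iterS; apply: (trap_inv_iterW coc tU _ Un).
  by rewrite (leq_trans _ (kn n)) // leq_maxr.
apply; apply: hn; apply: near_fiber => //.
by rewrite (nrmC nN) un mulr1 hK // leq_maxl.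
Qed.

(** The upper bounds for (b, b') and (b', b) have the same total as the two diagonal lower bounds,
    so all are equalities. *)
Lemma dim_attractor b b' : (\dim (P b) + \dim (Q b') = \dim {:V})%N.
Proof.
have := dim_attractor_le b b'; have := dim_attractor_le b' b.
by have := dim_attractor_ge b; have := dim_attractor_ge b'; lia.
Qed.

End Dimensions.

(** * Chain equivalence and separation by attractors *)

Section Recurrence.
Context {R : realType} {B : Type} {V : vectType R}.
Context (dB : B -> B -> R) (N : V -> R).
Variables (g : B -> B) (G : B -> V -> V) (gi : B -> B) (Gi : B -> V -> V).
Hypothesis coc : cocycle dB N g G gi Gi.
Local Notation F := (skew_map g G).
Local Notation Fi := (skew_map gi Gi).
Local Notation conn := (conn dB N F).
Local Notation cstep := (cstep dB N F).
Local Notation trap := (trap dB N F).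
Implicit Types (e : R) (p q r : B * V).

Let dd := coc_dist coc.
Let nN := coc_norm coc.
Let coci := cocycle_inv coc.

Lemma conn_trans p q r : conn p q -> conn q r -> conn p r.
Proof.
move=> pq qr e e0; have [n n0 h] := pq e e0; have [m m0 h'] := qr e e0.
by exists (n + m)%N; [rewrite addn_gt0 n0|exact: dchain_cat h h'].
Qed.

Lemma conn_step p : p.2 != 0 -> conn p (F p).
Proof.
move=> p0 e e0; exists 1%N => //; apply: dchain1; apply: near_refl => //.
by rewrite (skew_eq0 coc).
Qed.

Lemma conn_neq0r p q : conn p q -> q.2 != 0.
Proof.
by move=> /(_ 1 ltr01)[[//|n] _ h]; have [r _ []] := dchainSE h.
Qed.

Lemma conn_neq0l p q : conn p q -> p.2 != 0.
Proof.
move=> /(_ 1 ltr01)[n n0]; rewrite -(prednK n0) -add1n => h.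
have [r h1 _] := dchain_split h; have [s h2 h3] := dchainSE h1.
by rewrite (dchain0E h2) -(skew_eq0 coc); exact: (near_neq0l nN h3).
Qed.

Let long_loop p e : conn p p -> 0 < e ->
  exists m, dchain (cstep e) m.+2 p p.
Proof.
move=> pp e0; have [[//|n] _ h] := pp e e0; exists (n + n)%N.
by have := dchain_cat h h; rewrite addSn addnS.
Qed.

(** Drop the last step of a loop at [p]: the point before it is close to [Fi p] by uniform
    continuity of the inverse, so the preceding step can be redirected there. [conn_image] does the
    same at the start of the loop. *)
Lemma conn_preimage p : conn p p -> conn p (Fi p).
Proof.
move=> pp e e0.
have e20 : 0 < Num.min 1 (e / 3) by rewrite lt_min ltr01 divr_gt0.
have [eta eta0 h] := coc_unifi coc e20; set e2 := Num.min 1 _ in e20 h.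
have e10 : 0 < Num.min e2 eta by rewrite lt_min e20.
have [m hm] := long_loop pp e10.
have [c2 hc2 s2] := dchainSE hm; have [c1 hc1 s1] := dchainSE hc2.
have s1' : pnear dB N e2 (F c1) c2 by apply: (near_le nN _ s1); rewrite ge_min lexx.
have s2' : pnear dB N e2 c2 (Fi p).
  rewrite -[c2](cocK coc); apply: h; apply: (near_le nN _ s2).
  by rewrite ge_min lexx orbT.
have e21 : e2 <= 1 by rewrite ge_min lexx.
have e23 : 3 * e2 <= e.
  have : e2 <= e / 3 by rewrite ge_min lexx orbT.
  by lra.
exists m.+1 => //; apply: dchainS (_ : dchain _ m p c1) _.
  apply: dchain_sub hc1 => u v; apply: (near_le nN).
  by rewrite ge_min; apply/orP; left; lra.
by apply: (near_le nN e23); exact: near_trans dd nN _ _ _ _ e21 s1' s2'.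
Qed.

Lemma conn_image p : conn p p -> conn (F p) p.
Proof.
move=> pp e e0.
have e20 : 0 < Num.min 1 (e / 3) by rewrite lt_min ltr01 divr_gt0.
have [eta eta0 h] := coc_unif coc e20; set e2 := Num.min 1 _ in e20 h.
have e10 : 0 < Num.min e2 eta by rewrite lt_min e20.
have [m hm] := long_loop pp e10.
have [c1 hc1 hm1] := dchain_split (m := 1) (n := m.+1) hm.
have [c2 hc2 hm2] := dchain_split (m := 1) (n := m) hm1.
have [p' hp s1] := dchainSE hc1; rewrite -(dchain0E hp) in s1.
have [c1' hc1' s2] := dchainSE hc2; rewrite -(dchain0E hc1') in s2.
have s1' : pnear dB N e2 (F (F p)) (F c1).
  by apply: h; apply: (near_le nN _ s1); rewrite ge_min lexx orbT.
have s2' : pnear dB N e2 (F c1) c2 by apply: (near_le nN _ s2); rewrite ge_min lexx.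
have e21 : e2 <= 1 by rewrite ge_min lexx.
have e23 : 3 * e2 <= e.
  have : e2 <= e / 3 by rewrite ge_min lexx orbT.
  by lra.
exists m.+1 => //; rewrite -add1n; apply: dchain_cat (_ : dchain _ 1 (F p) c2) _.
  by apply: dchain1; apply: near_le e23 _ => //; exact: near_trans s1' s2'.
apply: dchain_sub hm2 => u v; apply: (near_le nN).
by rewrite ge_min; apply/orP; left; lra.
Qed.

Lemma conn_iter n p : conn p p -> conn p (iter n F p) /\ conn (iter n F p) p.
Proof.
move=> pp; elim: n => [//|n [IH1 IH2]]; rewrite iterS.
have h := conn_trans IH2 IH1; split.
  by apply: conn_trans IH1 _; apply: conn_step; exact: conn_neq0l h.
exact: conn_trans (conn_image h) IH2.
Qed.

Lemma conn_iter_inv n p : conn p p -> conn p (iter n Fi p) /\ conn (iter n Fi p) p.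
Proof.
move=> pp; elim: n => [//|n [IH1 IH2]]; rewrite iterS.
have h := conn_trans IH2 IH1; split; first exact: conn_trans IH1 (conn_preimage h).
apply: conn_trans IH2; rewrite -{2}[iter n Fi p](cocKi coc); apply: conn_step.
by rewrite (skew_eq0 coci); exact: conn_neq0l h.
Qed.

Definition reach e p : set (B * V) :=
  [set q | exists2 n, (0 < n)%N & dchain (cstep e) n p q].

Lemma reach_trap e p : 0 < e -> trap (reach e p) e.
Proof.
move=> e0; split=> // [q [[//|n] _ h]|q r [n n0 h] s].
  by have [? _ []] := dchainSE h.
by exists n.+1 => //; exact: dchainS h s.
Qed.

Section TrapConn.
Variables (U : set (B * V)) (delta : R).
Hypothesis tU : trap U delta.

Let delta0 : 0 < delta. Proof. by case: tU. Qed.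

Lemma trap_conn p q : U p -> conn p q -> U q.
Proof.
move=> Up /(_ _ delta0)[n _]; elim: n q => [|n IH] q h.
  by rewrite -(dchain0E h).
have [r /IH Ur s] := dchainSE h.
by have [_ _ hU] := tU; apply: hU Ur s.
Qed.

(** If some forward iterate of p is in [U], then so is every backward iterate, being reachable from
    it by chains. *)
Lemma recurrent_core p : conn p p -> core Fi U p \/ core F (~` U) p.
Proof.
move=> pp; have [h|h] := pselect (core F (~` U) p); [by right|left].
move=> _ n; apply: contrapT => nU; apply: h => _ m Um; apply: nU.
apply: trap_conn Um _; apply: conn_trans (conn_iter m pp).2 _.
exact: (conn_iter_inv n pp).1.
Qed.

Lemma attractor_conn p q : core Fi U p -> conn p q -> conn q q -> core Fi U q.
Proof.
move=> Up pq qq _ n; apply: (trap_conn (Up (conn_neq0l pq) 0%N)).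
exact: conn_trans pq (conn_iter_inv n qq).1.
Qed.

Lemma repeller_conn p q : core F (~` U) q -> conn p q -> conn p p -> conn q q ->
  core F (~` U) p.
Proof.
move=> Uq pq pp qq; have [Up|//] := recurrent_core pp.
by have := Uq (conn_neq0r pq) 0%N; have := attractor_conn Up pq qq (conn_neq0r pq) 0%N.
Qed.

End TrapConn.

(** Both directions come from linearity of cores. Points reachable from [p] form a trap whose
    attractor contains x and y. If [p] were not reachable from the combination w, then x and y,
    hence w, would be in the repeller of the trap reachable from w, although that trap contains the
    image of w. *)
Lemma class_lin p b a (x y : V) :
  (x != 0 -> conn p (b, x) /\ conn (b, x) p) ->
  (y != 0 -> conn p (b, y) /\ conn (b, y) p) ->
  a *: x + y != 0 -> conn p (b, a *: x + y) /\ conn (b, a *: x + y) p.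
Proof.
move=> hx hy w0; split=> e e0; apply: contrapT => no.
- have tU := reach_trap p e0.
  have cU z : (z != 0 -> conn p (b, z) /\ conn (b, z) p) -> core Fi (reach e p) (b, z).
    move=> hz z0 n; have [pz zp] := hz z0.
    by have := conn_trans pz (conn_iter_inv n (conn_trans zp pz)).1; exact.
  have := core_lin (a := a) coc tU (cU _ hx) (cU _ hy).
  by move=> /(_ w0 0%N) h; apply: no.
- set w := (b, _) in no.
  have tU := reach_trap w e0.
  have [delta' tU'] := trap_dual coc tU.
  have cU z : (z != 0 -> conn p (b, z) /\ conn (b, z) p) ->
      core F [set q | q.2 != 0 /\ ~ reach e w q] (b, z).
    move=> hz z0 n; have [pz zp] := hz z0; split.
      by rewrite (iter_skew_eq0 coc).
    move=> [m m0 hm]; apply: no.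
    have [k k0 hk] := conn_trans (conn_iter n (conn_trans zp pz)).2 zp e0.
    by exists (m + k)%N; [rewrite addn_gt0 m0|exact: dchain_cat hm hk].
  have [_] := core_lin (a := a) coci tU' (cU _ hx) (cU _ hy) w0 1%N; apply.
  by have := @conn_step w w0; exact.
Qed.

Hypothesis base_trans : forall b b' (e : R), 0 < e ->
  exists n, dchain (fun b c => dB (g b) c < e) n b b'.

(** The conclusion is symmetric in [P] and [Q] and leaves open which of them is the attractor; this
    permits the choice of a direction in which chains fail to exist. *)
Lemma separation p q : conn p p -> conn q q -> ~ (conn p q /\ conn q p) ->
  exists P Q : B -> {vspace V},
  [/\ forall b x, x \in P b -> x \in Q b -> x = 0,
      forall b b', (\dim (P b) + \dim (Q b') = \dim {:V})%N,
      forall b x, conn (b, x) (b, x) -> x \in P b \/ x \in Q b,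
      (forall r s, conn r s -> conn s r -> r.2 \in P r.1 -> s.2 \in P s.1) /\
      (forall r s, conn r s -> conn s r -> r.2 \in Q r.1 -> s.2 \in Q s.1) &
      p.2 \in P p.1 /\ q.2 \in Q q.1].
Proof.
suff sep r s : conn r r -> conn s s -> ~ conn r s -> exists P Q : B -> {vspace V},
  [/\ forall b x, x \in P b -> x \in Q b -> x = 0,
      forall b b', (\dim (P b) + \dim (Q b') = \dim {:V})%N,
      forall b x, conn (b, x) (b, x) -> x \in P b \/ x \in Q b,
      (forall r s, conn r s -> conn s r -> r.2 \in P r.1 -> s.2 \in P s.1) /\
      (forall r s, conn r s -> conn s r -> r.2 \in Q r.1 -> s.2 \in Q s.1) &
      r.2 \in P r.1 /\ s.2 \in Q s.1].
  move=> pp qq npq; have [pq|npq'] := pselect (conn p q); last exact: sep.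
  have [|P [Q [h1 h2 h3 [h4 h5] [h6 h7]]]] := sep q p qq pp; first by move=> qp; apply: npq.
  exists Q, P; split=> //.
  - by move=> b x xQ xP; exact: h1 xP xQ.
  - by move=> b b'; rewrite addnC.
  - by move=> b x /h3; rewrite or_comm.
move=> rr ss nrs.
have [e e0 nE] : exists2 e, 0 < e & ~ reach e r s.
  apply: contrapT => no; apply: nrs => e e0; apply: contrapT => ne.
  by apply: no; exists e.
have tU := reach_trap r e0.
have [P PE] := attractor_vspace coc tU; have [Q QE] := repeller_vspace coc tU.
have PE' z : z.2 \in P z.1 <-> core Fi (reach e r) z.
  by rewrite PE -surjective_pairing.
have QE' z : z.2 \in Q z.1 <-> core F (~` reach e r) z.
  by rewrite QE -surjective_pairing.
exists P, Q; split.
- exact: capPQ PE QE.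
- by move=> b b'; exact: (dim_attractor coc base_trans tU PE QE b b').
- by move=> b x /(recurrent_core tU)[/PE|/QE]; [left|right].
- split=> r' s' rs sr.
  + by move=> /PE' h; apply/PE'; exact: (attractor_conn tU h rs (conn_trans sr rs)).
  + move=> /QE' h; apply/QE'; exact: (repeller_conn tU h sr (conn_trans sr rs) (conn_trans rs sr)).
- split.
  + apply/PE' => _ n; exact: (conn_iter_inv n rr).1 _ e0.
  + by apply/QE'; have [h|//] := recurrent_core tU ss; case: nE; exact: h (conn_neq0l ss) 0%N.
Qed.

(** Separate i from another index j with nonzero vector. The vectors in [P b] and the others, which
    are in [Q b], sum to zero separately, and the first group is smaller because it omits j. *)
Lemma class_independent b (I : finType) (x : I -> V) (J : {set I}) :
  (forall i, i \in J -> x i != 0 -> conn (b, x i) (b, x i)) ->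
  (forall i j, i \in J -> j \in J -> x i != 0 -> x j != 0 ->
    conn (b, x i) (b, x j) -> conn (b, x j) (b, x i) -> i = j) ->
  \sum_(i in J) x i = 0 -> forall i, i \in J -> x i = 0.
Proof.
move: {2}(#|J|) (leqnn #|J|) => n; elim: n J => [|n IH] J.
  by rewrite leqn0 cards_eq0 => /eqP-> _ _ _ i; rewrite inE.
move=> Jn rec inj sum0 i iJ.
apply: contrapT => /eqP xi0.
have [[j [jJ ji xj0]]|none] := pselect (exists j, [/\ j \in J, j != i & x j != 0]); last first.
  move: sum0; rewrite (bigD1 i) //= big1 ?addr0; first by move/eqP; rewrite (negPf xi0).
  by move=> j /andP[jJ ji]; apply: contrapT => /eqP xj0; apply: none; exists j.
have [|P [Q [PQ0 _ PQ _ [iP jQ]]]] := separation (rec i iJ xi0) (rec j jJ xj0).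
  by move=> [h1 h2]; move: ji; rewrite (inj i j iJ jJ xi0 xj0 h1 h2) eqxx.
rewrite /= in iP jQ.
pose JP := [set k in J | x k \in P b]%SET; pose JQ := [set k in J | x k \notin P b]%SET.
have jnP : x j \notin P b.
  by apply: contraNN xj0 => jP; rewrite (PQ0 b _ jP jQ).
have sPQ : \sum_(k in JP) x k + \sum_(k in JQ) x k = 0.
  rewrite -[RHS]sum0 [RHS](bigID (fun k => x k \in P b)) /=.
  have -> : \sum_(k in JP) x k = \sum_(k in J | x k \in P b) x k.
    by apply: eq_bigl => k; rewrite inE.
  have -> // : \sum_(k in JQ) x k = \sum_(k in J | x k \notin P b) x k.
  by apply: eq_bigl => k; rewrite inE.
have sP : \sum_(k in JP) x k \in P b by apply: memv_suml => k; rewrite inE => /andP[].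
have sQ : \sum_(k in JQ) x k \in Q b.
  apply: memv_suml => k; rewrite inE => /andP[kJ kP].
  have [xk0|xk0] := eqVneq (x k) 0; first by rewrite xk0 mem0v.
  by have [h|//] := PQ _ _ (rec k kJ xk0); rewrite h in kP.
have sP0 : \sum_(k in JP) x k = 0.
  apply: (PQ0 b) => //; have /eqP := sPQ; rewrite addr_eq0 => /eqP ->.
  by rewrite memvN.
have JPJ : JP \subset J by apply/fintype.subsetP => k; rewrite inE => /andP[].
suff xi : x i = 0 by rewrite xi eqxx in xi0.
apply: (IH JP) => //.
- rewrite -ltnS (leq_trans _ Jn) // proper_card //.
  by apply/properP; split=> //; exists j; rewrite // inE jJ.
- by move=> k /(fintype.subsetP JPJ); exact: rec.
- by move=> k l /(fintype.subsetP JPJ) kJ /(fintype.subsetP JPJ); exact: inj.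
- by rewrite inE iJ.
Qed.

End Recurrence.

(** * Spanning by recurrent vectors *)

Lemma vspace_union (K : fieldType) (V : vectType K) (W1 W2 W : {vspace V}) :
  (forall x, x \in W <-> x \in W1 \/ x \in W2) -> (W1 <= W2)%VS \/ (W2 <= W1)%VS.
Proof.
move=> WE; have [h|/subvPn[x xW1 xW2]] := boolP (W1 <= W2)%VS; [by left|right].
apply/subvP => y yW2; apply: contrapT => /negP yW1.
have : x + y \in W by rewrite memvD //; apply/WE; [left|right].
move=> /WE[h|h].
- by move: yW1; rewrite -[y](addKr x) addrC memvB.
- by move: xW2; rewrite -[x](addrK y) memvB.
Qed.

Section Spanning.
Context {R : realType} {B : Type} {V : vectType R}.
Context (dB : B -> B -> R) (N : V -> R).
Variables (g : B -> B) (G : B -> V -> V) (gi : B -> B) (Gi : B -> V -> V).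
Hypothesis coc : cocycle dB N g G gi Gi.
Hypothesis base_trans : forall b b' (e : R), 0 < e ->
  exists n, dchain (fun b c => dB (g b) c < e) n b b'.
Local Notation F := (skew_map g G).
Local Notation Fi := (skew_map gi Gi).
Local Notation conn := (conn dB N F).
Local Notation trap := (trap dB N F).
Implicit Types (e delta : R) (p q r : B * V) (U W : set (B * V)) (P Q : B -> {vspace V}).

Let nN := coc_norm coc.

Lemma trapU U1 U2 d1 d2 : trap U1 d1 -> trap U2 d2 ->
  trap (U1 `|` U2) (Num.min d1 d2).
Proof.
move=> [e1 n1 h1] [e2 n2 h2]; split; first by rewrite lt_min e1.
  by move=> p [/n1|/n2].
move=> p q [U1p|U2p] npq; [left; apply: h1 U1p _|right; apply: h2 U2p _];
  by apply: (near_le nN _ npq); rewrite ge_min lexx ?orbT.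
Qed.

Lemma trapI U1 U2 d1 d2 : trap U1 d1 -> trap U2 d2 ->
  trap (U1 `&` U2) (Num.min d1 d2).
Proof.
move=> [e1 n1 h1] [e2 n2 h2]; split; first by rewrite lt_min e1.
  by move=> p [/n1].
move=> p q [U1p U2p] npq; split; [apply: h1 U1p _|apply: h2 U2p _];
  by apply: (near_le nN _ npq); rewrite ge_min lexx ?orbT.
Qed.

Record attractor_pair U P Q : Prop := AttractorPair {
  ap_trap : exists delta, trap U delta;
  ap_P : forall b x, x \in P b <-> core Fi U (b, x);
  ap_Q : forall b x, x \in Q b <-> core F (~` U) (b, x) }.

Lemma attractor_pair_ex U delta : trap U delta -> exists P Q, attractor_pair U P Q.
Proof.
move=> tU; have [P PE] := attractor_vspace coc tU.
have [Q QE] := repeller_vspace coc tU.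
by exists P, Q; split=> //; exists delta.
Qed.

Lemma ap_dim U P Q b b' : attractor_pair U P Q ->
  (\dim (P b) + \dim (Q b') = \dim {:V})%N.
Proof. by move=> [[d tU] PE QE]; exact: (dim_attractor coc base_trans tU PE QE). Qed.

Lemma ap_cap U P Q b x : attractor_pair U P Q -> x \in P b -> x \in Q b -> x = 0.
Proof. by move=> [_ PE QE]; exact: (capPQ PE QE). Qed.

Lemma ap_split U P Q b x : attractor_pair U P Q ->
  exists y z, [/\ y \in P b, z \in Q b & x = y + z].
Proof.
move=> ap.
have /eqP full : (P b + Q b == fullv)%VS.
  rewrite eqEdim subvf /= dimv_disjoint_sum ?(ap_dim b b ap) //.
  apply/eqP; rewrite -subv0; apply/subvP => y; rewrite memv_cap memv0 => /andP[yP yQ].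
  by rewrite (ap_cap ap yP yQ).
have : x \in (P b + Q b)%VS by rewrite full memvf.
by move=> /memv_addP[y yP [z zQ ->]]; exists y, z.
Qed.

Section TwoAttractors.
Variables (U1 U2 : set (B * V)) (P1 Q1 P2 Q2 : B -> {vspace V}).
Hypotheses (ap1 : attractor_pair U1 P1 Q1) (ap2 : attractor_pair U2 P2 Q2).

Let dimP U P Q b b' : attractor_pair U P Q -> \dim (P b) = \dim (P b').
Proof. by move=> ap; have := ap_dim b b ap; have := ap_dim b' b ap; lia. Qed.

(* The union of two traps is a trap, and the union of two attractors is
   fiberwise linear only if one contains the other. *)
Lemma attractors_total :
  (forall b, (P1 b <= P2 b)%VS) \/ (forall b, (P2 b <= P1 b)%VS).
Proof.
have [[d1 t1] P1E _] := ap1; have [[d2 t2] P2E _] := ap2.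
have [P [Q [_ PE _]]] := attractor_pair_ex (trapU t1 t2).
have tot b : (P1 b <= P2 b)%VS \/ (P2 b <= P1 b)%VS.
  apply: (@vspace_union _ _ _ _ (P b)) => x; split; last first.
    by case=> [/P1E h|/P2E h]; apply/PE => x0 n; [left|right]; exact: h.
  move=> /PE h; have [h1|h1] := pselect (x \in P1 b); [by left|right].
  apply/P2E => x0 n; have [n0 nU1] : exists n, ~ U1 (iter n Fi (b, x)).
    apply: contrapT => no; apply: h1; apply/P1E => _ m; apply: contrapT => ?.
    by apply: no; exists m.
  have [/(trap_inv_iterW coc t1 (leq_maxr n n0))//|] := h x0 (maxn n n0).
  exact: (trap_inv_iterW coc t2 (leq_maxl n n0)).
(* The direction of inclusion could so far vary with b; constancy of the dimensions excludes
   this. *)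
have [h|no] := pselect (forall b, (P1 b <= P2 b)%VS); [by left|right].
have [b /negP nb] : exists b, ~ (P1 b <= P2 b)%VS.
  by apply: contrapT => no'; apply: no => b; apply: contrapT => ?; apply: no'; exists b.
have [h|h] := tot b; first by rewrite h in nb.
move=> b'; have [h'|//] := tot b'.
have : P2 b == P1 b.
  by rewrite eqEdim h (dimP b b' ap1) (dimP b b' ap2); exact: dimvS.
by move=> /eqP e21; move: nb; rewrite e21 subvv.
Qed.

(** The repeller of the intersection of the two traps is the union of the repellers, so in each
    fiber one contains the other; the complementary dimensions decide which. *)
Lemma repellers_anti : (forall b, (P1 b <= P2 b)%VS) ->
  forall b, (Q2 b <= Q1 b)%VS.
Proof.
move=> h12 b.
have [[d1 t1] _ Q1E] := ap1; have [[d2 t2] _ Q2E] := ap2.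
have [P [Q [_ _ QE]]] := attractor_pair_ex (trapI t1 t2).
have tot : (Q1 b <= Q2 b)%VS \/ (Q2 b <= Q1 b)%VS.
  apply: (@vspace_union _ _ _ _ (Q b)) => x; split; last first.
    by case=> [/Q1E h|/Q2E h]; apply/QE => x0 n [u1 u2]; apply: h u1 || apply: h u2.
  move=> /QE h; have [h1|h1] := pselect (x \in Q1 b); [by left|right].
  apply/Q2E => x0 n U2n; have [m U1m] : exists m, U1 (iter m F (b, x)).
    apply: contrapT => no; apply: h1; apply/Q1E => _ m U1m; apply: no.
    by exists m.
  apply: (h x0 (maxn m n)); split.
    exact: (trap_iterW coc t1 (leq_maxl m n)).
  exact: (trap_iterW coc t2 (leq_maxr m n)).
have [h|//] := tot.
have : Q1 b == Q2 b.
  rewrite eqEdim h /=; have := ap_dim b b ap1; have := ap_dim b b ap2.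
  by have := dimvS (h12 b); lia.
by move=> /eqP ->.
Qed.

End TwoAttractors.

Definition recurrent_span b (x : V) : Prop := exists s : seq V,
  (forall y, y \in s -> conn (b, y) (b, y)) /\ x = \sum_(y <- s) y.

Lemma recurrent_spanD b x y : recurrent_span b x -> recurrent_span b y ->
  recurrent_span b (x + y).
Proof.
move=> [s [hs ->]] [t [ht ->]]; exists (s ++ t); split; last by rewrite big_cat.
by move=> z; rewrite mem_cat => /orP[/hs|/ht].
Qed.

(** Induction on the dimension gap between two nested attractors. If all nonzero vectors of [PW] and
    [QU] are joined by chains, each is recurrent. Otherwise some q is not e-reachable from some p,
    and the attractor of the set reachable from p lies strictly between: p is not in its repeller
    and q is not in it. The vector is split accordingly. *)
Lemma recurrent_span_between n U W PU QU PW QW :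
  attractor_pair U PU QU -> attractor_pair W PW QW ->
  (forall b, (PU b <= PW b)%VS) ->
  forall b x, (\dim (PW b) - \dim (PU b) <= n)%N ->
    x \in PW b -> x \in QU b -> recurrent_span b x.
Proof.
elim: n U W PU QU PW QW => [|n IH] U W PU QU PW QW apU apW UW b x dn xW xU.
  have /eqP eUW : PU b == PW b by rewrite eqEdim UW -subn_eq0 -leqn0.
  exists [::]; split=> //; rewrite big_nil.
  by apply: (ap_cap apU) xU; rewrite eUW.
have [rec|no] := pselect (forall p q, p.2 != 0 -> q.2 != 0 ->
    p.2 \in PW p.1 -> p.2 \in QU p.1 -> q.2 \in PW q.1 -> q.2 \in QU q.1 -> conn p q).
  have [->|x0] := eqVneq x 0; first by exists [::]; rewrite big_nil.
  exists [:: x]; rewrite big_seq1; split=> // y; rewrite inE => /eqP ->.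
  exact: rec.
have [p [q [p0 q0 [pW pU qW qU] npq]]] : exists p q, [/\ p.2 != 0, q.2 != 0,
    [/\ p.2 \in PW p.1, p.2 \in QU p.1, q.2 \in PW q.1 & q.2 \in QU q.1] & ~ conn p q].
  apply: contrapT => no'; apply: no => p q p0 q0 h1 h2 h3 h4; apply: contrapT => ?.
  by apply: no'; exists p, q.
have [e e0 nE] : exists2 e : R, 0 < e & ~ reach dB N g G e p q.
  apply: contrapT => no'; apply: npq => e e0; apply: contrapT => ne.
  by apply: no'; exists e.
have tZ : trap (reach dB N g G e p) e by exact: reach_trap.
have [PZ [QZ apZ]] := attractor_pair_ex tZ.
have pZ : p.2 \notin QZ p.1.
  apply/negP => /(ap_Q apZ); rewrite -surjective_pairing => /(_ p0 1%N); apply.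
  by have := conn_step coc p0 e0.
have qZ : q.2 \notin PZ q.1.
  by apply/negP => /(ap_P apZ); rewrite -surjective_pairing => /(_ q0 0%N).
have UZ : forall b, (PU b <= PZ b)%VS.
  have [//|h] := attractors_total apU apZ.
  by case/negP: pZ; exact: subvP (repellers_anti apZ apU h p.1) _ pU.
have ZW : forall b, (PZ b <= PW b)%VS.
  have [//|h] := attractors_total apZ apW.
  by case/negP: qZ; exact: subvP (h q.1) _ qW.
have dim_const A PA QA b1 b2 : attractor_pair A PA QA -> \dim (PA b1) = \dim (PA b2).
  by move=> ap; have := ap_dim b1 b1 ap; have := ap_dim b2 b1 ap; lia.
have dUZ : (\dim (PU b) < \dim (PZ b))%N.
  rewrite ltnNge; apply/negP => le.
  have h b' : (PZ b' <= PU b')%VS.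
    suff /eqP -> : PU b' == PZ b' by [].
    by rewrite eqEdim UZ (dim_const _ _ _ b' b apZ) (dim_const _ _ _ b' b apU).
  by case/negP: pZ; exact: subvP (repellers_anti apZ apU h p.1) _ pU.
have dZW : (\dim (PZ b) < \dim (PW b))%N.
  rewrite ltnNge; apply/negP => le.
  suff /eqP eZW : PZ q.1 == PW q.1 by rewrite eZW qW in qZ.
  by rewrite eqEdim ZW (dim_const _ _ _ q.1 b apZ) (dim_const _ _ _ q.1 b apW).
have dWb : (\dim (PW b) <= \dim {:V})%N by exact: dimvS (subvf _).
have [y [z [yZ zZ xE]]] := ap_split b x apZ.
have zU : z \in QU b by exact: subvP (repellers_anti apU apZ UZ b) _ zZ.
have yU : y \in QU b by rewrite -[y](addrK z) -xE memvB.
have yW : y \in PW b by exact: subvP (ZW b) _ yZ.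
have zW : z \in PW b by rewrite -[z](addKr y) -xE addrC memvB.
have [d1 d2] : (\dim (PZ b) - \dim (PU b) <= n)%N /\ (\dim (PW b) - \dim (PZ b) <= n)%N.
  by move: dn dUZ dZW; move: (\dim _) (\dim _) (\dim _); clear=> a c d; lia.
rewrite xE; apply: recurrent_spanD.
  exact: (IH _ _ _ _ _ _ apU apZ UZ b y d1 yZ yU).
exact: (IH _ _ _ _ _ _ apZ apW ZW b z d2 zW zZ).
Qed.

Lemma recurrent_span_full b x : recurrent_span b x.
Proof.
(* The two extreme traps: the empty one has the whole space as repeller, the other has the whole
   space as attractor. *)
have t0 : trap set0 1 by split.
have t1 : trap [set p | p.2 != 0] 1 by split=> // p q _ [].
have [P0 [Q0 ap0]] := attractor_pair_ex t0.
have [P1 [Q1 ap1]] := attractor_pair_ex t1.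
have P1f b' : P1 b' = fullv.
  apply/vspaceP => y; rewrite memvf; apply/(ap_P ap1) => y0 n /=.
  by rewrite (iter_skew_eq0 (cocycle_inv coc)).
apply: (recurrent_span_between ap0 ap1 _ (leqnn _)) => [b'||].
- by rewrite P1f subvf.
- by rewrite P1f memvf.
- by apply/(ap_Q ap0) => _ n [].
Qed.

End Spanning.

(** * The projective flow and Selgrade bundles *)

(* proj also names a projection of mathcomp-analysis. *)
Local Notation proj := Defs.proj.

Section ProjectiveMetric.
Context {R : realType} {V : vectType R} (dot : V -> V -> R).
Local Notation N := (dot_norm dot).
Hypothesis nN : is_norm N.
Local Notation pd := (proj_dist dot).
Implicit Types (p q r : proj_space V) (x y : V) (e : R).

Lemma vpick_neq0 p : vpick (val p) != 0.
Proof. by rewrite vpick0 -dimv_eq0 (eqP (valP p)). Qed.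

Lemma val_vline p x : x \in val p -> x != 0 -> val p = <[x]>%VS.
Proof.
move=> xp x0; apply/esym/eqP; rewrite eqEdim -memvE xp /=.
by rewrite dim_vline x0 (eqP (valP p)).
Qed.

Lemma projE p x (x0 : x != 0) : x \in val p -> proj x0 = p.
Proof. by move=> xp; apply: val_inj; rewrite /= (val_vline xp x0). Qed.

Lemma mem_proj x (x0 : x != 0) : x \in val (proj x0).
Proof. exact: memv_line. Qed.

Lemma norm_unit_pick p : N (unit_pick dot p) = 1.
Proof. by apply: nrm_unit => //; exact: vpick_neq0. Qed.

Lemma unit_pick_mem p : unit_pick dot p \in val p.
Proof. by rewrite memvZ // memv_pick. Qed.

Lemma unit_pick_neq0 p : unit_pick dot p != 0.
Proof. by rewrite -(nrm_eq0 nN) norm_unit_pick oner_eq0. Qed.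

Lemma unit_pick_coord p x : x \in val p ->
  exists2 c, `|c| = N x & x = c *: unit_pick dot p.
Proof.
rewrite (val_vline (unit_pick_mem p) (unit_pick_neq0 p)) => /vlineP[c ->].
by exists c => //; rewrite (nrmZ nN) norm_unit_pick mulr1.
Qed.

Lemma is_dist_proj : is_dist pd.
Proof.
split.
- move=> p; rewrite /proj_dist subrr (nrm0 nN).
  by apply/min_idPl; exact: nrm_ge0.
- move=> p q; rewrite /proj_dist (nrmC nN); congr Num.min.
  by rewrite addrC.
- move=> p q r; rewrite /proj_dist.
  set u := unit_pick dot p; set v := unit_pick dot q; set w := unit_pick dot r.
  have h1 : N (u - w) <= N (u - v) + N (v - w).
    by rewrite (le_trans _ (nrmD nN _ _)) // addrA subrK.
  have h2 : N (u - w) <= N (u + v) + N (v + w).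
    by rewrite (le_trans _ (nrmB nN _ _)) // opprD addrA addrK.
  have h3 : N (u + w) <= N (u - v) + N (v + w).
    by rewrite (le_trans _ (nrmD nN _ _)) // addrA subrK.
  have h4 : N (u + w) <= N (u + v) + N (v - w).
    by rewrite (le_trans _ (nrmB nN _ _)) // opprB addrACA subrr addr0.
  by rewrite ge_min; case: (leP (N (u - v))) => _; case: (leP (N (v - w))) => _;
    apply/orP; [left|right|right|left].
Qed.

Lemma proj_dist_lt e p q x y : x \in val p -> x != 0 -> y \in val q -> y != 0 ->
  pd p q < e -> exists2 a, a != 0 & N (a *: y - x) < e * N x.
Proof.
move=> xp x0 yq y0; have [c cx ->] := unit_pick_coord xp.
have [k ky ->] := unit_pick_coord yq.
have c0 : 0 < `|c| by rewrite cx nrm_gt0.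
have k0 : k != 0 by rewrite -normr_eq0 ky nrm_eq0.
rewrite /proj_dist gt_min; move: (norm_unit_pick p) (norm_unit_pick q).
move: (unit_pick dot p) (unit_pick dot q) => u v u1 v1 /orP[h|h].
- exists (c / k); first by rewrite mulf_neq0 ?invr_neq0 // -normr_gt0.
  rewrite scalerA divfK // -scalerBr !(nrmZ nN) u1 mulr1 mulrC.
  by rewrite ltr_pM2r // (nrmC nN).
- exists (- (c / k)); first by rewrite oppr_eq0 mulf_neq0 ?invr_neq0 // -normr_gt0.
  rewrite scalerA mulNr divfK // scaleNr -opprD (nrmN nN) -scalerDr !(nrmZ nN).
  by rewrite u1 mulr1 mulrC ltr_pM2r // addrC.
Qed.

(** Between unit representatives the comparison scalar m satisfies [| |m| - 1 | < e]; replacing m by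
    its sign costs a second e. *)
Lemma lt_proj_dist e p q x y a : x \in val p -> x != 0 -> y \in val q ->
  N (a *: y - x) < e * N x -> pd p q < 2 * e.
Proof.
move=> xp x0 yq; have [c cx xE] := unit_pick_coord xp.
have [k ky yE] := unit_pick_coord yq.
have c0 : 0 < `|c| by rewrite cx nrm_gt0.
have cn0 : c != 0 by rewrite -normr_gt0.
set u := unit_pick dot p in xE; set v := unit_pick dot q in yE.
pose m := a * k / c.
have -> : a *: y - x = c *: (m *: v - u).
  by rewrite scalerBr scalerA mulrC divfK // -scalerA -yE -xE.
rewrite (nrmZ nN) -cx mulrC ltr_pM2r // => h.
have u1 : N u = 1 by exact: norm_unit_pick.
have v1 : N v = 1 by exact: norm_unit_pick.
have hm : `| `|m| - 1 | < e.
  apply: le_lt_trans h; have h1 := nrm_dist nN (m *: v) u.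
  have h2 := nrm_dist nN u (m *: v); rewrite (nrmC nN u) in h2.
  rewrite (nrmZ nN) u1 v1 mulr1 in h1 h2.
  by rewrite ler_norml; lra.
rewrite /proj_dist -/u -/v gt_min; apply/orP; have [m0|m0] := leP 0 m; [left|right].
- have -> : u - v = - (m *: v - u) - (1 - m) *: v.
    by rewrite opprB scalerBl scale1r opprB addrA subrK.
  apply: le_lt_trans (nrmB nN _ _) _; rewrite (nrmN nN) (nrmZ nN) v1 mulr1.
  by move: hm; rewrite (ger0_norm m0) distrC; lra.
- have -> : u + v = - (m *: v - u) + (1 + m) *: v.
    by rewrite opprB scalerDl scale1r [v + _]addrC addrA subrK.
  apply: le_lt_trans (nrmD nN _ _) _; rewrite (nrmN nN) (nrmZ nN) v1 mulr1.
  by move: hm; rewrite (ltr0_norm m0) -opprD normrN addrC; lra.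
Qed.

Lemma seq_compact_proj : seq_compact pd.
Proof.
move=> q; have [m|k [x [kn x1 kx]]] :=
    @unit_sphere_compact _ _ _ nN (fun n => unit_pick dot (q n)).
  exact: norm_unit_pick.
have x0 : x != 0 by rewrite -(nrm_eq0 nN) x1 oner_eq0.
exists k, (proj x0); split=> // e e0; have e20 : 0 < e / 2 by rewrite divr_gt0.
have [K hK] := kx _ e20; exists K => n /hK h.
have -> : e = 2 * (e / 2) by rewrite mulrC divfK.
apply: (@lt_proj_dist _ _ _ (unit_pick dot (q (k n))) x 1).
- exact: unit_pick_mem.
- exact: unit_pick_neq0.
- exact: mem_proj.
- by rewrite scale1r (nrmC nN) norm_unit_pick mulr1.
Qed.

End ProjectiveMetric.

Section LinearFlow.
Context {R : realType} {B : Type} {V : vectType R}.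
Variables (dB : B -> B -> R) (dot : V -> V -> R).
Variables (theta : R -> B -> B) (phi : R -> B -> V -> V).
Local Notation N := (dot_norm dot).
Hypotheses (dd : is_dist dB) (cB : seq_compact dB) (nN : is_norm N).
Hypothesis linf : is_linear_flow dB dot theta phi.
Hypothesis base_trans : chain_transitive dB theta setT.
Local Notation pd := (proj_dist dot).
Local Notation Pdist := (max_dist dB pd).
Local Notation Pflow := (proj_flow theta phi).
Local Notation F := (skew_map (theta 1) (phi 1)).
Local Notation pconn := (conn dB N F).
Implicit Types (e t s : R) (b : B) (p q : proj_space V) (x y : V).

Let lin t b : linear (phi t b). Proof. by case: linf => h _; exact: h. Qed.

Lemma flow_lin0 t b : phi t b 0 = 0.
Proof. by have := lin t b (-1) 0 0; rewrite scaler0 addr0 scaleN1r addNr. Qed.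

Lemma flow_linZ t b a x : phi t b (a *: x) = a *: phi t b x.
Proof. by have := lin t b a x 0; rewrite !addr0 flow_lin0 addr0. Qed.

Lemma flow_theta0 b : theta 0 b = b.
Proof. by case: linf => _ [_ h _]; have := h (b, 0) => -[]. Qed.

Lemma flow_thetaD t s b : theta (t + s) b = theta t (theta s b).
Proof. by case: linf => _ [_ _ h]; have := h t s (b, 0) => -[]. Qed.

Lemma flow_phi0 b x : phi 0 b x = x.
Proof. by case: linf => _ [_ h _]; have := h (b, x) => -[]. Qed.

Lemma flow_phiD t s b x : phi (t + s) b x = phi t (theta s b) (phi s b x).
Proof. by case: linf => _ [_ _ h]; have := h t s (b, x) => -[]. Qed.

Lemma proj_flow_mem t b p x : x \in val p -> phi t b x \in val (Pflow t (b, p)).2.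
Proof.
rewrite /= val_insubd dim_vline (linear_flow_neq0 t b linf (vpick_neq0 p)) /= => xp.
have /vlineP[c ->] : x \in <[vpick (val p)]>%VS.
  by rewrite -(val_vline (memv_pick _) (vpick_neq0 p)).
by rewrite flow_linZ memvZ // memv_line.
Qed.

Lemma base_flow : is_flow dB theta.
Proof.
case: linf => _ [jc _ _]; split; [|exact: flow_theta0|exact: flow_thetaD].
move=> t b e e0; have [delta d0 h] := jc t (b, 0) e e0; exists delta => // s b' ts bb'.
have := h s (b', 0) ts; rewrite /max_dist /= gt_max bb' /= /dot_dist subrr (nrm0 nN) d0.
by move=> /(_ isT); rewrite gt_max => /andP[].
Qed.

Lemma pflow_is_flow : is_flow Pdist Pflow.
Proof.
split.
- move=> t [b p] e e0.
  set x := unit_pick dot p; have x0 : x != 0 by exact: unit_pick_neq0.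
  have x1 : N x = 1 by exact: norm_unit_pick.
  have y0 : phi t b x != 0 by exact: linear_flow_neq0 linf x0.
  (* Continuity of the linear flow bounds an absolute error. The factor [N (phi t b x)] makes it
     relative, and the half compensates the loss in [lt_proj_dist]. *)
  have e'0 : 0 < Num.min e (e / 2 * N (phi t b x)).
    by rewrite lt_min e0 mulr_gt0 ?divr_gt0 // nrm_gt0.
  case: (linf) => _ [jc _ _].
  have [delta d0 h] := jc t (b, x) _ e'0; exists delta => // s [b' q] ts.
  rewrite {1}/max_dist gt_max /= => /andP[bb' pq].
  have [a a0 ha] := proj_dist_lt nN (unit_pick_mem dot p) x0
    (unit_pick_mem dot q) (unit_pick_neq0 nN q) pq.
  rewrite -/x x1 mulr1 in ha.
  have := h s (b', a *: unit_pick dot q) ts.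
  rewrite {1}/max_dist gt_max /= bb' /= /dot_dist (nrmC nN) => /(_ ha).
  rewrite /max_dist !gt_max /= => /andP[]; rewrite !lt_min => /andP[-> _] /andP[_ h2] /=.
  have -> : e = 2 * (e / 2) by rewrite mulrC divfK.
  apply: (@lt_proj_dist _ _ _ nN _ _ _ (phi t b x) (phi s b' (a *: unit_pick dot q)) 1) => //.
  - exact: (proj_flow_mem t b (unit_pick_mem dot p)).
  - by apply: (proj_flow_mem s b'); rewrite memvZ // unit_pick_mem.
  - by rewrite scale1r (nrmC nN).
- move=> [b p]; have h := proj_flow_mem 0 b (memv_pick (val p)).
  rewrite flow_phi0 in h.
  rewrite [LHS]surjective_pairing; congr pair; first exact: flow_theta0.
  by rewrite -(projE (vpick_neq0 p) h); apply: projE; exact: memv_pick.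
- move=> t s [b p]; rewrite [LHS]surjective_pairing [RHS]surjective_pairing.
  congr pair; first exact: flow_thetaD.
  have h := proj_flow_mem (t + s) b (memv_pick (val p)).
  have y0 := linear_flow_neq0 (t + s) b linf (vpick_neq0 p).
  rewrite -(projE y0 h); apply: projE; rewrite flow_phiD.
  by have := proj_flow_mem t (theta s b) (proj_flow_mem s b (memv_pick (val p))).
Qed.

Let pdd : is_dist Pdist. Proof. by apply: is_dist_max => //; exact: is_dist_proj. Qed.
Let pcB : seq_compact Pdist.
Proof. by apply: seq_compact_max => //; exact: seq_compact_proj. Qed.

Lemma pnear_lift e b p b' q x y : x \in val p -> x != 0 -> y \in val q -> y != 0 ->
  Pdist (b, p) (b', q) < e -> pnear dB N e (b, x) (b', y).
Proof.
move=> xp x0 yq y0; rewrite /max_dist gt_max /= => /andP[h1 h2]; split=> //=.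
exact: (proj_dist_lt nN xp x0 yq y0 h2).
Qed.

Lemma lift_pnear e b p b' q x y : x \in val p -> x != 0 -> y \in val q ->
  pnear dB N e (b, x) (b', y) -> Pdist (b, p) (b', q) < 2 * e.
Proof.
move=> xp x0 yq [h1 /= y0 [a _ h2]]; rewrite /= in h1.
rewrite /max_dist gt_max /= (lt_proj_dist nN xp x0 yq h2) andbT.
by have := is_dist_ge0 b b' dd; lra.
Qed.

(** Uniform continuity comes from compactness of the projective bundle and is then read on vectors;
    the vector bundle itself is not compact in general. *)
Let unif_skew t : near_unif dB N (skew_map (theta t) (phi t)).
Proof.
move=> e e0; have [eta eta0 h] := flow_unif pdd pcB pflow_is_flow t e0.
exists (eta / 2); first by rewrite divr_gt0.
move=> [b x] [b' y] nxy; have x0 := near_neq0l nN nxy; have [_ y0 _] := nxy.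
rewrite /= in x0 y0.
have := lift_pnear (mem_proj x0) x0 (mem_proj y0) nxy.
rewrite mulrC divfK // => /(h t); rewrite subrr normr0 => /(_ eta0).
rewrite [Pflow t (b, _)]surjective_pairing [Pflow t (b', _)]surjective_pairing.
apply: pnear_lift.
- exact: proj_flow_mem (mem_proj x0).
- exact: linear_flow_neq0 linf x0.
- exact: proj_flow_mem (mem_proj y0).
- exact: linear_flow_neq0 linf y0.
Qed.

Lemma flow_cocycle : cocycle dB N (theta 1) (phi 1) (theta (-1)) (phi (-1)).
Proof.
have skewK t s : t + s = 0 ->
    cancel (skew_map (theta s) (phi s)) (skew_map (theta t) (phi t)).
  move=> ts [b x]; rewrite /skew_map /= -flow_thetaD -flow_phiD ts.
  by rewrite flow_theta0 flow_phi0.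
split; [exact: dd|exact: nN|exact: lin|exact: lin|apply: skewK|apply: skewK
  |exact: unif_skew|exact: unif_skew].
- by rewrite addNr.
- by rewrite addrN.
Qed.

Lemma flow_base_trans b b' e : 0 < e ->
  exists n, dchain (fun b c => dB (theta 1 b) c < e) n b b'.
Proof.
move=> e0; have [h _] := chain_transitiveP dd cB base_flow setT.
by have [n _ hn] := h base_trans b b' I I e e0; exists n.
Qed.

(** The length is positive because a chain of length 0 determines its endpoint as a vector, not only
    as a line. *)
Lemma dchain_scale_r e n (q : B * V) b (a : R) x : a != 0 ->
  dchain (cstep dB N F e) n.+1 q (b, x) -> dchain (cstep dB N F e) n.+1 q (b, a *: x).
Proof.
move=> a0 hn; have [r hr s] := dchainSE hn.
by apply: (dchainS hr); exact: near_scale.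
Qed.

Lemma dchain_scale_l e n b (a : R) x (q : B * V) : a != 0 ->
  dchain (cstep dB N F e) n.+1 (b, x) q -> dchain (cstep dB N F e) n.+1 (b, a *: x) q.
Proof.
move=> a0; rewrite -add1n => hn; have [r h1 hr] := dchain_split hn.
apply: dchain_cat hr; apply: dchain1.
have [r' h2 [/= s1 s2 [c c0 s3]]] := dchainSE h1.
rewrite -(dchain0E h2) /= in s1 s3.
split=> //=; exists (c * a); first by rewrite mulf_neq0.
by rewrite flow_linZ mulrC -scalerA -scalerBr !(nrmZ nN) mulrCA ltr_pM2l // normr_gt0.
Qed.

Lemma conn_scale_r (q : B * V) b (a : R) x :
  a != 0 -> pconn q (b, x) -> pconn q (b, a *: x).
Proof.
move=> a0 h e e0; have [[//|n] _ hn] := h e e0.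
by exists n.+1 => //; exact: dchain_scale_r.
Qed.

Lemma conn_scale_l (q : B * V) b (a : R) x :
  a != 0 -> pconn (b, x) q -> pconn (b, a *: x) q.
Proof.
move=> a0 h e e0; have [[//|n] _ hn] := h e e0.
by exists n.+1 => //; exact: dchain_scale_l.
Qed.

Let lift (q : B * proj_space V) : B * V := (q.1, vpick (val q.2)).

Lemma conn_lift (q : B * V) b p x : x \in val p -> x != 0 ->
  (pconn q (b, x) <-> pconn q (lift (b, p))) /\
  (pconn (b, x) q <-> pconn (lift (b, p)) q).
Proof.
move=> xp x0; have /vlineP[c cE] : x \in <[vpick (val p)]>%VS.
  by rewrite -(val_vline (memv_pick _) (vpick_neq0 p)).
have c0 : c != 0 by apply: contraNneq x0 => c0; rewrite cE c0 scale0r.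
have eE : vpick (val p) = c^-1 *: x by rewrite cE scalerA mulVf // scale1r.
have ci0 : c^-1 != 0 by rewrite invr_neq0.
split; split.
- by move=> /(conn_scale_r ci0); rewrite -eE.
- by move=> /(conn_scale_r c0); rewrite -cE.
- by move=> /(conn_scale_l ci0); rewrite -eE.
- by move=> /(conn_scale_l c0); rewrite -cE.
Qed.

Lemma dchain_lift e n (p q : B * proj_space V) :
  dchain (step Pdist Pflow e) n p q -> dchain (cstep dB N F e) n (lift p) (lift q).
Proof.
move=> hn; apply: (dchain_map _ hn) => -[c r] [c' r'] s.
rewrite /cstep /skew_map /lift /=.
move: s; rewrite /step [Pflow _ _]surjective_pairing; apply: pnear_lift.
- exact: (proj_flow_mem 1 c (memv_pick (val r))).
- exact: linear_flow_neq0 linf (vpick_neq0 r).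
- exact: memv_pick.
- exact: vpick_neq0.
Qed.

(** The control of all large lengths is retained, so that chains inside a bundle can run in parallel
    with chains of another base. *)
Lemma bundle_mixing M b x (x0 : x != 0) b' x' (x'0 : x' != 0) e :
  chain_transitive Pdist Pflow M -> M (b, proj x0) -> M (b', proj x'0) -> 0 < e ->
  exists K, forall n, (K <= n)%N -> dchain (cstep dB N F e) n (b, x) (b', x').
Proof.
move=> trM Mx Mx' e0.
have [K hK] := flow_mixing pdd pcB pflow_is_flow trM Mx Mx' e0.
have repr y (y0 : y != 0) : exists2 a : R, a != 0 & y = a *: vpick (val (proj y0)).
  have /vlineP[a aE] : y \in <[vpick (val (proj y0))]>%VS.
    by rewrite -(val_vline (memv_pick _) (vpick_neq0 _)); exact: mem_proj.
  by exists a => //; apply: (contraNneq _ y0) => a0; rewrite aE a0 scale0r.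
have [a a0 ->] := repr x x0; have [a' a'0 ->] := repr x' x'0.
exists K.+1 => -[//|n] Kn; apply: dchain_scale_r => //; apply: dchain_scale_l => //.
exact: dchain_lift (hK _ (ltnW Kn)).
Qed.

Lemma chain_transitive_lift (M : set (B * proj_space V)) :
  chain_transitive Pdist Pflow M <->
  forall p q : B * proj_space V, M p -> M q -> pconn (lift p) (lift q).
Proof.
have [h1 h2] := chain_transitiveP pdd pcB pflow_is_flow M.
split=> [/h1 h p q Mp Mq e e0|h]; last first.
  apply: h2 => -[b p] [b' q] Mp Mq e e0; have e20 : 0 < e / 2 by rewrite divr_gt0.
  have [n n0 hn] := h _ _ Mp Mq _ e20; exists n => //.
  (* The default [p] would only be taken at a zero vector, and both ends of a [cstep] are
     nonzero. *)
  pose f (z : B * V) : B * proj_space V := (z.1, insubd p <[z.2]>%VS).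
  have fE c (r : proj_space V) : f (lift (c, r)) = (c, r).
    congr pair; apply: val_inj; rewrite val_insubd /= dim_vline vpick_neq0 /=.
    by rewrite -(val_vline (memv_pick _) (vpick_neq0 r)).
  rewrite -(fE b p) -(fE b' q); apply: (dchain_map _ hn) => -[c z] [c' z'] s.
  have [_ z'0 _] := s; have := near_neq0l nN s.
  rewrite (skew_eq0 flow_cocycle) /= => z0.
  have fm y : y != 0 -> y \in val (insubd p <[y]>%VS : proj_space V).
    by move=> y0; rewrite val_insubd dim_vline y0 memv_line.
  rewrite /step /f /= -[e](divfK (_ : 2 != 0)) // mulrC.
  rewrite [Pflow _ _]surjective_pairing; apply: lift_pnear (s) => /=.
  - exact: (proj_flow_mem 1 c (fm z z0)).
  - exact: linear_flow_neq0 linf z0.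
  - exact: fm.
have [n n0 hn] := h p q Mp Mq e e0; by exists n => //; exact: dchain_lift hn.
Qed.

End LinearFlow.

(** * Selgrade bundles as chain equivalence classes of vectors *)

Section SelgradeBundles.
Context {R : realType} {B : Type} {V : vectType R}.
Variables (dB : B -> B -> R) (dot : V -> V -> R).
Variables (theta : R -> B -> B) (phi : R -> B -> V -> V).
Local Notation N := (dot_norm dot).
Hypotheses (dd : is_dist dB) (cB : seq_compact dB) (nN : is_norm N).
Hypothesis linf : is_linear_flow dB dot theta phi.
Local Notation Pdist := (max_dist dB (proj_dist dot)).
Local Notation Pflow := (proj_flow theta phi).
Local Notation pconn := (conn dB N (skew_map (theta 1) (phi 1))).
Local Notation selgrade := (selgrade_bundle dB dot theta phi).
Implicit Types (b : B) (x y : V) (W : set (B * V)).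

Let coc := flow_cocycle dd cB nN linf.

Lemma chain_transitive_conn (M : set (B * proj_space V)) :
  chain_transitive Pdist Pflow M <->
  forall b x (x0 : x != 0) b' x' (x'0 : x' != 0),
    M (b, proj x0) -> M (b', proj x'0) -> pconn (b, x) (b', x').
Proof.
rewrite (chain_transitive_lift dd cB nN linf); split=> [h b x x0 b' x' x'0 Mx Mx'|h].
  have [h1 _] := conn_lift nN linf (b, x) b' (mem_proj x'0) x'0.
  apply/h1; have [_ h2] := conn_lift nN linf (b', vpick (val (proj x'0))) b (mem_proj x0) x0.
  by apply/h2; exact: h Mx Mx'.
move=> [b p] [b' q] Mp Mq; apply: (h _ _ (vpick_neq0 p) _ _ (vpick_neq0 q)).
- by rewrite (projE _ (memv_pick _)).
- by rewrite (projE _ (memv_pick _)).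
Qed.

Lemma bundle0 W b : selgrade W -> W (b, 0).
Proof. by move=> [M _ ->]; rewrite /bundle_of /=; move=> x0; have := x0; rewrite eqxx. Qed.

Lemma bundle_conn W b x b' x' : selgrade W -> x != 0 -> x' != 0 ->
  W (b, x) -> W (b', x') -> pconn (b, x) (b', x').
Proof.
move=> [M [/chain_transitive_conn h _] ->] x0 x'0 Wx Wx'.
exact: (h _ _ x0 _ _ x'0 (Wx x0) (Wx' x'0)).
Qed.

(** By maximality: adjoining a chain equivalent point to the component keeps it chain transitive. *)
Lemma bundle_absorb W b x b' x' : selgrade W -> x != 0 -> W (b, x) ->
  pconn (b, x) (b', x') -> pconn (b', x') (b, x) -> W (b', x').
Proof.
move=> [M [tr max] ->] x0 Wx xx' x'x x'0.
pose Z := M `|` [set (b', proj x'0)].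
suff /max ZM : chain_transitive Pdist Pflow Z.
  by rewrite -(ZM (@subsetUl _ _ _)); right.
move/chain_transitive_conn: tr => tr; apply/chain_transitive_conn.
have to_x c z (z0 : z != 0) : Z (c, proj z0) -> pconn (c, z) (b, x) /\ pconn (b, x) (c, z).
  move=> [Mz|/pair_equal_spec[-> zx']].
    by split; [exact: (tr _ _ z0 _ _ x0 Mz (Wx x0))|exact: (tr _ _ x0 _ _ z0 (Wx x0) Mz)].
  have zm : z \in val (proj x'0) by rewrite -zx'; exact: mem_proj.
  have /vlineP[a zE] : z \in <[x']>%VS := zm.
  have a0 : a != 0 by apply: (contraNneq _ z0) => a0; rewrite zE a0 scale0r.
  rewrite zE; split; first exact: (conn_scale_l nN linf a0).
  exact: conn_scale_r.
move=> c z z0 c' z' z'0 /to_x[h1 _] /to_x[_ h2].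
exact: conn_trans h1 h2.
Qed.

Lemma bundle_ex b x : pconn (b, x) (b, x) -> exists2 W, selgrade W & W (b, x).
Proof.
move=> xx.
pose M := [set q : B * proj_space V | pconn (b, x) (q.1, vpick (val q.2)) /\
                                      pconn (q.1, vpick (val q.2)) (b, x)].
have ME c z (z0 : z != 0) : M (c, proj z0) <->
    pconn (b, x) (c, z) /\ pconn (c, z) (b, x).
  have [h1 h2] := conn_lift nN linf (b, x) c (mem_proj z0) z0.
  by split=> -[/h1 ? /h2 ?]; split.
exists (bundle_of M); last by move=> x0; apply/ME.
exists M => //; split=> [|Z trZ MZ].
  apply/chain_transitive_conn => c z z0 c' z' z'0 /ME[_ h1] /ME[h2 _].
  exact: conn_trans h1 h2.
apply/seteqP; split=> // -[c p] Zp; move/chain_transitive_conn: trZ => trZ.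
have x0 : x != 0 by exact: (conn_neq0r xx).
have Zx : Z (b, proj x0) by apply: MZ; apply/ME.
have Zp' : Z (c, proj (vpick_neq0 p)) by rewrite (projE _ (memv_pick _)).
by split; [exact: (trZ _ _ x0 _ _ (vpick_neq0 p))|exact: (trZ _ _ (vpick_neq0 p) _ _ x0)].
Qed.

Lemma bundle_uniq W W' b x : selgrade W -> selgrade W' -> x != 0 ->
  W (b, x) -> W' (b, x) -> W = W'.
Proof.
move=> sW sW' x0 Wx W'x.
suff sub W1 W2 : selgrade W1 -> selgrade W2 -> W1 (b, x) -> W2 (b, x) -> W1 `<=` W2.
  by apply/seteqP; split; exact: sub.
move=> s1 s2 W1x W2x [c z] W1z; have [->|z0] := eqVneq z 0; first exact: bundle0.
by apply: (bundle_absorb s2 x0 W2x); exact: (bundle_conn s1).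
Qed.

Lemma bundle_lin W b a x y : selgrade W -> W (b, x) -> W (b, y) -> W (b, a *: x + y).
Proof.
move=> sW Wx Wy; have [->|w0] := eqVneq (a *: x + y) 0; first exact: bundle0.
have [p [c [c0 pE Wp]]] : exists p c, [/\ c != 0, p = (b, c) & W (b, c)].
  have [x0|x0] := eqVneq x 0; last by exists (b, x), x.
  by exists (b, y), y; split=> //; move: w0; rewrite x0 scaler0 add0r.
have cl z : W (b, z) -> z != 0 -> pconn p (b, z) /\ pconn (b, z) p.
  by move=> Wz z0; rewrite pE; split; exact: (bundle_conn sW).
have [h1 h2] := class_lin coc (cl _ Wx) (cl _ Wy) w0.
by rewrite pE in h1 h2; exact: (bundle_absorb sW c0 Wp).
Qed.

Lemma bundleD W b x y : selgrade W -> W (b, x) -> W (b, y) -> W (b, x + y).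
Proof. by move=> sW Wx Wy; rewrite -[x]scale1r; exact: bundle_lin. Qed.

Lemma bundleZ W b a x : selgrade W -> W (b, x) -> W (b, a *: x).
Proof. by move=> sW Wx; rewrite -[_ *: _]addr0; apply: bundle_lin => //; exact: bundle0. Qed.

Section Family.
Hypothesis base_trans : chain_transitive dB theta setT.
Variables (ell : nat) (F : 'I_ell -> set (B * V)).
Hypothesis F_inj : injective F.
Hypothesis F_all : range F = [set W | selgrade W].

Lemma family_selgrade i : selgrade (F i).
Proof.
have : range F (F i) by exists i.
by rewrite F_all.
Qed.

Lemma family_span b x : exists y : 'I_ell -> V,
  (forall i, F i (b, y i)) /\ x = \sum_i y i.
Proof.
have [s [hs ->]] := recurrent_span_full coc (flow_base_trans dd cB nN linf base_trans) b x.
elim: s hs => [_|z s IH hs].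
  exists (fun=> 0); split=> [i|]; first by apply: bundle0; exact: family_selgrade.
  by rewrite big_nil big1.
have [|y [Fy sy]] := IH; first by move=> w ws; apply: hs; rewrite inE ws orbT.
have [W sW Wz] := bundle_ex (hs z (mem_head z s)).
have [i _ iW] : range F W by rewrite F_all.
exists (fun j => if j == i then z + y j else y j); split=> [j|].
  case: eqP => [->|//]; apply: bundleD => //; first exact: family_selgrade.
  by rewrite iW.
rewrite big_cons sy (bigD1 i) //= [RHS](bigD1 i) //= eqxx addrA; congr (_ + _).
by apply: eq_bigr => j /negPf ->.
Qed.

Lemma family_independent b (y : 'I_ell -> V) (J : {set 'I_ell}) :
  (forall i, i \in J -> F i (b, y i)) -> \sum_(i in J) y i = 0 ->
  forall i, i \in J -> y i = 0.
Proof.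
move=> Fy; apply: (class_independent coc (flow_base_trans dd cB nN linf base_trans) (b := b)).
- by move=> i /Fy Fi yi0; apply: (bundle_conn (family_selgrade i)).
- move=> i j /Fy Fi /Fy Fj yi0 yj0 ij ji; apply: F_inj.
  apply: (bundle_uniq (family_selgrade i) (family_selgrade j) yj0 _ Fj).
  exact: (bundle_absorb (family_selgrade i) yi0 Fi ij ji).
Qed.

End Family.
End SelgradeBundles.

(** * Split affine flows and their lifts *)

Section NegligibleIntegral.
Import HBNNSimple.
Context d (T : measurableType d) (R : realType) (mu : {measure set T -> \bar R}).
Local Open Scope ereal_scope.

(* No measurability is assumed: only simple functions below f are involved. *)
Lemma ge0_integral_negligible (f : T -> \bar R) : (forall x, 0 <= f x) ->
  {ae mu, forall x, f x = 0} -> \int[mu]_x f x = 0.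
Proof.
move=> f0 [A [mA A0 fA]].
apply/eqP; rewrite eq_le integral_ge0 // andbT ge0_integralTE //.
apply: ge_ereal_sup => _ [h /= hf <-].
rewrite sintegralET fsbig1 // => r _.
have [->|r0] := eqVneq r 0%R; first by rewrite mul0e.
suff -> : mu (h @^-1` [set r]) = 0 by rewrite mule0.
apply: (subset_measure0 _ mA _ A0); first exact: measurable_funPTI.
move=> x /= hx; apply: fA => /= fx; have := hf x; rewrite fx hx lee_fin => r_le.
have r_ge : (0 <= r)%R by rewrite -hx; exact: fun_ge0.
by move: r0; rewrite eq_le r_le r_ge.
Qed.

Lemma integral_negligible (D : set T) (f : T -> \bar R) :
  {ae mu, forall x, f x = 0} -> \int[mu]_(x in D) f x = 0.
Proof.
move=> [A [mA A0 fA]].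
rewrite integralE (integral_mkcond D f^\+) (integral_mkcond D f^\-).
rewrite !ge0_integral_negligible ?sube0 //.
- by move=> x; rewrite patchE; case: ifP.
- exists A; split=> // x /= h; apply: fA => /= fx; apply: h.
  by rewrite patchE funenegE fx oppe0 maxxx if_same.
- by move=> x; rewrite patchE; case: ifP.
- exists A; split=> // x /= h; apply: fA => /= fx; apply: h.
  by rewrite patchE funeposE fx maxxx if_same.
Qed.

End NegligibleIntegral.

Lemma hintegral_negligible (R : realType) (H : vectType R) (g : R -> H) t :
  {ae @lebesgue_measure R, forall s, g s = 0} -> hintegral g t = 0.
Proof.
move=> g0; rewrite /hintegral big1 // => i _.
have z (D : set R) : \int[@lebesgue_measure R]_(s in D) hcoord i (g s) = 0.
  rewrite /Rintegral integral_negligible //.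
  have [A [mA A0 gA]] := g0; exists A; split=> // s /= hs; apply: gA => /= gs.
  by apply: hs; rewrite gs /hcoord linear0.
by rewrite /oriented_integral !z oppr0 if_same scale0r.
Qed.

(** * Extension of a linear flow by an additive cocycle *)

Section HalfLineExtension.
Context {R : realType} {H : vectType R}.
Variable dot : H -> H -> R.
Hypothesis inn : is_inner dot.
Local Notation H1 := (H * R^o)%type.
Local Notation N := (dot_norm dot).
Local Notation N1 := (dot_norm (dot1 dot)).

Lemma dot1_inner : is_inner (dot1 dot : H1 -> H1 -> R).
Proof.
have [lin sym pos] := inn.
have pos0 x : 0 <= dot x x.
  have [->|/pos/ltW//] := eqVneq x 0.
  by have := lin (-1) 0 0 0; rewrite scaler0 addr0 mulN1r addNr => ->.
split.
- move=> a x y z; rewrite /dot1 /= lin /GRing.scale /=; ring.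
- by move=> x y; rewrite /dot1 sym mulrC.
- move=> [x r]; rewrite -pair_eqE /= /pair_eq negb_and /dot1 /= => /orP[x0|r0].
    by rewrite ltr_pwDl ?pos // -expr2 sqr_ge0.
  by rewrite ltr_wpDl // -expr2 lt_neqAle sqr_ge0 andbT eq_sym sqrf_eq0.
Qed.

Let nN : is_norm N. Proof. exact: inner_norm. Qed.
Let nN1 : is_norm N1. Proof. exact: inner_norm dot1_inner. Qed.

Let dot_ge0 x : 0 <= dot x x.
Proof.
have [lin _ pos] := inn; have [->|/pos/ltW//] := eqVneq x 0.
by have := lin (-1) 0 0 0; rewrite scaler0 addr0 mulN1r addNr => ->.
Qed.

Lemma norm1_fst (u : H1) : N u.1 <= N1 u.
Proof. by rewrite ler_wsqrtr // /dot1 lerDl -expr2 sqr_ge0. Qed.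

Lemma norm1_snd (u : H1) : `|u.2 : R| <= N1 u.
Proof.
rewrite -sqrtr_sqr ler_wsqrtr // /dot1 expr2 lerDr; exact: dot_ge0.
Qed.

Lemma norm1_infty x : N1 (x, 0) = N x.
Proof. by rewrite /dot_norm /dot1 /= mulr0 addr0. Qed.

Lemma norm1_pole (r : R) : N1 (0, r) = `|r|.
Proof.
rewrite /dot_norm /dot1 /= -sqrtr_sqr expr2.
have [lin _ _] := inn; have := lin (-1) 0 0 0; rewrite scaler0 addr0 mulN1r addNr.
by move=> ->; rewrite add0r.
Qed.

Lemma norm1_le (u : H1) : N1 u <= N u.1 + `|u.2 : R|.
Proof.
have E : u = (u.1, 0) + (0, u.2).
  by case: u => x r; congr pair; rewrite /= ?addr0 ?add0r.
by have := nrmD nN1 (u.1, 0) (0, u.2); rewrite -E norm1_infty norm1_pole.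
Qed.

Section Extension.
Context {B : Type} (dB : B -> B -> R) (theta : R -> B -> B) (phi : R -> B -> H -> H).
Context (F : R -> B -> H).
Hypothesis linf : is_linear_flow dB dot theta phi.
Hypothesis jcF : forall t b (e : R), 0 < e -> exists2 delta : R, 0 < delta &
  forall s b', `|t - s| < delta -> dB b b' < delta -> N (F t b - F s b') < e.
Hypothesis F0 : forall b, F 0 b = 0.
Hypothesis FD : forall t s b, F (t + s) b = phi t (theta s b) (F s b) + F t (theta s b).

(** One construction for both flows on the lifted space: [F] is the forcing for the lift, and zero
    for the flow denoted by [cocycle1]. *)
Lemma extension_linear_flow : is_linear_flow dB (dot1 dot) theta
  (fun t b (u : H1) => (phi t b u.1 + (u.2 : R) *: F t b, u.2) : H1).
Proof.
have [lin [jc idf addf]] := linf; split.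
  move=> t b a [x r] [y q]; rewrite /= lin; congr pair.
  rewrite -[_ *: (_, _)]/(_, _) /= scalerDr [a *: r : R^o]/(a * r) scalerDl -scalerA.
  by rewrite addrACA.
split.
- move=> t [b [x r]] e e0; have e40 : 0 < e / 4 by rewrite divr_gt0.
  (* The error is split into four parts of size e/4: the linear flow, the variation of [F] times r,
     the variation of r times the nearby value of [F], and the last coordinate. Here c dominates
     [|r|], and k dominates the nearby value because [F] varies by less than 1. *)
  pose c := `|r : R| + 1; have c0 : 0 < c by rewrite /c ltr_wpDl.
  pose k := N (F t b) + 1; have k0 : 0 < k by rewrite /k ltr_wpDl // nrm_ge0.
  have eF0 : 0 < Num.min 1 (e / 4 / c) by rewrite lt_min ltr01 divr_gt0.
  have [d1 d10 h1] := jc t (b, x) _ e40.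
  have [d2 d20 h2] := jcF t b eF0.
  pose d3 := Num.min (e / 4) (e / 4 / k).
  have d30 : 0 < d3 by rewrite lt_min e40 divr_gt0.
  exists (Num.min d1 (Num.min d2 d3)); first by rewrite lt_min d10 lt_min d20 d30.
  move=> s [b' [y q]]; rewrite !lt_min => /and3P[ts1 ts2 _].
  rewrite {1 2 3 4}/max_dist !gt_max /=.
  move=> /and4P[/andP[bb1 xy1] /andP[bb2 _] /andP[_ xy3] /andP[_ xy4]].
  have xy : N (x - y) < d1 by exact: le_lt_trans (norm1_fst _) xy1.
  have rq3 : `|(r : R) - q| < e / 4 by exact: le_lt_trans (norm1_snd _) xy3.
  have rq4 : `|(r : R) - q| < e / 4 / k by exact: le_lt_trans (norm1_snd _) xy4.
  have := h1 s (b', y) ts1; rewrite /max_dist /= gt_max bb1 /= => /(_ xy).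
  rewrite gt_max => /andP[tb pxy].
  have := h2 s b' ts2 bb2; rewrite lt_min => /andP[F1 F2].
  apply/andP; split; first by apply: (lt_trans tb); lra.
  apply: le_lt_trans (norm1_le _) _ => /=.
  move: F1 F2; move: (F s b') => a' F1 F2.
  have E : phi t b x + (r : R) *: F t b - (phi s b' y + (q : R) *: a') =
      (phi t b x - phi s b' y) + ((r : R) *: (F t b - a') + ((r : R) - q) *: a').
    rewrite opprD addrACA; congr (_ + _).
    by rewrite scalerBr scalerBl addrA subrK.
  rewrite E; have g1 := nrmD nN (phi t b x - phi s b' y)
    ((r : R) *: (F t b - a') + ((r : R) - q) *: a').
  have g2 := nrmD nN ((r : R) *: (F t b - a')) (((r : R) - q) *: a').
  rewrite !(nrmZ nN) in g2.
  have g3 : `|r : R| * N (F t b - a') <= e / 4.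
    have : c * N (F t b - a') <= e / 4 by rewrite mulrC -ler_pdivlMr // ltW.
    apply: le_trans; rewrite ler_wpM2r ?nrm_ge0 //.
    by rewrite /c; lra.
  have g4 : N a' <= k.
    by have := nrm_dist nN a' (F t b); rewrite (nrmC nN) /k; lra.
  have g5 : `|(r : R) - q| * N a' <= e / 4.
    apply: (@le_trans _ _ (`|(r : R) - q| * k)); first by rewrite ler_wpM2l.
    by rewrite -ler_pdivlMr // ltW.
  move: pxy; rewrite /dot_dist /=; lra.
- move=> [b [x r]]; have := idf (b, x); rewrite /skew_product /= => -[-> ->].
  by rewrite F0 scaler0 addr0.
- move=> t s [b [x r]]; have := addf t s (b, x); rewrite /skew_product /= => -[-> ->].
  have lin1 y z : phi t (theta s b) (y + z) = phi t (theta s b) y + phi t (theta s b) z.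
    by rewrite -[y]scale1r lin !scale1r.
  by rewrite lin1 (flow_linZ linf) FD scalerDr addrA.
Qed.

End Extension.
End HalfLineExtension.

Section SplitAffineFlow.
Context {R : realType} {B1 B2 : metricType R} {H : vectType R}.
Variables (dot : {dot H for idfun}).
Variables (theta1 : R -> B1 -> B1) (theta2 : R -> B2 -> B2) (e1 : B1).
Variables (phi : R -> B2 -> H -> H) (f : B1 -> R -> H).
Hypotheses (compact_B1 : compact [set: B1]) (compact_B2 : compact [set: B2]).
Hypotheses (flow1 : is_flow mdist theta1) (flow2 : is_flow mdist theta2).
Hypotheses (trans1 : chain_transitive mdist theta1 setT)
  (trans2 : chain_transitive mdist theta2 setT).
Hypothesis equilibrium : forall t, theta1 t e1 = e1.
Hypothesis linear_Phi : is_linear_flow mdist dot theta2 phi.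
Hypothesis forcing_e1 : {ae @lebesgue_measure R, forall t, f e1 t = 0}.
Hypothesis flow_Psi : is_flow (max_dist (max_dist mdist mdist) (dot_dist dot))
  (split_affine_flow theta1 theta2 phi f).

Local Notation H1 := (H * R^o)%type.
Local Notation N := (dot_norm dot).
Local Notation N1 := (dot_norm (dot1 dot)).
Local Notation dB2 := (@mdist R B2).
Local Notation dB := (max_dist (@mdist R B1) (@mdist R B2)).
Local Notation forc := (forcing theta2 phi f).
Local Notation theta := (prod_flow theta1 theta2).
Local Notation lift := (lift_cocycle theta2 phi f).
Local Notation F0 := (skew_map (theta2 1) (phi 1)).
Local Notation F1 := (skew_map (theta2 1) (cocycle1 phi 1)).
Local Notation FP := (skew_map (theta 1) (lift 1)).
Local Notation conn0 := (conn dB2 N F0).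
Local Notation conn1 := (conn dB2 N1 F1).
Local Notation connP := (conn dB N1 FP).

Let inn : is_inner dot. Proof. exact: dot_inner. Qed.
Let nN : is_norm N. Proof. exact: inner_norm. Qed.
Let nN1 : is_norm N1. Proof. exact: inner_norm (dot1_inner inn). Qed.
Let dd2 : is_dist dB2. Proof. exact: is_dist_mdist. Qed.
Let dd : is_dist dB. Proof. by apply: is_dist_max; exact: is_dist_mdist. Qed.
Let c2 : seq_compact dB2. Proof. exact: seq_compact_mdist. Qed.
Let cB : seq_compact dB. Proof. by apply: seq_compact_max; exact: seq_compact_mdist. Qed.

Lemma linear_prod_flow : is_linear_flow dB dot theta (fun t b => phi t b.2).
Proof.
have [lin [jc idf addf]] := linear_Phi; have [jc1 id1 add1] := flow1.
split=> [t b|]; first exact: lin.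
split.
- move=> t [[b1 b2] x] e e0; have [d1 d10 h1] := jc1 t b1 e e0.
  have [d2 d20 h2] := jc t (b2, x) e e0.
  exists (Num.min d1 d2); first by rewrite lt_min d10.
  move=> s [[b1' b2'] y]; rewrite !lt_min => /andP[ts1 ts2].
  rewrite /max_dist !gt_max /= => /andP[/andP[/andP[b11 _] _] /andP[/andP[_ b22] xy]].
  rewrite h1 //=; have := h2 s (b2', y) ts2; rewrite /max_dist !gt_max /= b22 xy.
  by move=> /(_ isT) /andP[-> ->].
- move=> [[b1 b2] x]; rewrite /skew_product /prod_flow /= id1.
  by have := idf (b2, x); rewrite /skew_product /= => -[-> ->].
- move=> t s [[b1 b2] x]; rewrite /skew_product /prod_flow /= add1.
  by have := addf t s (b2, x); rewrite /skew_product /= => -[-> ->].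
Qed.

Let phi0 t b : phi t b 0 = 0. Proof. exact: (flow_lin0 linear_Phi). Qed.

(** The forcing is the orbit of the zero vector under the affine flow. Its continuity and cocycle
    identity are therefore inherited from [flow_Psi]; the integral is only evaluated over [e1],
    where it vanishes. *)
Lemma forcing_continuous t b (e : R) : 0 < e -> exists2 delta : R, 0 < delta &
  forall s b', `|t - s| < delta -> dB b b' < delta -> N (forc t b - forc s b') < e.
Proof.
move=> e0; have [jc _ _] := flow_Psi; have [delta d0 h] := jc t (b, 0) e e0.
exists delta => // s b' ts bb'; have := h s (b', 0) ts.
rewrite /max_dist gt_max /= in bb'; have /andP[b1 b2] := bb'.
rewrite /max_dist !gt_max /= b1 b2 /dot_dist subrr (nrm0 nN) d0 => /(_ isT).
by move=> /andP[_]; rewrite !phi0 !add0r.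
Qed.

Lemma forcing0 b : forc 0 b = 0.
Proof.
have [_ idf _] := flow_Psi; have := idf (b, 0).
by rewrite /split_affine_flow /= phi0 add0r => -[].
Qed.

Lemma forcingD t s b :
  forc (t + s) b = phi t (theta s b).2 (forc s b) + forc t (theta s b).
Proof.
have [_ _ addf] := flow_Psi; have := addf t s (b, 0).
by rewrite /split_affine_flow /= !phi0 !add0r => -[].
Qed.

Lemma linear_lift : is_linear_flow dB (dot1 dot) theta lift.
Proof.
exact: (extension_linear_flow inn linear_prod_flow forcing_continuous forcing0 forcingD).
Qed.

Lemma linear_Phi1 : is_linear_flow dB2 (dot1 dot) theta2 (cocycle1 phi).
Proof.
have -> : cocycle1 phi = (fun t b (u : H1) => (phi t b u.1 + (u.2 : R) *: 0, u.2) : H1).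
  by apply/funext => t; apply/funext => b; apply/funext => u; rewrite scaler0 addr0.
apply: (extension_linear_flow inn linear_Phi (F := fun _ _ => 0)) => //.
- by move=> t b e e0; exists 1 => // s b' _ _; rewrite subrr (nrm0 nN).
- by move=> t s b; rewrite phi0 addr0.
Qed.

Let coc1 := flow_cocycle dd2 c2 nN1 linear_Phi1.
Let cocP := flow_cocycle dd cB nN1 linear_lift.

Lemma chain_transitive_prod : chain_transitive dB theta setT.
Proof.
apply/(chain_transitiveP dd cB (base_flow nN linear_prod_flow)).
move=> [b1 b2] [b1' b2'] _ _ e e0.
have [n1 h1] := flow_mixing (is_dist_mdist B1) (seq_compact_mdist compact_B1) flow1 trans1
  (I : setT b1) (I : setT b1') e0.
have [n2 h2] := flow_mixing dd2 c2 flow2 trans2 (I : setT b2) (I : setT b2') e0.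
exists (maxn n1 n2).+1 => //.
have := dchain_prod (h1 _ (leqW (leq_maxl n1 n2))) (h2 _ (leqW (leq_maxr n1 n2))).
apply: dchain_sub => u v; rewrite /step /max_dist gt_max /= => -[-> ->] //.
Qed.

Let btP := flow_base_trans dd cB nN1 linear_lift chain_transitive_prod.

Lemma forcing_equilibrium b : forc 1 (e1, b) = 0.
Proof.
apply: hintegral_negligible; have [A [mA A0 fA]] := forcing_e1.
exists A; split=> // s /= hs; apply: fA => /= fs; apply: hs.
by rewrite fs phi0.
Qed.

Lemma forcing_bounded : exists2 C : R, 0 < C & forall b, N (forc 1 b) <= C.
Proof.
apply: contrapT => no.
have /choice[b hb] : forall n : nat, exists b, n.+1%:R < N (forc 1 b).
  move=> n; apply: contrapT => no'; apply: no; exists n.+1%:R; first by rewrite ltr0n.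
  by move=> b; rewrite leNgt; apply/negP => h; apply: no'; exists b.
have [k [c [kn kc]]] := cB b.
have [delta d0 h] := @forcing_continuous 1 c 1 ltr01.
have [K hK] := kc _ d0.
have c0 : 0 <= N (forc 1 c) + 1 by rewrite addr_ge0 // nrm_ge0.
have /andP[_ tc] := truncn_itv c0.
pose n := maxn K (Num.truncn (N (forc 1 c) + 1)).
have := h 1 (b (k n)); rewrite subrr normr0 => /(_ d0).
have [_ ds _] := dd; rewrite ds => /(_ (hK _ (leq_maxl _ _))) h1.
have h2 := hb (k n).
have h3 : (Num.truncn (N (forc 1 c) + 1)).+1%:R <= (k n).+1%:R :> R.
  by rewrite ler_nat ltnS (leq_trans _ (kn n)) // leq_maxr.
have := nrm_dist nN (forc 1 (b (k n))) (forc 1 c); rewrite (nrmC nN).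
by move: tc h1 h2 h3; lra.
Qed.

(** Both bases are arbitrary, so that chains at infinity can be placed over [B2] as well as over the
    product. *)
Lemma near_infty (B B' : Type) (d : B -> B -> R) (d' : B' -> B' -> R) e b b' c c' x y :
  pnear d N e (b, x) (b', y) -> d' c c' < e ->
  pnear d' N1 e (c, (x, 0) : H1) (c', (y, 0) : H1).
Proof.
move=> [_ /= y0 [a a0 h]] dc; split=> //=.
  by rewrite -pair_eqE /= /pair_eq /= eqxx andbT.
exists a => //; rewrite (norm1_infty dot).
have -> : a *: ((y, 0) : H1) - (x, 0) = (a *: y - x, 0).
  by congr pair; rewrite /= scaler0 subr0.
by rewrite (norm1_infty dot).
Qed.

Lemma conn_infty b b' x x' : conn0 (b, x) (b', x') ->
  conn1 (b, (x, 0)) (b', (x', 0)).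
Proof.
move=> h e e0; have [n n0 hn] := h e e0; exists n => //.
apply: (dchain_map (f := fun p : B2 * H => (p.1, (p.2, 0) : H1)) _ hn).
by move=> [c z] [c' z'] s; apply: (near_infty s); case: s.
Qed.

Lemma conn_equilibrium b b' (u v : H1) : conn1 (b, u) (b', v) ->
  connP (e1, b, u) (e1, b', v).
Proof.
move=> h e e0; have [n n0 hn] := h e e0; exists n => //.
apply: (dchain_map (f := fun p : B2 * H1 => (e1, p.1, p.2)) _ hn).
move=> [c z] [c' z'] [/= h1 h2 h3]; split=> //=.
  by rewrite /max_dist gt_max /= equilibrium mdistxx e0.
by rewrite /lift_cocycle forcing_equilibrium scaler0 addr0.
Qed.

Lemma conn_pole b b' : conn1 (b, (0, 1)) (b', (0, 1)).
Proof.
move=> e e0; have [h _] := chain_transitiveP dd2 c2 flow2 setT.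
have [n n0 hn] := h trans2 b b' I I e e0; exists n => //.
apply: (dchain_map (f := fun c : B2 => (c, (0, 1) : H1)) _ hn) => c c' s.
split=> //=; first by rewrite pair1_neq0.
exists 1; first exact: oner_neq0.
rewrite scale1r /cocycle1 /= phi0 subrr (nrm0 nN1) mulr_gt0 // nrm_gt0 //.
exact: pair1_neq0.
Qed.

(* Conjugating the lift by (x, r) |-> (delta x, r) multiplies the forcing by delta, so
   that its chains shadow chains of the unforced flow. *)
Lemma rescaled_chain (e : R) : 0 < e -> exists delta e' : R, [/\ 0 < delta, 0 < e' &
  forall n (b b' : B1 * B2) (u v : H1), dchain (cstep dB N1 FP e') n (b, u) (b', v) ->
    dchain (cstep dB2 N1 F1 e) n (b.2, (delta *: u.1, u.2) : H1)
      (b'.2, (delta *: v.1, v.2) : H1)].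
Proof.
move=> e0; have [C C0 hC] := forcing_bounded.
pose e2 := Num.min 1 (e / 3).
have e20 : 0 < e2 by rewrite lt_min ltr01 divr_gt0.
have e21 : e2 <= 1 by rewrite ge_min lexx.
have e23 : 3 * e2 <= e.
  have : e2 <= e / 3 by rewrite ge_min lexx orbT.
  by lra.
(* Chosen so that the rescaled forcing, at most [delta * C] times the last coordinate, is a relative
   error of at most e2/2; the cocycle leaves that coordinate unchanged. *)
pose delta := Num.min 1 (e2 / 2 / C).
have d0 : 0 < delta by rewrite lt_min ltr01 !divr_gt0.
have d1 : delta <= 1 by rewrite ge_min lexx.
have dC : delta * C <= e2 / 2 by rewrite -ler_pdivlMr // ge_min lexx orbT.
have dn0 : delta != 0 by rewrite gt_eqF.
pose D (u : H1) : H1 := (delta *: u.1, u.2).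
have D0 u : u != 0 -> D u != 0.
  rewrite -!pair_eqE /= /pair_eq /= !negb_and scaler_eq0 (negPf dn0) //.
(* Used with factors (delta, 1) to see that [D] does not increase norms, and with (1, delta) on
   [D u], which becomes [delta *: u], for the lower bound. *)
have shrink (a c : R) (u : H1) : 0 <= a <= 1 -> 0 <= c <= 1 ->
    N1 (a *: u.1, c * u.2 : R^o) <= N1 u.
  move=> a01 c01; rewrite /dot_norm ler_wsqrtr // /dot1 /=.
  have [lin sym pos] := inn.
  have dot0 y : dot 0 y = 0.
    by have := lin (-1) 0 0 y; rewrite scaler0 addr0 mulN1r addNr.
  have linZ k x y : dot (k *: x) y = k * dot x y.
    by rewrite -[k *: x]addr0 lin dot0 addr0.
  rewrite linZ sym linZ mulrA; apply: lerD.
    rewrite ler_piMl //; last by case/andP: a01 => *; rewrite mulr_ile1.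
    by have [->|/pos/ltW//] := eqVneq u.1 0; rewrite dot0.
  rewrite mulrACA ler_piMl // -?expr2 ?sqr_ge0 //.
  by case/andP: c01 => *; rewrite expr2 mulr_ile1.
have D_le u : N1 (D u) <= N1 u.
  by have := shrink delta 1 u; rewrite mul1r (ltW d0) d1 ler01 lexx; exact.
have D_ge u : delta * N1 u <= N1 (D u).
  have := shrink 1 delta (D u); rewrite (ltW d0) d1 ler01 lexx => /(_ isT isT).
  apply: le_trans; rewrite -{1}(gtr0_norm d0) -(nrmZ nN1) /D /= scale1r.
  by case: u.
(* Norms are multiplied by a factor between delta and 1 under [D], so relative errors can grow by
   1/delta; the tolerance [e2 * delta] compensates this. *)
exists delta, (e2 * delta); split; [done|exact: mulr_gt0|move=> n b b' u v hn].
apply: (dchain_map (f := fun p : B1 * B2 * H1 => (p.1.2, D p.2)) _ hn).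
move=> [[b1 c] w] [[b1' c'] z] s; rewrite /cstep.
have := near_neq0l nN1 s; rewrite (skew_eq0 cocP) /= => w0.
have := near_neq0l nN1 s; set w' := (FP _).2 => w'0.
have w'E : w' = (phi 1 c w.1 + (w.2 : R) *: forc 1 (b1, c), w.2) by [].
(* The intermediate point [D w'] separates the two errors: dropping the forcing on one side, the
   jump of the given chain on the other. *)
apply: (near_le nN1 e23); apply: (near_trans dd2 nN1 (q := (theta2 1 c, D w'))) => //.
- split=> /=; [by rewrite mdistxx|exact: D0|].
  have n0 : 0 < N1 (cocycle1 phi 1 c (D w)).
    rewrite nrm_gt0 //; have := skew_eq0 coc1 (c, D w); rewrite /= => ->; exact: D0.
  exists 1; first exact: oner_neq0.
  rewrite scale1r.
  have -> : D w' - cocycle1 phi 1 c (D w) = (delta *: ((w.2 : R) *: forc 1 (b1, c)), 0).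
    rewrite w'E /D /cocycle1 /= (flow_linZ linear_Phi).
    by congr pair; rewrite /= ?subrr // scalerDr addrC addKr.
  rewrite (norm1_infty dot) !(nrmZ nN) gtr0_norm //.
  have h1 := norm1_snd inn (cocycle1 phi 1 c (D w)); rewrite /= in h1.
  have h2 : N (forc 1 (b1, c)) <= C by exact: hC.
  apply: (@le_lt_trans _ _ (delta * (`|w.2 : R| * C))).
    by rewrite ler_pM2l // ler_wpM2l.
  rewrite mulrCA mulrC; apply: (@le_lt_trans _ _ (e2 / 2 * N1 (cocycle1 phi 1 c (D w)))).
    by apply: ler_pM => //; rewrite mulr_ge0 // ltW.
  by rewrite ltr_pM2r //; lra.
- have [s1 s2 [a a0 s3]] := s; split=> /=; last first.
  + exists a => //; rewrite /= -/w' in s3.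
    have -> : a *: D z - D w' = D (a *: z - w').
      by rewrite /D; congr pair; rewrite /= scalerBr !scalerA mulrC.
    apply: le_lt_trans (D_le _) _; apply: (lt_le_trans s3).
    by rewrite -mulrA ler_pM2l.
  + exact: D0.
  + have : e2 * delta <= e2 by rewrite ler_piMr // ltW.
    by move=> le; apply: lt_le_trans le; move: s1; rewrite /max_dist gt_max /= => /andP[].
Qed.

(** Although delta depends on e, the endpoints survive: [(0, 1)] is fixed by the rescaling and
    [(x, 0)] only changes by the scalar delta, which is undone afterwards. *)
Lemma conn_lift_infty_pole b b' x : connP (e1, b, (x, 0)) (e1, b', (0, 1)) ->
  conn1 (b, (x, 0)) (b', (0, 1)).
Proof.
move=> h e e0; have [delta [e' [d0 e'0 hD]]] := rescaled_chain e0.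
have [[//|n] _ /hD] := h _ e'0; rewrite /= scaler0 => hn; exists n.+1 => //.
have := dchain_scale_l nN1 linear_Phi1 (_ : delta^-1 != 0) hn.
rewrite invr_neq0 ?gt_eqF // => /(_ isT).
suff -> : delta^-1 *: ((delta *: x, 0) : H1) = (x, 0) by [].
by congr pair; rewrite /= ?scaler0 // scalerA mulVf ?gt_eqF // scale1r.
Qed.

Lemma conn_lift_pole_infty b b' x : connP (e1, b, (0, 1)) (e1, b', (x, 0)) ->
  conn1 (b, (0, 1)) (b', (x, 0)).
Proof.
move=> h e e0; have [delta [e' [d0 e'0 hD]]] := rescaled_chain e0.
have [[//|n] _ /hD] := h _ e'0; rewrite /= scaler0 => hn; exists n.+1 => //.
have := dchain_scale_r (_ : delta^-1 != 0) hn.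
rewrite invr_neq0 ?gt_eqF // => /(_ isT).
suff -> : delta^-1 *: ((delta *: x, 0) : H1) = (x, 0) by [].
by congr pair; rewrite /= ?scaler0 // scalerA mulVf ?gt_eqF // scale1r.
Qed.

(** * The central bundle over the equilibrium *)

Section Bundles.
Variables (ell : nat) (V : 'I_ell -> set (B2 * H)) (Vc : set (B1 * B2 * H1)).
Hypothesis V_inj : injective V.
Hypothesis V_all : range V = [set W | selgrade_bundle dB2 dot theta2 phi W].
Hypothesis Vc_central :
  central_selgrade_bundle theta1 theta2 phi f dB dot Vc.

Let selgV i : selgrade_bundle dB2 dot theta2 phi (V i) := family_selgrade V_all i.
Let selgVc : selgrade_bundle dB (dot1 dot) theta lift Vc. Proof. by case: Vc_central. Qed.

(** At infinity the lift acts by the linear flow alone, so a chain inside the bundle runs in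
    parallel with any chain of [B1] of the same length. This makes the part at infinity independent
    of the point of [B1]. *)
Lemma conn_bundle_infty i b1 b1' b2 b2' x x' : x != 0 -> x' != 0 ->
  V i (b2, x) -> V i (b2', x') -> connP (b1, b2, (x, 0)) (b1', b2', (x', 0)).
Proof.
move=> x0 x'0; have [M [trM _] ->] := selgV i => Vx Vx' e e0.
have [n1 h1] := flow_mixing (is_dist_mdist B1) (seq_compact_mdist compact_B1) flow1 trans1
  (I : setT b1) (I : setT b1') e0.
have [n2 h2] := bundle_mixing dd2 c2 nN linear_Phi trM (Vx x0) (Vx' x'0) e0.
exists (maxn n1 n2).+1 => //.
have hn := dchain_prod (h1 _ (leqW (leq_maxl n1 n2))) (h2 _ (leqW (leq_maxr n1 n2))).
apply: (dchain_map (f := fun p : B1 * (B2 * H) => (p.1, p.2.1, (p.2.2, 0) : H1)) _ hn).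
move=> [c1 [c z]] [c1' [c' z']] [/= s1 s2]; rewrite /cstep /skew_map /= /lift_cocycle /=.
rewrite scale0r addr0; apply: (near_infty s2).
by case: s2 => /= h _ _; rewrite /max_dist gt_max /= s1.
Qed.

Let pair_sum (J : {pred 'I_ell}) (y : 'I_ell -> H) :
  \sum_(i | J i) ((y i, 0) : H1) = (\sum_(i | J i) y i, 0).
Proof. by elim/big_rec2: _ => // i z _ _ ->; congr pair; rewrite /= addr0. Qed.

(** Each bundle coordinate lies in [P] or in [Q]; grouping the coordinates splits the whole
    vector. *)
Lemma infty_coords (P Q : {vspace H1}) (y : 'I_ell -> H) :
  (forall i, ((y i, 0) : H1) \in P \/ ((y i, 0) : H1) \in Q) ->
  let S := \sum_(i | ((y i, 0) : H1) \notin P) ((y i, 0) : H1) in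
  S \in Q /\ (\sum_i y i, 0) - S \in P.
Proof.
move=> PQ S; split.
  by apply: memv_suml => i yP; have [h|//] := PQ i; rewrite h in yP.
rewrite -(pair_sum predT) (bigID (fun i => ((y i, 0) : H1) \in P)) /= addrK.
exact: memv_suml.
Qed.

Lemma family_infty_cases (PP QQ : B1 * B2 -> {vspace H1}) b1 b2 (y : 'I_ell -> H) :
  (forall b u, connP (b, u) (b, u) -> u \in PP b \/ u \in QQ b) ->
  (forall i, V i (b2, y i)) ->
  forall i, ((y i, 0) : H1) \in PP (b1, b2) \/ ((y i, 0) : H1) \in QQ (b1, b2).
Proof.
move=> PQ Vy i; have [->|y0] := eqVneq (y i) 0; first by left; exact: mem0v.
by apply: PQ; exact: (conn_bundle_infty _ _ y0 y0 (Vy i) (Vy i)).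
Qed.

Lemma conn_pole_equilibrium b b' : connP (e1, b, (0, 1)) (e1, b', (0, 1)).
Proof. exact/conn_equilibrium/conn_pole. Qed.

(* If the pole were not chain equivalent to a point of Vc off infinity, a repeller
   would contain that point while its fiber over e1 lies at infinity; but the part at
   infinity does not depend on b1, so both fibers coincide by dimension. *)
Lemma conn_central_pole b1 b2 (u : H1) : Vc (b1, b2, u) -> u.2 != 0 ->
  connP (b1, b2, u) (e1, b2, (0, 1)) /\ connP (e1, b2, (0, 1)) (b1, b2, u).
Proof.
move=> Vu u0.
have un0 : u != 0 by apply: contraNneq u0 => ->.
have uu : connP (b1, b2, u) (b1, b2, u) by exact: (bundle_conn dd cB nN1 linear_lift selgVc).
apply: contrapT => npu.
have [|PP [QQ [PQ0 dPQ PQ [_ eqQ] [poleP uQ]]]] :=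
  separation cocP btP (conn_pole_equilibrium b2 b2) uu; first by move=> [? ?]; apply: npu.
rewrite /= in poleP uQ.
have sub (v : H1) : v \in QQ (e1, b2) -> v \in QQ (b1, b2) /\ v.2 = 0.
  case: v => x s vQ.
  have [y [Vy xE]] := family_span dd2 c2 nN linear_Phi trans2 V_all b2 x.
  have yPQ := @family_infty_cases PP QQ e1 b2 y PQ Vy.
  have vE : (x, s) = s *: ((0, 1) : H1) + (x, 0).
    by congr pair; rewrite /= ?scaler0 ?add0r // addr0 /GRing.scale /= mulr1.
  have [SQ SP] := infty_coords yPQ; rewrite -xE in SP.
  (* The difference of the two sides lies in [QQ], and also in [PP], as [s] times the pole plus the
     coordinates in [PP]; so it vanishes. *)
  have -> : (x, s) = \sum_(i | ((y i, 0) : H1) \notin PP (e1, b2)) ((y i, 0) : H1).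
    apply/eqP; rewrite -subr_eq0; apply/eqP; apply: (PQ0 (e1, b2)); last by rewrite memvB.
    by rewrite vE -addrA memvD // memvZ.
  split; last by rewrite pair_sum.
  apply: memv_suml => i yP; have [->|y0] := eqVneq (y i) 0; first exact: mem0v.
  have yQ : ((y i, 0) : H1) \in QQ (e1, b2) by have [h|//] := yPQ i; rewrite h in yP.
  (* Each coordinate in the repeller over [e1] is chain equivalent to the same vector over [b1], so
     it is in the repeller there too. *)
  apply: (eqQ (e1, b2, (y i, 0)) (b1, b2, (y i, 0))) yQ; exact: conn_bundle_infty.
have /eqP QE : QQ (e1, b2) == QQ (b1, b2).
  rewrite eqEdim; apply/andP; split; first by apply/subvP => v /sub[].
  by have := dPQ (e1, b2) (e1, b2); have := dPQ (e1, b2) (b1, b2); lia.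
by move: uQ; rewrite -QE => /sub[_ h]; rewrite h eqxx in u0.
Qed.

Lemma central_pole b : Vc (e1, b, (0, 1)).
Proof.
have [_ [[[b1 b2] u] Vu u0]] := Vc_central; rewrite /= in u0.
have [h1 h2] := conn_central_pole Vu u0.
have un0 : u != 0 by apply: contraNneq u0 => ->.
apply: (bundle_absorb dd cB nN1 linear_lift selgVc un0 Vu).
- exact: conn_trans h1 (conn_pole_equilibrium _ _).
- exact: conn_trans (conn_pole_equilibrium _ _) h2.
Qed.

Let A := [set i | chain_transitive (max_dist dB2 (proj_dist (dot1 dot)))
                    (proj_flow theta2 (cocycle1 phi)) (h1 (V i))].

(** Since 0 is in the fiber of [V i], the set [h1 (V i)] contains the pole. Hence (x, 1) is chain
    equivalent to (0, 1), and so is their difference (x, 0) by [class_lin]. *)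
Lemma central_infty i b x : A i -> V i (b, x) -> Vc (e1, b, (x, 0)).
Proof.
move=> Ai Vx; have [->|x0] := eqVneq x 0; first exact: (bundle0 _ selgVc).
have /(chain_transitive_conn dd2 c2 nN1 linear_Phi1) tr := Ai.
have Vx0 : V i (b, 0) by exact: (bundle0 _ (selgV i)).
have hx y : V i (b, y) -> h1 (V i) (b, proj (pair1_neq0 y)) by move=> Vy; exists (b, y).
have [|||c1' c2'] := class_lin coc1 (p := (b, (0, 1))) (b := b) (a := -1)
  (x := (0, 1) : H1) (y := (x, 1) : H1).
- by move=> _; split; exact: conn_pole.
- move=> _; split; first exact: (tr _ _ _ _ _ _ (hx _ Vx0) (hx _ Vx)).
  exact: (tr _ _ _ _ _ _ (hx _ Vx) (hx _ Vx0)).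
- have -> : -1 *: ((0, 1) : H1) + (x, 1) = (x, 0).
    by congr pair; rewrite /= ?scaler0 ?add0r // scaleN1r addNr.
  by rewrite -pair_eqE /= /pair_eq /= negb_and x0.
have E : -1 *: ((0, 1) : H1) + (x, 1) = (x, 0).
  by congr pair; rewrite /= ?scaler0 ?add0r // scaleN1r addNr.
rewrite E in c1' c2'.
apply: (bundle_absorb dd cB nN1 linear_lift selgVc (pair1_neq0 0) (central_pole b)).
- exact: conn_equilibrium.
- exact: conn_equilibrium.
Qed.

(** A single equivalence of the pole with (x, 0) spreads over the bundle: every nonzero (y, 0) is
    equivalent to (x, 0), and (y, 1) is the sum of the pole and (y, 0). Then all of [h1 (V i)] is
    one class. *)
Lemma infty_not_central i b x : ~ A i -> V i (b, x) -> x != 0 ->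
  ~ (connP (e1, b, (0, 1)) (e1, b, (x, 0)) /\ connP (e1, b, (x, 0)) (e1, b, (0, 1))).
Proof.
move=> nA Vx x0 [/conn_lift_pole_infty px /conn_lift_infty_pole xp]; apply: nA.
have cls c y : V i (c, y) ->
    conn1 (b, (0, 1)) (c, (y, 1)) /\ conn1 (c, (y, 1)) (b, (0, 1)).
  move=> Vy; have E : ((y, 1) : H1) = 1 *: (0, 1) + (y, 0).
    by congr pair; rewrite /= ?scale1r ?add0r ?addr0.
  rewrite E; apply: (class_lin coc1).
  - by move=> _; split; exact: conn_pole.
  - move=> yn0; have y0 : y != 0.
      by apply: contraNneq yn0 => ->.
    have h1 := bundle_conn dd2 c2 nN linear_Phi (selgV i) x0 y0 Vx Vy.
    have h2 := bundle_conn dd2 c2 nN linear_Phi (selgV i) y0 x0 Vy Vx.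
    by split; [exact: conn_trans px (conn_infty h1)|exact: conn_trans (conn_infty h2) xp].
  - by rewrite -E pair1_neq0.
apply/(chain_transitive_conn dd2 c2 nN1 linear_Phi1).
have scale c (u : H1) (u0 : u != 0) : h1 (V i) (c, proj u0) ->
    exists y k, [/\ V i (c, y), k != 0 & u = k *: ((y, 1) : H1)].
  move=> [[c' y] /= Vy /pair_equal_spec[<- pE]].
  have : u \in val (proj (pair1_neq0 y)) by rewrite pE; exact: mem_proj.
  move=> /vlineP[k kE]; exists y, k; split=> //.
  by apply: (contraNneq _ u0) => k0; rewrite kE k0 scale0r.
move=> c u u0 c' u' u'0 /scale[y [k [Vy k0 ->]]] /scale[y' [k' [Vy' k'0 ->]]].
apply: (conn_scale_l nN1 linear_Phi1 k0); apply: conn_scale_r => //.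
exact: conn_trans (cls _ _ Vy).2 (cls _ _ Vy').1.
Qed.

(** Suppose the coordinate of an index outside [A] is nonzero, and separate it from the pole. The
    vector (x, 0) is equivalent to the pole, hence on its side, so the coordinates not on that side
    sum to zero; independence of the Selgrade bundles makes each of them zero. *)
Lemma central_coords b (u : H1) : Vc (e1, b, u) ->
  exists y : 'I_ell -> H, [/\ forall i, V i (b, y i), u.1 = \sum_i y i &
    forall i, ~ A i -> y i = 0].
Proof.
case: u => x r Vu.
have Vx : Vc (e1, b, (x, 0)).
  have := bundle_lin dd cB nN1 linear_lift (- r : R) selgVc (central_pole b) Vu.
  suff -> : (- r : R) *: ((0, 1) : H1) + (x, r) = (x, 0) by [].
  by congr pair; rewrite /= ?scaler0 ?add0r // /GRing.scale /= mulr1 addNr.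
have [y [Vy xE]] := family_span dd2 c2 nN linear_Phi trans2 V_all b x.
exists y; split=> // i nAi; apply: contrapT => /eqP y0.
have yn0 : ((y i, 0) : H1) != 0 by rewrite -pair_eqE /= /pair_eq /= negb_and y0.
have yy : connP (e1, b, (y i, 0)) (e1, b, (y i, 0)).
  exact: (conn_bundle_infty _ _ y0 y0 (Vy i) (Vy i)).
have [PP [QQ [PQ0 _ PQ [eqP' eqQ] [yP poleQ]]]] := separation cocP btP yy
  (conn_pole_equilibrium b b) (fun h => infty_not_central nAi (Vy i) y0 (conj h.2 h.1)).
rewrite /= in yP poleQ.
have xQ : ((x, 0) : H1) \in QQ (e1, b).
  have [->|x0] := eqVneq x 0; first exact: mem0v.
  have xn0 : ((x, 0) : H1) != 0 by rewrite -pair_eqE /= /pair_eq /= negb_and x0.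
  apply: (eqQ (e1, b, (0, 1)) (e1, b, (x, 0))) poleQ.
  - exact: (bundle_conn dd cB nN1 linear_lift selgVc (pair1_neq0 0) xn0 (central_pole b)).
  - exact: (bundle_conn dd cB nN1 linear_lift selgVc xn0 (pair1_neq0 0) Vx (central_pole b)).
(* The two spaces are exchanged: here the sum of the coordinates outside [QQ] is the one to be shown
   zero. *)
have QP j : ((y j, 0) : H1) \in QQ (e1, b) \/ ((y j, 0) : H1) \in PP (e1, b).
  by rewrite or_comm; exact: (@family_infty_cases PP QQ e1 b y PQ Vy).
have [SP SQ] := infty_coords QP; rewrite -xE in SQ.
have QP0 (v : H1) : v \in QQ (e1, b) -> v \in PP (e1, b) -> v = 0.
  by move=> vQ vP; exact: PQ0 vP vQ.
pose J := [set j | ((y j, 0) : H1) \notin QQ (e1, b)]%SET.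
have sJ : \sum_(j in J) y j = 0.
  have : \sum_(j | ((y j, 0) : H1) \notin QQ (e1, b)) ((y j, 0) : H1) = 0.
    by apply: QP0 => //; rewrite -[X in X \in _](subKr ((x, 0) : H1)) memvB.
  by rewrite pair_sum => -[s0]; rewrite -[RHS]s0; apply: eq_bigl => j; rewrite inE.
have iJ : i \in J.
  rewrite inE; apply/negP => yQ; move: yn0.
  by rewrite (QP0 _ yQ yP) eqxx.
have yi0 := family_independent dd2 c2 nN linear_Phi trans2 V_inj V_all
  (fun j _ => Vy j) sJ iJ.
by rewrite yi0 eqxx in y0.
Qed.

End Bundles.
End SplitAffineFlow.

Theorem theorem19 (R : realType) (B1 B2 : metricType R) (H : vectType R)
    (dot : {dot H for idfun})
    (theta1 : R -> B1 -> B1) (theta2 : R -> B2 -> B2) (e1 : B1)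
    (phi : R -> B2 -> H -> H) (f : B1 -> R -> H)
    (ell : nat) (V : 'I_ell -> set (B2 * H)) (Vc : set (B1 * B2 * (H * R^o)))
    (compact_B1 : compact [set: B1]) (compact_B2 : compact [set: B2])
    (flow1 : is_flow mdist theta1) (flow2 : is_flow mdist theta2)
    (trans1 : chain_transitive mdist theta1 setT)
    (trans2 : chain_transitive mdist theta2 setT)
    (equilibrium : forall t, theta1 t e1 = e1)
    (linear_Phi : is_linear_flow mdist dot theta2 phi)
    (forcing_f : is_forcing_family theta1 f e1)
    (flow_Psi : is_flow (max_dist (max_dist mdist mdist) (dot_dist dot))
                        (split_affine_flow theta1 theta2 phi f))
    (V_inj : injective V)
    (V_all : range V = [set W | selgrade_bundle mdist dot theta2 phi W])
    (Vc_central : central_selgrade_bundle theta1 theta2 phi f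
                    (max_dist mdist mdist) dot Vc) :
  let Vinfty i := bundle_at_infty (V i) in
  let A := [set i | chain_transitive
                      (max_dist mdist (proj_dist (dot1 dot)))
                      (proj_flow theta2 (cocycle1 phi)) (h1 (V i))] in
  [/\ bundle_bigsum_direct A Vinfty,
      bundle_sum_direct (polar_bundle B2 H) (bundle_bigsum A Vinfty) &
      Vc `&` over_point e1 setT =
      over_point e1
        (bundle_sum (polar_bundle B2 H) (bundle_bigsum A Vinfty))].
Proof.
have dd2 := is_dist_mdist B2; have c2 := seq_compact_mdist compact_B2.
have nN := inner_norm (dot_inner dot); have nN1 := inner_norm (dot1_inner (dot_inner dot)).
have [_ fe1 _] := forcing_f; move=> Vinfty A.
have fst_sum (J : {pred 'I_ell}) (z : 'I_ell -> H * R^o) :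
    (\sum_(i | J i) z i).1 = \sum_(i | J i) (z i).1.
  exact: (big_morph fst (fun _ _ => erefl) erefl).
have snd_sum (J : {pred 'I_ell}) (z : 'I_ell -> H * R^o) :
    (\sum_(i | J i) z i).2 = \sum_(i | J i) (z i).2.
  exact: (big_morph snd (fun _ _ => erefl) erefl).
split.
- move=> b z Vz sz i Ai.
  have sz1 : \sum_(j in [set j | j \in A]%SET) (z j).1 = 0.
    rewrite (eq_bigl (fun j => j \in A)) => [|j]; last by rewrite inE.
    by rewrite -fst_sum sz.
  have z10 := family_independent dd2 c2 nN linear_Phi trans2 V_inj V_all (b := b) _ sz1.
  rewrite [LHS]surjective_pairing (Vz i Ai).2 z10 //.
    by move=> j; rewrite !inE => /Vz[].
  by rewrite inE; apply: mem_set.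
- move=> b [x r] /= x0 [z [Vz]] /= zE; rewrite /polar_bundle /= in x0.
  have r0 : r = 0.
    have := congr1 snd zE; rewrite snd_sum /= => ->.
    by apply: big1 => i; rewrite in_setE => /Vz[].
  by rewrite x0 r0.
- apply/seteqP; split=> [[[b1 b2] [x r]] [Vp [/= b1E _]]|].
    rewrite b1E in Vp *; split=> //=.
    have [y [Vy /= xE yA]] := central_coords compact_B1 compact_B2 flow1 flow2 trans1
      trans2 equilibrium linear_Phi fe1 flow_Psi V_inj V_all Vc_central Vp.
    exists (0, r), (x, 0); split=> //=; last by congr pair; rewrite /= ?add0r ?addr0.
    exists (fun i => (y i, 0)); split=> [i Ai|/=]; first by split; [exact: Vy|].
    rewrite [RHS]surjective_pairing fst_sum snd_sum big1_eq /=; congr pair.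
    rewrite xE (bigID (fun i => i \in A)) /= [X in _ + X]big1 ?addr0 // => i.
    by rewrite notin_setE => /yA.
move=> [[b1 b2] u] [/= b1E [v [w [v0 [z [Vz wE]] uE]]]]; rewrite /= in uE v0 wE *.
rewrite b1E {b1 b1E}; split=> //.
have [selgVc _] := Vc_central.
have linP := linear_lift flow1 linear_Phi flow_Psi.
have cB : seq_compact (max_dist (@mdist R B1) (@mdist R B2)).
  by apply: seq_compact_max; exact: seq_compact_mdist.
have dd : is_dist (max_dist (@mdist R B1) (@mdist R B2)).
  by apply: is_dist_max; exact: is_dist_mdist.
(* The fibers of [Vc] are linear, so it is enough to place the pole and each summand at infinity in
   [Vc]. *)
rewrite uE; apply: (bundleD dd cB nN1 linP selgVc).
  have -> : v = (v.2 : R) *: ((0, 1) : H * R^o).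
    rewrite [LHS]surjective_pairing [v.1]v0; congr pair; rewrite /= ?scaler0 //.
    by rewrite /GRing.scale /= mulr1.
  apply: (bundleZ dd cB nN1 linP _ selgVc).
  exact: (central_pole compact_B1 compact_B2 flow1 flow2 trans1 trans2 equilibrium
    linear_Phi fe1 flow_Psi V_all Vc_central).
rewrite wE; elim/big_rec: _ => [|i s Ai Vs]; first exact: (bundle0 _ selgVc).
apply: (bundleD dd cB nN1 linP selgVc) => //; rewrite in_setE in Ai.
have [Vzi zi0] := Vz i Ai; rewrite [z i]surjective_pairing [(z i).2]zi0.
exact: (central_infty compact_B1 compact_B2 flow1 flow2 trans1 trans2 equilibrium
  linear_Phi fe1 flow_Psi V_all Vc_central Ai Vzi).
Qed.
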